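(* Let $P(z)$ be an NCIP over $\mathbb{C}$ of degree $n\ge 6$ having only simple zeros and with $t=t'=3$; i.e., exactly three of the sets $B_i(H_2)$ are non-empty and each of these is a singleton, say $B_1(H_2)=\{d_1\}$, $B_2(H_2)=\{d_2\}$, $B_3(H_2)=\{d_3\}$. Let $$P'(z)=(z-d_1)(z-d_2)(z-d_3)Q(z),$$ where $Q(z)$ is a polynomial of degree $\ge 2$ and $d_1,d_2,d_3$ are simple zeros of $P'$. Assume: (a) $Q'(d_j)\neq 0$ for $j\in\{1,2,3\}$; (b) for all distinct $i,j,k\in\{1,2,3\}$, $$\frac{Q'(d_j)}{Q(d_j)}\neq\frac{2d_i+2d_k-4d_j}{(d_j-d_k)(d_j-d_i)};$$ (c) for all distinct $i,j,k\in\{1,2,3\}$ and every $\xi\neq d_k$ with $P(\xi)=P(d_k)$, $$\frac{Q(\xi)}{Q(d_k)}\neq\frac{(d_k-d_i)^2(d_k-d_j)^2}{(\xi-d_i)^2(\xi-d_j)^2}.$$ Then $P(z)$ is a UPM in $\mathbb{C}$ whenever, for all distinct $i,j,k\in\{1,2,3\}$, one of the following holds: (i) $d_k\neq 2d_i-d_j$; or (ii) $d_k=2d_i-d_j$ and $\dfrac{Q'(d_j)}{Q(d_j)}\neq\dfrac{3}{d_k-d_i}$.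
   Context: $\mathcal{M}(\mathbb{C})$ denotes the field of meromorphic functions in $\mathbb{C}$. A non-constant polynomial $P$ is a UPM in $\mathbb{C}$ if for any two non-constant $f,g\in\mathcal{M}(\mathbb{C})$, the identity $P(f)=P(g)$ implies $f=g$. A polynomial $P$ is a CIP (critically injective polynomial) if $P(d)\neq P(d')$ for any two distinct zeros $d,d'$ of $P'$; otherwise it is an NCIP. Definition of $B_i(H_2)$, $t$, $t'$. Let $S$ be the set of distinct zeros of $P'$, and for $d\in S$ let $q_d\ge 1$ be the multiplicity of $d$ as a zero of $P'$. Partition $S$ into ''columns'' $C_1,C_2,\dots$, namely the classes of the equivalence relation $d\sim d'\iff P(d)=P(d')$. Let $C_i'$ be the list (with repetitions) of the multiplicities $q_d$, $d\in C_i$. Let $A_i$ be the set of values that occur exactly once in the list $C_i'$. Put $A_i(H_1)=\{q\in A_i: q>q' \text{ for all } q' \text{ in } C_i' \text{ with } q'\notin A_i\}$, $A_i(H_2)=\{q\in A_i(H_1): \max A_i(H_1)+1<2(q+1)\}$, $B_i(H_2)=\{d\in C_i: q_d\in A_i(H_2)\}$. Then $t=|\{i: B_i(H_2)\neq\emptyset\}|$ and $t'=|\bigcup_i B_i(H_2)|$. *)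

(* Defs.v *)
From HB Require Import structures.
From mathcomp Require Import all_boot all_order all_algebra.
From mathcomp Require Import boolp classical_sets reals topology normedtype derive.
From mathcomp Require Import complex.

Set Implicit Arguments.
Unset Strict Implicit.
Unset Printing Implicit Defensive.

Import Order.TTheory GRing.Theory Num.Theory.
Import numFieldNormedType.Exports.

Local Open Scope classical_set_scope.
Local Open Scope complex_scope.
Local Open Scope ring_scope.

(* The ambient field of complex numbers is [R[i]] with [R : realType].  The
   alias [R[i]^o] carries the topology of the norm and makes [R[i]] a normed
   module over itself, so [derivable f w 1] is complex differentiability. *)
Definition holomorphic_at (R : realType) (h : R[i] -> R[i]) (z : R[i]) : Prop :=
  \forall w \near (z : R[i]^o), derivable (h : R[i]^o -> R[i]^o) w 1.

(* A meromorphic function is total with values in [option R[i]], where [None]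
   is the value at a pole; equality of meromorphic functions is then equality
   of functions. *)
Definition regular_at (R : realType) (f : R[i] -> option R[i]) (z : R[i]) :
    Prop :=
  exists2 h : R[i] -> R[i], holomorphic_at h z &
    \forall w \near (z : R[i]^o), f w = Some (h w).

Definition pole_at (R : realType) (f : R[i] -> option R[i]) (z : R[i]) : Prop :=
  f z = None /\
  exists (m : nat) (h : R[i] -> R[i]),
    [/\ (0 < m)%N, holomorphic_at h z, h z != 0 &
        \forall w \near (z : R[i]^o),
          w != z -> f w = Some (h w / (w - z) ^+ m)].

Definition meromorphic (R : realType) (f : R[i] -> option R[i]) : Prop :=
  forall z, regular_at f z \/ pole_at f z.

Definition constant_fun (R : realType) (f : R[i] -> option R[i]) : Prop :=
  exists c : R[i], forall z, f z = Some c.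

(* [P(f)].  Poles of [f] are sent to poles, which is the right convention for
   non-constant [P], the only case in which this is used. *)
Definition poly_comp (R : realType) (P : {poly R[i]}) (f : R[i] -> option R[i]) :
    R[i] -> option R[i] :=
  fun z => omap (horner P) (f z).

Definition UPM (R : realType) (P : {poly R[i]}) : Prop :=
  (1 < size P)%N /\
  forall f g : R[i] -> option R[i],
    meromorphic f -> meromorphic g -> ~ constant_fun f -> ~ constant_fun g ->
    (forall z, poly_comp P f z = poly_comp P g z) -> forall z, f z = g z.

Definition CIP (R : realType) (P : {poly R[i]}) : Prop :=
  forall d d' : R[i],
    root P^`() d -> root P^`() d' -> d != d' -> P.[d] != P.[d'].

Definition NCIP (R : realType) (P : {poly R[i]}) : Prop := ~ CIP P.

Definition crit_points (R : realType) (P : {poly R[i]}) : seq R[i] :=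
  undup (sval (closed_field_poly_normal P^`())).

Lemma mem_crit_points (R : realType) (P : {poly R[i]}) (z : R[i]) :
  P^`() != 0 -> (z \in crit_points P) = root P^`() z.
Proof.
move=> nz; rewrite /crit_points mem_undup.
case: (closed_field_poly_normal P^`()) => r /= Er.
by rewrite [in RHS]Er rootZ ?lead_coef_eq0// root_prod_XsubC.
Qed.

(* The filter keeps the order of [crit_points P], so equivalent critical points
   yield the same sequence and [undup] leaves one copy of each class. *)
Definition columns (R : realType) (P : {poly R[i]}) : seq (seq R[i]) :=
  undup [seq [seq d' <- crit_points P | P.[d'] == P.[d]] | d <- crit_points P].

Definition mults (R : realType) (P : {poly R[i]}) (c : seq R[i]) : seq nat :=
  [seq mup d P^`() | d <- c].

Definition setA (s : seq nat) : seq nat := [seq q <- s | count_mem q s == 1%N].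

Definition setA_H1 (s : seq nat) : seq nat :=
  [seq q <- setA s | all (fun q' => (q' \notin setA s) ==> (q' < q)%N) s].

Definition setA_H2 (s : seq nat) : seq nat :=
  [seq q <- setA_H1 s |
     (\max_(q' <- setA_H1 s) q' + 1 < 2 * (q + 1))%N].

Definition setB_H2 (R : realType) (P : {poly R[i]}) (c : seq R[i]) : seq R[i] :=
  [seq d <- c | mup d P^`() \in setA_H2 (mults P c)].

Definition t_H2 (R : realType) (P : {poly R[i]}) : nat :=
  count (fun c => setB_H2 P c != [::]) (columns P).

Definition t'_H2 (R : realType) (P : {poly R[i]}) : nat :=
  size (undup (flatten [seq setB_H2 P c | c <- columns P])).

(* Main.v *)
Require Import Defs.
From HB Require Import structures.
From mathcomp Require Import all_boot all_order all_algebra.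
From mathcomp Require Import boolp classical_sets reals constructive_ereal.
From mathcomp Require Import topology normedtype derive realfun.
From mathcomp Require Import measure lebesgue_measure lebesgue_integral ftc.
From mathcomp Require Import complex polyXY polydiv ring lra zify.

Set Implicit Arguments.
Unset Strict Implicit.
Unset Printing Implicit Defensive.

Import Order.TTheory GRing.Theory Num.Theory.
Import numFieldNormedType.Exports.

Local Open Scope classical_set_scope.
Local Open Scope ring_scope.
Local Open Scope complex_scope.

(** Suppose that [P(f) = P(g)] with [f], [g] meromorphic, non-constant and
    distinct.  What the combinatorial hypotheses say about the [d j] is that each
    is a simple zero of [P'] and that no other critical point has the same
    critical value ([column_singleton]).  Therefore the curve [P(x) = P(y)],
    [x <> y], is smooth with known tangents above [x = d j] and [y = d j], and
    the form
      [(x - y) dx / prod_j (y - d j)]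
    is holomorphic on its compactification: its possible poles at [y = d j] are
    cancelled either by [x - y] or by the ramification of [y], and the three
    factors of the denominator are what is needed at infinity.  Its coefficient along [(f, g)]
    therefore extends to an entire function [u] ([entire_form]); so does the
    coefficient [v] of the form obtained by exchanging [x] and [y].  As
    [P'(x) dx = P'(y) dy], one has [u Q(f) + v Q(g) = 0] ([form_relation]).

    Two independent holomorphic forms leave no room for a non-constant entire
    curve.  By the rescaling argument of Bloch, Zalcman and Brody
    ([point_picking]) there are discs, arbitrarily large at the scale
    [1 / (|u| + |v|)] of their centre, on which [|u| + |v|] is at most twice
    its value at the centre; Cauchy's estimate makes [u] and [v] almost constant
    on the concentric disc of radius [1 / (|u| + |v|)].  There
    [a1 Q(f) + a2 Q(g)] is relatively small for some constants [a1], [a2].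
    The polynomial [a1 Q(x) + a2 Q(y)] has no component in common with the curve
    ([no_common_factor]): a common component would have a point above [x = d 0],
    and the gradients of the two equations at such a point are not proportional
    because [Q'(d 0) <> 0].  Eliminating [y] bounds a non-zero polynomial at
    [f], so that [f] stays close to finitely many points of
    the Riemann sphere ([confinement]), by
    connectedness to one of them ([cluster]), and so does [g].  Cauchy's
    estimate now makes the spherical derivatives of [f] and [g] small
    ([spherical_small]).  But a holomorphic form is bounded by the spherical
    metrics ([form_bound]), so [u] and [v] are smaller at the centre than the
    scale of the disc allows.  Uniformity in [(a1, a2)] comes from compactness
    of the unit disc after normalising one of them to [1].

    The complex analysis is built on Goursat's theorem for rectangles.  It gives
    Cauchy's formula on squares, and from it the removal of singularities, the
    differentiability of derivatives, Cauchy's estimate and the factorization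
    [h = (z - z0)^m k] of holomorphic functions, hence the identity theorem for
    meromorphic functions.  Integrals of complex functions along segments are
    differences of real antiderivatives. *)

(** * The modulus, neighbourhoods and complex derivatives *)

Section modulus.
Variable R : realType.
Local Notation C := R[i].
Implicit Types (x y z : C) (a b : R).

(** Real-valued, whereas the norm of [R[i]] takes its values in [R[i]]. *)
Definition cabs z : R := complex.Re `|z|.

Lemma normr_cabs z : `|z| = (cabs z)%:C.
Proof. by rewrite /cabs normc_def. Qed.

Lemma cabs0 : cabs 0 = 0. Proof. by rewrite /cabs normr0. Qed.
Lemma cabs1 : cabs 1 = 1. Proof. by rewrite /cabs normr1. Qed.

Lemma cabs_ge0 z : 0 <= cabs z.
Proof. by have := normr_ge0 z; rewrite normr_cabs lecR. Qed.

Lemma cabs_eq0 z : (cabs z == 0) = (z == 0).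
Proof. by rewrite -(normr_eq0 z) normr_cabs -(inj_eq (@complexI R)). Qed.

Lemma cabs_gt0 z : (0 < cabs z) = (z != 0).
Proof. by rewrite lt_def cabs_ge0 andbT cabs_eq0. Qed.

Lemma cabsM x y : cabs (x * y) = cabs x * cabs y.
Proof. by apply: complexI; rewrite rmorphM /= -!normr_cabs normrM. Qed.

Lemma cabsN z : cabs (- z) = cabs z.
Proof. by rewrite /cabs normrN. Qed.

Lemma cabsC x y : cabs (x - y) = cabs (y - x).
Proof. by rewrite -cabsN opprB. Qed.

Lemma cabsD x y : cabs (x + y) <= cabs x + cabs y.
Proof. by have := ler_normD x y; rewrite !normr_cabs -rmorphD /= lecR. Qed.

Lemma cabsB x y : cabs (x - y) <= cabs x + cabs y.
Proof. by rewrite (le_trans (cabsD _ _))// cabsN. Qed.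

Lemma cabs_subD y x z : cabs (x - z) <= cabs (x - y) + cabs (y - z).
Proof. by rewrite (le_trans _ (cabsD _ _))// addrA subrK. Qed.

Lemma cabs_subl x y : cabs x - cabs y <= cabs (x - y).
Proof. by rewrite lerBlDr (le_trans _ (cabsD _ _))// subrK. Qed.

Lemma cabsV z : cabs z^-1 = (cabs z)^-1.
Proof. by apply: complexI; rewrite fmorphV /= -!normr_cabs normfV. Qed.

Lemma cabsX n z : cabs (z ^+ n) = cabs z ^+ n.
Proof. by elim: n => [|n IH]; rewrite ?expr0 ?cabs1// !exprS cabsM IH. Qed.

Lemma cabs_real a : cabs a%:C = `|a|.
Proof.
by rewrite /cabs normc_def /= expr0n addr0 sqrtr_sqr.
Qed.

Lemma cabs_nat n : cabs n%:R = n%:R.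
Proof. by rewrite /cabs normr_nat raddfMn. Qed.

Lemma cabs_i : cabs 'i%C = 1.
Proof. by rewrite /cabs normc_def /= expr0n add0r expr1n sqrtr1. Qed.

Lemma Re_le_cabs z : `|complex.Re z| <= cabs z.
Proof. by have := normc_ge_Re z; rewrite normr_cabs lecR. Qed.

Lemma Im_le_cabs z : `|complex.Im z| <= cabs z.
Proof.
have -> : complex.Im z = - complex.Re (z * 'i%C) by rewrite ReiNIm opprK.
by rewrite normrN (le_trans (Re_le_cabs _))// cabsM cabs_i mulr1.
Qed.

Lemma cabs_le_ReIm z : cabs z <= `|complex.Re z| + `|complex.Im z|.
Proof.
rewrite [in leLHS](complexE z) (le_trans (cabsD _ _))//.
by rewrite cabsM cabs_i mul1r !cabs_real.
Qed.

Lemma cabs_sum (I : Type) (s : seq I) (F : I -> C) :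
  cabs (\sum_(i <- s) F i) <= \sum_(i <- s) cabs (F i).
Proof.
elim/big_rec2 : _ => [|i a z _ IH]; first by rewrite cabs0.
by rewrite (le_trans (cabsD _ _))// lerD2l.
Qed.

Lemma cabs_prod (I : Type) (s : seq I) (P : pred I) (F : I -> C) :
  cabs (\prod_(i <- s | P i) F i) = \prod_(i <- s | P i) cabs (F i).
Proof.
elim/big_rec2 : _ => [|i a z _ IH]; first by rewrite cabs1.
by rewrite cabsM IH.
Qed.

Lemma cabs_lt0_eq0 z : (forall e, 0 < e -> cabs z < e) -> z = 0.
Proof.
move=> H; apply/eqP; rewrite -cabs_eq0 eq_le cabs_ge0 andbT leNgt.
by apply/negP => /H; rewrite ltxx.
Qed.

End modulus.

Section neighbourhoods.
Variable R : realType.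
Local Notation C := R[i].
Implicit Types (z : C) (S T : C -> Prop).

Definition nbh z S : Prop :=
  exists2 d : R, 0 < d & forall w, cabs (w - z) < d -> S w.

(** Neighbourhoods of the normed space [R[i]^o] described with real radii. *)
Lemma nbhE z S : (\forall w \near (z : R[i]^o), S w) <-> nbh z S.
Proof.
split => [/nbhs_ballP[e /= e0 H]|[d d0 H]].
- have ereal : e = (complex.Re e)%:C by rewrite RRe_real// ger0_real// ltW.
  exists (complex.Re e); first by rewrite -ltcR -ereal.
  move=> w wz; apply: H; rewrite -ball_normE /= distrC.
  by change (`|w - z : C| < e); rewrite normr_cabs ereal ltcR.
- apply/nbhs_ballP; exists d%:C; first by rewrite /= ltcR.
  move=> w; rewrite -ball_normE /= distrC => wz; apply: H.
  by move: wz; change (`|w - z : C| < d%:C -> cabs (w - z) < d); rewrite normr_cabs ltcR.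
Qed.

Lemma nbhS z S T : (forall w, S w -> T w) -> nbh z S -> nbh z T.
Proof. by move=> ST [d d0 H]; exists d => // w /H/ST. Qed.

Lemma nbhI z S T : nbh z S -> nbh z T -> nbh z (fun w => S w /\ T w).
Proof.
move=> [d d0 H] [d' d'0 H']; exists (Num.min d d'); first by rewrite lt_min d0.
by move=> w; rewrite lt_min => /andP[/H ? /H' ?].
Qed.

Lemma nbhS2 z S T U :
  (forall w, S w -> T w -> U w) -> nbh z S -> nbh z T -> nbh z U.
Proof. by move=> STU zS /(nbhI zS); apply: nbhS => w []; exact: STU. Qed.

Lemma nbhT z S : (forall w, S w) -> nbh z S.
Proof. by move=> H; exists 1. Qed.

Lemma nbh_center z S : nbh z S -> S z.
Proof. by move=> [d d0]; apply; rewrite subrr cabs0. Qed.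

Lemma nbh_open z S : nbh z S -> nbh z (fun w => nbh w S).
Proof.
move=> [d d0 H]; exists d => // w wz; exists (d - cabs (w - z)).
  by rewrite subr_gt0.
by move=> x xw; apply: H; rewrite (le_lt_trans (cabs_subD w _ _))// -ltrBrDr.
Qed.

Lemma nbh_ball z (r : R) w : cabs (w - z) < r ->
  nbh w (fun x => cabs (x - z) < r).
Proof.
move=> wz; exists (r - cabs (w - z)); first by rewrite subr_gt0.
by move=> x xw; rewrite (le_lt_trans (cabs_subD w _ _))// -ltrBrDr.
Qed.

Lemma nbh_neq z w : w != z -> nbh w (fun x => x != z).
Proof.
move=> wz; exists (cabs (w - z)); first by rewrite cabs_gt0 subr_eq0.
by move=> x; apply: contraTneq => ->; rewrite cabsC ltxx.
Qed.

Lemma nbh_punctured_ex z S :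
  nbh z (fun w => w != z -> S w) -> exists2 w, w != z & S w.
Proof.
move=> [d d0 H]; have dz : (z + (d / 2)%:C - z) = (d / 2)%:C.
  by rewrite addrC addKr.
have nz : z + (d / 2)%:C != z.
  by rewrite -subr_eq0 dz -cabs_eq0 cabs_real normr_eq0; lra.
exists (z + (d / 2)%:C) => //; apply: H => //.
by rewrite dz cabs_real gtr0_norm; lra.
Qed.

End neighbourhoods.

Section derivative.
Variable R : realType.
Local Notation C := R[i].
Implicit Types (z l : C) (f g : C -> C).

Definition ccont f z := forall e : R, 0 < e -> nbh z (fun w => cabs (f w - f z) < e).

Lemma eq_ccont f g z : nbh z (fun w => f w = g w) -> ccont f z -> ccont g z.
Proof.
move=> fg cf e e0; move: (nbh_center fg) => fgz.
by apply: nbhS2 fg (cf e e0) => w <-; rewrite fgz.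
Qed.

Lemma ccont_cst l z : ccont (fun=> l) z.
Proof. by move=> e e0; apply: nbhT => w; rewrite subrr cabs0. Qed.

Lemma ccont_id z : ccont id z.
Proof. by move=> e e0; exists e. Qed.

Lemma ccontD f g z : ccont f z -> ccont g z -> ccont (fun w => f w + g w) z.
Proof.
move=> cf cg e e0; have e20 : 0 < e / 2 by lra.
apply: nbhS2 (cf _ e20) (cg _ e20) => w fe ge.
rewrite (_ : _ - _ = (f w - f z) + (g w - g z)); last by ring.
by rewrite (le_lt_trans (cabsD _ _))//; lra.
Qed.

Lemma ccont_bounded f z : ccont f z ->
  nbh z (fun w => cabs (f w) < cabs (f z) + 1).
Proof.
move=> cf; apply: nbhS (cf 1 ltr01) => w H.
by have := le_lt_trans (cabs_subl _ _) H; lra.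
Qed.

Lemma ccontM f g z : ccont f z -> ccont g z -> ccont (fun w => f w * g w) z.
Proof.
move=> cf cg e e0.
set A := cabs (f z) + 1; set B := cabs (g z) + 1.
have A0 : 0 < A by rewrite ltr_wpDl// cabs_ge0.
have B0 : 0 < B by rewrite ltr_wpDl// cabs_ge0.
have eA : 0 < e / 2 / A by rewrite !divr_gt0.
have eB : 0 < e / 2 / B by rewrite !divr_gt0.
apply: nbhS2 (nbhI (cf _ eB) (ccont_bounded cf)) (cg _ eA) => w [fe fA] ge.
rewrite (_ : _ - _ = (f w - f z) * g z + f w * (g w - g z)); last by ring.
rewrite (le_lt_trans (cabsD _ _))// !cabsM.
have h1 : cabs (f w - f z) * cabs (g z) <= e / 2.
  rewrite -[leRHS](divfK (lt0r_neq0 B0)) ler_pM ?cabs_ge0 ?ltW//.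
  by rewrite /B ltrDl.
have h2 : cabs (f w) * cabs (g w - g z) < e / 2.
  rewrite -[ltRHS](divfK (lt0r_neq0 A0)) mulrC (@le_lt_trans _ _ (cabs (g w - g z) * A))//.
    by rewrite ler_wpM2l ?cabs_ge0// ltW.
  by rewrite ltr_pM2r.
by lra.
Qed.

Lemma ccontN f z : ccont f z -> ccont (fun w => - f w) z.
Proof.
by move=> cf e /cf; apply: nbhS => w; rewrite -opprD cabsN.
Qed.

Lemma ccontB f g z : ccont f z -> ccont g z -> ccont (fun w => f w - g w) z.
Proof. by move=> cf cg; apply: ccontD => //; exact: ccontN. Qed.

Lemma ccont_neq0 f z : ccont f z -> f z != 0 ->
  nbh z (fun w => cabs (f z) / 2 < cabs (f w)).
Proof.
rewrite -cabs_gt0 => cf fz; have e0 : 0 < cabs (f z) / 2 by lra.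
apply: nbhS (cf _ e0) => w; rewrite cabsC => H.
by have := le_lt_trans (cabs_subl _ _) H; lra.
Qed.

Lemma ccont_nbh_neq0 f z : ccont f z -> f z != 0 -> nbh z (fun w => f w != 0).
Proof.
move=> cf fz; apply: nbhS (ccont_neq0 cf fz) => w H.
by rewrite -cabs_gt0 (le_lt_trans _ H)// divr_ge0// cabs_ge0.
Qed.

Lemma ccontV f z : ccont f z -> f z != 0 -> ccont (fun w => (f w)^-1) z.
Proof.
move=> cf fz e e0; set a := cabs (f z).
have a0 : 0 < a by rewrite cabs_gt0.
have ea0 : 0 < e * (a ^+ 2 / 2) by rewrite mulr_gt0// divr_gt0// exprn_gt0.
apply: nbhS2 (nbhI (cf _ ea0) (ccont_nbh_neq0 cf fz)) (ccont_neq0 cf fz).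
move=> w [we fw] aw.
rewrite (_ : _ - _ = (f z - f w) / (f w * f z)); last by field; rewrite fz.
rewrite cabsM cabsV cabsM cabsC -/a ltr_pdivrMr; last first.
  by rewrite mulr_gt0// (le_lt_trans _ aw)// ltW// divr_gt0.
apply: (lt_trans we); rewrite ltr_pM2l// expr2 mulrAC ltr_pM2r//.
Qed.

Lemma ccont_comp f g z : ccont f z -> ccont g (f z) -> ccont (g \o f) z.
Proof.
move=> cf cg e /cg[d d0 H]; apply: nbhS (cf _ d0) => w /H //.
Qed.

Lemma ccontX f n z : ccont f z -> ccont (fun w => f w ^+ n) z.
Proof.
move=> cf; elim: n => [|n IH].
  by apply: (eq_ccont _ (ccont_cst 1 z)); apply: nbhT => w; rewrite expr0.
by apply: (eq_ccont _ (ccontM cf IH)); apply: nbhT => w; rewrite exprS.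
Qed.

Lemma ccont_eq0 f z : ccont f z -> nbh z (fun w => w != z -> f w = 0) -> f z = 0.
Proof.
move=> cf H; apply: contrapT => /eqP/(ccont_nbh_neq0 cf) H'.
have [w wz [fw]] : exists2 w, w != z & f w = 0 /\ f w != 0.
  by apply: nbh_punctured_ex; apply: nbhS2 H H' => w H ? /H.
by rewrite fw eqxx.
Qed.

Lemma ccont_eq f g z : ccont f z -> ccont g z ->
  nbh z (fun w => w != z -> f w = g w) -> f z = g z.
Proof.
move=> cf cg H; apply/eqP; rewrite -subr_eq0; apply/eqP.
apply: (ccont_eq0 (ccontB cf cg)); apply: nbhS H => w H /H ->.
by rewrite subrr.
Qed.

(** Carathéodory's form of the derivative: the difference quotient extends
    continuously.  It turns the rules of calculus into algebraic identities
    between quotient functions. *)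
Definition cder f z l := exists q : C -> C,
  [/\ ccont q z, q z = l & nbh z (fun w => f w = f z + q w * (w - z))].

Lemma cder_ccont f z l : cder f z l -> ccont f z.
Proof.
move=> [q [cq _ fq]].
apply: (@eq_ccont (fun w => f z + q w * (w - z))); first by apply: nbhS fq.
by apply: ccontD; [exact: ccont_cst|apply: ccontM => //; apply: ccontB; [exact: ccont_id|exact: ccont_cst]].
Qed.

Lemma eq_cder f g z l : nbh z (fun w => f w = g w) -> cder f z l -> cder g z l.
Proof.
move=> fg [q [cq ql fq]]; exists q; split=> //; have fgz := nbh_center fg.
by apply: nbhS2 fg fq => w <- ->; rewrite fgz.
Qed.

Lemma cder_unique f z l l' : cder f z l -> cder f z l' -> l = l'.
Proof.
move=> [q [cq <- fq]] [q' [cq' <- fq']]; apply: ccont_eq => //.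
apply: nbhS2 fq fq' => w -> /addrI + wz; apply: mulIf.
by rewrite subr_eq0.
Qed.

Lemma cder_cst l z : cder (fun=> l) z 0.
Proof.
exists (fun=> 0); split=> //; first exact: ccont_cst.
by apply: nbhT => w; rewrite mul0r addr0.
Qed.

Lemma cder_id z : cder id z 1.
Proof.
exists (fun=> 1); split=> //; first exact: ccont_cst.
by apply: nbhT => w; rewrite mul1r addrC subrK.
Qed.

Lemma cderD f g z l l' : cder f z l -> cder g z l' ->
  cder (fun w => f w + g w) z (l + l').
Proof.
move=> [q [cq <- fq]] [q' [cq' <- fq']]; exists (fun w => q w + q' w).
split=> //; first exact: ccontD.
by apply: nbhS2 fq fq' => w -> ->; ring.
Qed.

Lemma cderM f g z l l' : cder f z l -> cder g z l' ->
  cder (fun w => f w * g w) z (l * g z + f z * l').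
Proof.
move=> df dg; have cg := cder_ccont dg.
move: df dg => [q [cq <- fq]] [q' [cq' <- fq']].
exists (fun w => q w * g w + f z * q' w).
split=> //.
  apply: ccontD; first exact: ccontM.
  by apply: ccontM => //; exact: ccont_cst.
by apply: nbhS2 fq fq' => w -> ->; ring.
Qed.

Lemma cderZ f a z l : cder f z l -> cder (fun w => a * f w) z (a * l).
Proof.
by move=> df; have := cderM (cder_cst a z) df; rewrite mul0r add0r.
Qed.

Lemma cderN f z l : cder f z l -> cder (fun w => - f w) z (- l).
Proof.
move=> df; rewrite -mulN1r; apply: eq_cder (cderZ (-1) df).
by apply: nbhT => w; rewrite mulN1r.
Qed.

Lemma cderB f g z l l' : cder f z l -> cder g z l' ->
  cder (fun w => f w - g w) z (l - l').
Proof. by move=> df dg; apply: cderD => //; exact: cderN. Qed.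

Lemma cderV f z l : f z != 0 -> cder f z l ->
  cder (fun w => (f w)^-1) z (- l / f z ^+ 2).
Proof.
move=> fz df; have cf := cder_ccont df; move: df => [q [cq <- fq]].
exists (fun w => - q w / (f w * f z)); split; last 2 first.
- by rewrite expr2.
- apply: nbhS2 fq (ccont_nbh_neq0 cf fz) => w fq fw.
  rewrite !mulNr.
  have -> : q w / (f w * f z) * (w - z) = (f w - f z) / (f w * f z).
    by rewrite mulrAC; congr (_ / _); rewrite fq; ring.
  by field; rewrite fz.
- apply: ccontM; first exact: ccontN.
  by apply: ccontV; [apply: ccontM => //; exact: ccont_cst|rewrite mulf_neq0].
Qed.

Lemma cder_comp f g z l l' : cder f z l -> cder g (f z) l' ->
  cder (g \o f) z (l' * l).
Proof.
move=> df dg; have cf := cder_ccont df.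
move: df dg => [q [cq <- fq]] [q' [cq' <- [d d0 gq]]].
exists (fun w => q' (f w) * q w); split=> //.
  by apply: ccontM => //; exact: (ccont_comp cf cq').
apply: nbhS2 fq (cf _ d0) => w fq /gq /= ->.
by rewrite {2}fq; ring.
Qed.

Lemma cderX f n z l : cder f z l ->
  cder (fun w => f w ^+ n) z (n%:R * f z ^+ n.-1 * l).
Proof.
move=> df; elim: n => [|n IH].
  rewrite !mul0r; apply: eq_cder (cder_cst 1 z).
  by apply: nbhT => w; rewrite expr0.
have := cderM df IH; rewrite (_ : _ + _ = n.+1%:R * f z ^+ n * l); last first.
  case: n {IH} => [|n] /=; first by rewrite expr0; ring.
  rewrite exprS -[n.+2%:R]natr1; ring.
by apply: eq_cder; apply: nbhT => w; rewrite exprS.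
Qed.

Lemma cder_horner (p : {poly C}) f z l : cder f z l ->
  cder (fun w => p.[f w]) z (p^`().[f z] * l).
Proof.
move=> df; elim/poly_ind: p => [|p c IH].
  rewrite deriv0 horner0 mul0r; apply: eq_cder (cder_cst 0 z).
  by apply: nbhT => w; rewrite horner0.
rewrite derivD derivC addr0 derivM derivX mulr1 !hornerE.
have := cderD (cderM IH df) (cder_cst c z).
rewrite addr0 (_ : _ + _ = (p^`().[f z] * f z + p.[f z]) * l); last by ring.
by apply: eq_cder; apply: nbhT => w; rewrite !hornerE.
Qed.

Definition diffable f z := exists l, cder f z l.
Definition cderiv f z := xget 0 [set l | cder f z l].

Lemma cderivP f z : diffable f z -> cder f z (cderiv f z).
Proof. by move=> [l fl]; rewrite /cderiv; apply: xgetPex; exists l. Qed.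

Lemma cderivE f z l : cder f z l -> cderiv f z = l.
Proof. by move=> fl; exact: cder_unique (cderivP (ex_intro _ l fl)) fl. Qed.

(** The difference quotient, completed by the derivative at [z], is the
    continuous function required by [cder]. *)
Lemma derivable_diffable f z :
  derivable (f : R[i]^o -> R[i]^o) z 1 -> diffable f z.
Proof.
move=> /cvg_ex[/= l fl]; exists l.
exists (fun w => if w == z then l else (f w - f z) / (w - z)).
split; last 2 first.
- by rewrite eqxx.
- apply: nbhT => w; case: eqVneq => [->|wz]; first by rewrite subrr mulr0 addr0.
  by rewrite divfK ?subr_eq0// addrC subrK.
move=> e e0; rewrite eqxx.
have e0' : 0 < e%:C by rewrite ltcR.
have /cvgrPdist_lt/(_ _ e0')/nbhs_ballP[d /= d0 H] := fl.
have dreal : d = (complex.Re d)%:C by rewrite RRe_real// ger0_real// ltW.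
exists (complex.Re d); first by rewrite -ltcR -dreal.
move=> w wz; case: eqVneq => [_|nwz]; first by rewrite subrr cabs0.
have := H (w - z); rewrite -ball_normE /= sub0r normrN => /(_ _ _).
have d1 : (`|w - z : C| < d) by rewrite normr_cabs dreal ltcR.
move=> /(_ d1); rewrite subr_eq0 => /(_ nwz).
have -> : (w - z) *: (1 : R[i]^o) + z = w.
  by rewrite /GRing.scale /= mulr1 subrK.
change (`|l - (w - z)^-1 * (f w - f z) : C| < e%:C -> cabs ((f w - f z) / (w - z) - l) < e).
by rewrite normr_cabs ltcR cabsC mulrC.
Qed.

End derivative.

(** * Integrals along segments *)

Section real_antiderivative.
Variable R : realType.
Implicit Types (f F : R -> R) (a b x y : R).

Lemma derive0_ray_cst (g : R -> R) (m : R) x y :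
  (forall t : R, m < t -> is_derive t (1 : R) g 0) -> m < x -> m < y -> g x = g y.
Proof.
wlog xy : x y / x <= y.
  move=> H dg mx my; have [xy|/ltW yx] := leP x y; first exact: H.
  by apply/esym/H.
move=> dg mx my.
have gc : {within `[x, y], continuous g}.
  apply: derivable_within_continuous => t; rewrite in_itv /= => /andP[xt _].
  have ? := dg t (lt_le_trans mx xt); exact: ex_derive.
have [t|c _] := @MVT_segment R g (fun=> 0) x y xy _ gc.
  by rewrite in_itv /= => /andP[xt _]; apply: dg; exact: lt_trans xt.
by rewrite mul0r => /eqP; rewrite subr_eq0 => /eqP.
Qed.

(** The integral over [[a, x]] has the right derivative on [x > a] only.  The
    integrals for different [a] differ by constants, so that normalised at [0]
    they glue to an antiderivative on the whole line. *)
Lemma antiderivative_ex f : continuous f ->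
  exists F, forall x, is_derive x (1 : R) F (f x).
Proof.
move=> cf.
pose G a x := (\int[lebesgue_measure]_(t in `[a, x]) f t)%R.
have dG a x : a < x -> is_derive x (1 : R) (G a) (f x).
  move=> ax; have x1 : x < x + 1 by rewrite ltrDl.
  have fi : lebesgue_measure.-integrable `[a, x + 1] (EFin \o f).
    apply: continuous_compact_integrable; first exact: segment_compact.
    exact: continuous_subspaceT.
  have [dF FE] := continuous_FTC1_closed x1 fi ax (cf x).
  by rewrite -FE derive1E; apply/derivableP.
have GG a b x y : a < x -> a < y -> b < x -> b < y -> G a x - G a y = G b x - G b y.
  move=> ax ay bx by_; suff : G a x - G b x = G a y - G b y by lra.
  apply: (@derive0_ray_cst (fun t => G a t - G b t) (Num.max a b)) => [t||].
  - rewrite gt_max => /andP[at_ bt].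
    have ? := dG _ _ at_; have ? := dG _ _ bt.
    rewrite -(subrr (f t)).
    exact: is_deriveB.
  - by rewrite gt_max ax.
  - by rewrite gt_max ay.
pose m x := Num.min x 0 - 1.
exists (fun x => G (m x) x - G (m x) 0) => x.
have mx : m x - 1 < x by rewrite /m; case: (leP x 0) => ?; lra.
have m0 : m x - 1 < 0 by rewrite /m; case: (leP x 0) => ?; lra.
have := dG _ _ mx => dGx.
have dH : is_derive x (1 : R) (fun t => G (m x - 1) t - G (m x - 1) 0) (f x).
  rewrite -[f x]subr0; exact: is_deriveB.
apply: (near_eq_is_derive _ dH) => //.
near=> t.
have t1 : x - 1 < t by near: t; apply: lt_nbhsr; lra.
apply: GG => //; rewrite /m; case: (leP x 0) => ?; case: (leP t 0) => ?; lra.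
Unshelve. all: by end_near. Qed.

End real_antiderivative.

Section path_integral.
Variable R : realType.
Local Notation C := R[i].
Local Notation Re := (@complex.Re R).
Local Notation Im := (@complex.Im R).
Implicit Types (p q : R -> C) (a b c t : R) (x : C).

Definition pcont p := forall t (e : R), 0 < e ->
  exists2 d : R, 0 < d & forall s, `|s - t| < d -> cabs (p s - p t) < e.

Lemma pcont_Re p : pcont p -> continuous (fun t => Re (p t)).
Proof.
move=> cp t; apply/cvgrPdist_lt => e /(cp t)[d d0 H].
near=> s; rewrite distrC; apply: le_lt_trans (H s _).
  by have := Re_le_cabs (p s - p t); rewrite raddfB.
by rewrite distrC; near: s; exists d.
Unshelve. all: by end_near. Qed.

Lemma pcont_lin x p q : pcont p -> pcont q -> pcont (fun t => x * p t + q t).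
Proof.
move=> cp cq t e e0.
have k0 : 0 < cabs x + 1 by rewrite ltr_wpDl// cabs_ge0.
have e1 : 0 < e / 2 / (cabs x + 1) by rewrite !divr_gt0.
have [d d0 H] := cp t _ e1.
have e2 : 0 < e / 2 by lra.
have [d' d'0 H'] := cq t _ e2.
exists (Num.min d d'); first by rewrite lt_min d0.
move=> s; rewrite lt_min => /andP[/H ps /H' qs].
rewrite (_ : _ - _ = x * (p s - p t) + (q s - q t)); last by ring.
rewrite (le_lt_trans (cabsD _ _))// cabsM.
suff : cabs x * cabs (p s - p t) <= e / 2 by lra.
rewrite -[leRHS](divfK (lt0r_neq0 k0)) mulrC ler_pM ?cabs_ge0 ?ltW//.
by rewrite ltrDl.
Qed.

Lemma pcont_Im p : pcont p -> continuous (fun t => Im (p t)).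
Proof.
move=> cp; have c0 : pcont (fun=> 0) by move=> t e e0; exists 1 => // s _; rewrite subrr cabs0.
have -> : (fun t => Im (p t)) = (fun t => Re (- 'i%C * p t + 0)).
  by apply/funext => t; rewrite addr0 mulNr raddfN /= mulrC ReiNIm opprK.
exact: pcont_Re (pcont_lin (- 'i%C) cp c0).
Qed.

Definition antiderivative (f : R -> R) : R -> R :=
  xget f [set F | forall t, is_derive t (1 : R) F (f t)].

Lemma antiderivativeP f : continuous f ->
  forall t, is_derive t (1 : R) (antiderivative f) (f t).
Proof.
by move=> /antiderivative_ex fF; rewrite /antiderivative; apply: (xgetPex f fF).
Qed.

Definition cint p a b : C :=
  let F := antiderivative (Re \o p) in
  let G := antiderivative (Im \o p) in
  (F b - F a) +i* (G b - G a).

Lemma antiderivative_diff (f F G : R -> R) a b :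
  (forall t, is_derive t (1 : R) F (f t)) ->
  (forall t, is_derive t (1 : R) G (f t)) -> F b - F a = G b - G a.
Proof.
move=> dF dG; suff : F b - G b = F a - G a by lra.
apply: (@derive0_ray_cst _ (fun t => F t - G t) (Num.min a b - 1)).
- by move=> t _; have ? := dF t; have ? := dG t; rewrite -(subrr (f t)); exact: is_deriveB.
- by case: (leP a b) => ?; lra.
- by case: (leP a b) => ?; lra.
Qed.

Lemma cintE p F G a b :
  (forall t, is_derive t (1 : R) F (Re (p t))) ->
  (forall t, is_derive t (1 : R) G (Im (p t))) ->
  cint p a b = (F b - F a) +i* (G b - G a).
Proof.
move=> dF dG; rewrite /cint.
have Fex : exists F, forall t, is_derive t (1 : R) F ((Re \o p) t) by exists F.
have Gex : exists F, forall t, is_derive t (1 : R) F ((Im \o p) t) by exists G.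
congr (_ +i* _); apply: antiderivative_diff; try exact: dF; try exact: dG.
- exact: (xgetPex _ Fex).
- exact: (xgetPex _ Gex).
Qed.

Lemma cint_chain p a b c : cint p a b + cint p b c = cint p a c.
Proof. by apply/eqP; rewrite eq_complex /=; apply/andP; split; apply/eqP; ring. Qed.

Lemma cint_id p a : cint p a a = 0.
Proof. by rewrite /cint !subrr. Qed.

Lemma is_derive_lin (F G H : R -> R) (u v f g h t : R) :
  is_derive t 1 F f -> is_derive t 1 G g -> is_derive t 1 H h ->
  is_derive t 1 (fun t => u * F t + v * G t + H t) (u * f + v * g + h).
Proof.
move=> dF dG dH; exact: is_deriveD.
Qed.

Lemma cint_lin x p q a b : pcont p -> pcont q ->
  cint (fun t => x * p t + q t) a b = x * cint p a b + cint q a b.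
Proof.
move=> cp cq.
have dRp := antiderivativeP (pcont_Re cp); have dIp := antiderivativeP (pcont_Im cp).
have dRq := antiderivativeP (pcont_Re cq); have dIq := antiderivativeP (pcont_Im cq).
set Rp := antiderivative _ in dRp; set Ip := antiderivative _ in dIp.
set Rq := antiderivative _ in dRq; set Iq := antiderivative _ in dIq.
rewrite (cintE a b dRp dIp) (cintE a b dRq dIq).
case: x => u v.
apply: etrans (@cintE _ (fun t => u * Rp t + (- v) * Ip t + Rq t)
                  (fun t => u * Ip t + v * Rp t + Iq t) a b _ _) _.
- move=> t.
  have -> : Re ((u +i* v) * p t + q t) = u * Re (p t) + (- v) * Im (p t) + Re (q t).
    by case: (p t) (q t) => [? ?] [? ?] /=; rewrite mulNr.
  exact: is_derive_lin.
- move=> t.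
  have -> : Im ((u +i* v) * p t + q t) = u * Im (p t) + v * Re (p t) + Im (q t).
    by case: (p t) (q t) => [? ?] [? ?] /=.
  exact: is_derive_lin.
- by apply/eqP; rewrite eq_complex /=; apply/andP; split; apply/eqP; ring.
Qed.

Lemma antiderivative_mvt (f F : R -> R) a b : a <= b ->
  (forall t, is_derive t (1 : R) F (f t)) ->
  exists2 c, a <= c <= b & F b - F a = f c * (b - a).
Proof.
move=> ab dF.
have [|c cab ->] := @MVT_segment R F f a b ab (fun t _ => dF t).
- by apply: derivable_within_continuous => t _; have ? := dF t; exact: ex_derive.
- by exists c => //; move: cab; rewrite in_itv.
Qed.

(** The mean value theorem is applied to the real and imaginary parts
    separately, at the price of the factor [2]. *)
Lemma cint_bound p a b M : a <= b -> pcont p ->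
  (forall t, a <= t <= b -> cabs (p t) <= M) ->
  cabs (cint p a b) <= 2 * M * (b - a).
Proof.
move=> ab cp pM; rewrite (le_trans (cabs_le_ReIm _))//= /cint /=.
have [c cab ->] := antiderivative_mvt ab (antiderivativeP (pcont_Re cp)).
have [c' cab' ->] := antiderivative_mvt ab (antiderivativeP (pcont_Im cp)).
rewrite !normrM (ger0_norm (_ : 0 <= b - a)) ?subr_ge0//.
rewrite -mulrDl ler_wpM2r ?subr_ge0// [2 * M](_ : _ = M + M); last by ring.
apply: lerD; first exact: le_trans (Re_le_cabs _) (pM _ cab).
exact: le_trans (Im_le_cabs _) (pM _ cab').
Qed.

Lemma cint_Im_ge p a b m : a <= b -> pcont p ->
  (forall t, a <= t <= b -> m <= Im (p t)) ->
  m * (b - a) <= Im (cint p a b).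
Proof.
move=> ab cp pm; rewrite /cint /=.
have [c cab ->] := antiderivative_mvt ab (antiderivativeP (pcont_Im cp)).
by rewrite ler_wpM2r ?subr_ge0// pm.
Qed.

Lemma cint_opp p a : pcont p -> cint (fun t => p (- t)) (- a) a = cint p (- a) a.
Proof.
move=> cp; have dR := antiderivativeP (pcont_Re cp).
have dI := antiderivativeP (pcont_Im cp).
set F := antiderivative _ in dR; set G := antiderivative _ in dI.
have dopp (H h : R -> R) : (forall t, is_derive t (1 : R) H (h t)) ->
    forall t, is_derive t (1 : R) (fun t => - H (- t)) (h (- t)).
  move=> dH t; have ? := dH (- t).
  rewrite -[h _]opprK; apply: is_deriveN.
  rewrite -[X in is_derive _ _ _ X]mulrN1.
  have -> : (fun t => H (- t)) = H \o -%R by [].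
  exact: is_derive1_comp.
rewrite (cintE _ _ dR dI); apply: etrans (cintE _ _ (dopp _ _ dR) (dopp _ _ dI)) _.
by rewrite !opprK; apply/eqP; rewrite eq_complex /=; apply/andP; split; apply/eqP; ring.
Qed.

Lemma cint_affine x y a b : cint (fun t => x * t%:C + y) a b =
  x * ((b ^+ 2 - a ^+ 2) / 2)%:C + y * (b - a)%:C.
Proof.
case: x y => [x1 x2] [y1 y2].
have dq (u v : R) : forall t : R, is_derive t 1 (fun t => (u / 2) * (t * t) + v * t + 0) (u * t + v).
  move=> t; have -> : u * t + v = (u / 2) * (t *: 1 + t *: 1) + v * 1 + 0.
    by rewrite /GRing.scale /= !mulr1; lra.
  apply: is_derive_lin; exact: is_deriveM.
apply: etrans (@cintE _ (fun t => (x1 / 2) * (t * t) + y1 * t + 0) (fun t => (x2 / 2) * (t * t) + y2 * t + 0) a b _ _) _.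
- by move=> t; rewrite (_ : Re _ = x1 * t + y1)//= mulr0 subr0.
- by move=> t; rewrite (_ : Im _ = x2 * t + y2)//= mulr0 add0r.
- by apply/eqP; rewrite eq_complex /=; apply/andP; split; apply/eqP; ring.
Qed.

Lemma pcont_comp h (g : R -> C) :
  (forall t, ccont h (g t)) -> (forall s t, cabs (g s - g t) <= `|s - t|) ->
  pcont (h \o g).
Proof.
move=> ch Hg t e /(ch t)[d d0 H]; exists d => // s st.
by apply: H; exact: le_lt_trans st.
Qed.

End path_integral.

(** * Goursat's theorem on rectangles *)

Section goursat.
Variable R : realType.
Local Notation C := R[i].
Local Notation Re := (@complex.Re R).
Local Notation Im := (@complex.Im R).
Implicit Types (h k : C -> C) (a b c d m : R) (z w : C).

Lemma nested_intervals (a b : nat -> R) :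
  (forall n, a n <= a n.+1) -> (forall n, b n.+1 <= b n) ->
  (forall n, a n <= b n) -> exists x, forall n, a n <= x <= b n.
Proof.
move=> ha hb hab.
have ham : {homo a : n m / (n <= m)%N >-> n <= m} by apply: homo_leq => //; exact: le_trans.
have hbm : {homo b : n m / (n <= m)%N >-> m <= n}.
  by apply: homo_leq => // x y z yx zy; exact: le_trans zy yx.
have ub n : ubound (range a) (b n).
  move=> _ [m _ <-]; rewrite (le_trans (ham _ _ (leq_maxl m n)))//.
  by rewrite (le_trans (hab _))// hbm// leq_maxr.
exists (sup (range a)) => n; apply/andP; split.
  by apply: sup_upper_bound; [split; [exists (a 0%N), 0%N|exists (b 0%N); exact: ub]|exists n].
by apply: ge_sup; [exists (a 0%N), 0%N|exact: ub].
Qed.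

Definition horizontal h (y : R) := fun t : R => h (t +i* y).
Definition vertical h (x : R) := fun t : R => h (x +i* t).

Lemma pcont_horizontal h y : (forall z, ccont h z) -> pcont (horizontal h y).
Proof.
move=> ch; apply: (@pcont_comp _ h (fun t => t +i* y)) => // s t.
by rewrite (_ : _ - _ = (s - t)%:C) ?cabs_real// /real_complex_def; congr (_ +i* _); rewrite subrr.
Qed.

Lemma pcont_vertical h x : (forall z, ccont h z) -> pcont (vertical h x).
Proof.
move=> ch; apply: (@pcont_comp _ h (fun t => x +i* t)) => // s t.
rewrite (_ : _ - _ = 'i%C * (s - t)%:C) ?cabsM ?cabs_i ?mul1r ?cabs_real//.
by apply/eqP; rewrite eq_complex /=; apply/andP; split; apply/eqP; ring.
Qed.

Definition rect h a b c d : C :=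
  cint (horizontal h c) a b + 'i%C * cint (vertical h b) c d
  - cint (horizontal h d) a b - 'i%C * cint (vertical h a) c d.

Lemma rect_hsplit h m a b c d : rect h a b c d = rect h a m c d + rect h m b c d.
Proof.
by rewrite /rect -(cint_chain _ a m b) -(cint_chain (horizontal h d) a m b); ring.
Qed.

Lemma rect_vsplit h m a b c d : rect h a b c d = rect h a b c m + rect h a b m d.
Proof.
by rewrite /rect -(cint_chain _ c m d) -(cint_chain (vertical h a) c m d); ring.
Qed.

Lemma rectD h k a b c d : (forall z, ccont h z) -> (forall z, ccont k z) ->
  rect (fun z => h z + k z) a b c d = rect h a b c d + rect k a b c d.
Proof.
move=> ch ck.
have H p q (x y : R) : pcont p -> pcont q -> cint (fun t => p t + q t) x y = cint p x y + cint q x y.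
  move=> cp cq; rewrite -[cint p x y]mul1r -cint_lin//; congr cint.
  by apply/funext => t; rewrite mul1r.
rewrite /rect (H (horizontal h c) (horizontal k c))//; try exact: pcont_horizontal.
rewrite (H (horizontal h d) (horizontal k d))//; try exact: pcont_horizontal.
rewrite (H (vertical h a) (vertical k a))//; try exact: pcont_vertical.
rewrite (H (vertical h b) (vertical k b))//; try exact: pcont_vertical.
by ring.
Qed.

Lemma rect_affine (x y : C) a b c d : rect (fun z => x * z + y) a b c d = 0.
Proof.
have -> : rect (fun z => x * z + y) a b c d =
    cint (fun t => x * t%:C + (x * 'i%C * c%:C + y)) a b
    + 'i%C * cint (fun t => (x * 'i%C) * t%:C + (x * b%:C + y)) c d
    - cint (fun t => x * t%:C + (x * 'i%C * d%:C + y)) a b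
    - 'i%C * cint (fun t => (x * 'i%C) * t%:C + (x * a%:C + y)) c d.
  rewrite /rect; congr (cint _ _ _ + _ * cint _ _ _ - cint _ _ _ - _ * cint _ _ _).
  - by apply/funext => t; rewrite /horizontal [t +i* c]complexE /=; ring.
  - by apply/funext => t; rewrite /vertical [b +i* t]complexE /=; ring.
  - by apply/funext => t; rewrite /horizontal [t +i* d]complexE /=; ring.
  - by apply/funext => t; rewrite /vertical [a +i* t]complexE /=; ring.
by rewrite !cint_affine !rmorphB /=; ring.
Qed.

Definition in_rect a b c d z := (a <= Re z <= b) && (c <= Im z <= d).

Lemma rect_bound h a b c d M : a <= b -> c <= d -> (forall z, ccont h z) ->
  (forall z, in_rect a b c d z -> cabs (h z) <= M) ->
  cabs (rect h a b c d) <= 4 * M * (b - a + (d - c)).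
Proof.
move=> ab cd ch hM.
have H1 : cabs (cint (horizontal h c) a b) <= 2 * M * (b - a).
  apply: cint_bound => //; first exact: pcont_horizontal.
  by move=> t tab; apply: hM; rewrite /in_rect /= tab lexx cd.
have H2 : cabs (cint (horizontal h d) a b) <= 2 * M * (b - a).
  apply: cint_bound => //; first exact: pcont_horizontal.
  by move=> t tab; apply: hM; rewrite /in_rect /= tab lexx cd.
have H3 : cabs (cint (vertical h a) c d) <= 2 * M * (d - c).
  apply: cint_bound => //; first exact: pcont_vertical.
  by move=> t tab; apply: hM; rewrite /in_rect /= tab lexx ab.
have H4 : cabs (cint (vertical h b) c d) <= 2 * M * (d - c).
  apply: cint_bound => //; first exact: pcont_vertical.
  by move=> t tab; apply: hM; rewrite /in_rect /= tab lexx ab.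
rewrite /rect (le_trans (cabsB _ _))// cabsM cabs_i mul1r.
have := cabsB (cint (horizontal h c) a b + 'i%C * cint (vertical h b) c d) (cint (horizontal h d) a b).
have := cabsD (cint (horizontal h c) a b) ('i%C * cint (vertical h b) c d).
by rewrite cabsM cabs_i mul1r; lra.
Qed.

Definition diff_on_rect h a b c d := forall z, in_rect a b c d z -> diffable h z.

(** The integrals over the four quarters add up to the integral. *)
Lemma rect_quarter h a b c d : a <= b -> c <= d -> exists a' b' c' d',
  [/\ a <= a' /\ b' <= b, c <= c' /\ d' <= d,
     b' - a' = (b - a) / 2, d' - c' = (d - c) / 2 &
     cabs (rect h a b c d) <= 4 * cabs (rect h a' b' c' d')].
Proof.
move=> ab cd; set m := (a + b) / 2; set n := (c + d) / 2.
apply: contrapT => H.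
have Hq a' b' c' d' : [/\ a <= a' /\ b' <= b, c <= c' /\ d' <= d,
     b' - a' = (b - a) / 2 & d' - c' = (d - c) / 2] ->
    4 * cabs (rect h a' b' c' d') < cabs (rect h a b c d).
  move=> [? ? ? ?]; rewrite ltNge; apply/negP => Hle; apply: H.
  by exists a', b', c', d'.
have h1 : 4 * cabs (rect h a m c n) < cabs (rect h a b c d).
  by apply: Hq; rewrite /m /n; split; [split|split| |]; lra.
have h2 : 4 * cabs (rect h m b c n) < cabs (rect h a b c d).
  by apply: Hq; rewrite /m /n; split; [split|split| |]; lra.
have h3 : 4 * cabs (rect h a m n d) < cabs (rect h a b c d).
  by apply: Hq; rewrite /m /n; split; [split|split| |]; lra.
have h4 : 4 * cabs (rect h m b n d) < cabs (rect h a b c d).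
  by apply: Hq; rewrite /m /n; split; [split|split| |]; lra.
have e : rect h a b c d =
  (rect h a m c n + rect h a m n d) + (rect h m b c n + rect h m b n d).
  by rewrite (rect_hsplit h m) (rect_vsplit h n a m) (rect_vsplit h n m b).
have := cabsD (rect h a m c n + rect h a m n d) (rect h m b c n + rect h m b n d).
have := cabsD (rect h a m c n) (rect h a m n d).
have := cabsD (rect h m b c n) (rect h m b n d).
by rewrite -e; lra.
Qed.

(** Bisection produces rectangles [R_n] shrinking to a point [p], of size
    [L / 2^n], whose integrals are at least [4^-n] times the initial one.  Up to
    an error [o(|z - p|)] the function is affine near [p], so the integral over
    [R_n] is [o(4^-n)]. *)
Lemma goursat h a b c d : a <= b -> c <= d -> (forall z, ccont h z) ->
  diff_on_rect h a b c d -> rect h a b c d = 0.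
Proof.
move=> ab cd ch dh.
pose ok (q : R * R * R * R) := let: (a, b, c, d) := q in a <= b /\ c <= d.
pose sub (q q' : R * R * R * R) := let: (a, b, c, d) := q in
  let: (a', b', c', d') := q' in
  [/\ a <= a' /\ b' <= b, c <= c' /\ d' <= d,
     b' - a' = (b - a) / 2, d' - c' = (d - c) / 2 &
     cabs (rect h a b c d) <= 4 * cabs (rect h a' b' c' d')].
have step (q : {q | ok q}) : {q' : {q | ok q} | sub (sval q) (sval q')}.
  case: q => [[[[a1 b1] c1] d1] [ab1 cd1]] /=; apply: cid.
  have [a' [b' [c' [d' H]]]] := rect_quarter h ab1 cd1.
  have okq : ok (a', b', c', d') by case: H => _ _ Hb Hd _; split; lra.
  by exists (exist _ _ okq).
pose s := fun n => iter n (fun q => sval (step q)) (exist ok (a, b, c, d) (conj ab cd)).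
pose An n := (sval (s n)).1.1.1; pose Bn n := (sval (s n)).1.1.2.
pose Cn n := (sval (s n)).1.2; pose Dn n := (sval (s n)).2.
have sE n : sval (s n) = (An n, Bn n, Cn n, Dn n).
  by rewrite /An /Bn /Cn /Dn; case: (sval (s n)) => [[[]]].
have okn n : An n <= Bn n /\ Cn n <= Dn n by have := svalP (s n); rewrite sE.
have subn n : sub (sval (s n)) (sval (s n.+1)) by exact: (svalP (step (s n))).
have {}subn n : [/\ An n <= An n.+1 /\ Bn n.+1 <= Bn n, Cn n <= Cn n.+1 /\ Dn n.+1 <= Dn n,
     Bn n.+1 - An n.+1 = (Bn n - An n) / 2, Dn n.+1 - Cn n.+1 = (Dn n - Cn n) / 2 &
     cabs (rect h (An n) (Bn n) (Cn n) (Dn n)) <= 4 * cabs (rect h (An n.+1) (Bn n.+1) (Cn n.+1) (Dn n.+1))].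
  by have := subn n; rewrite !sE.
have [x xP] := @nested_intervals An Bn (fun n => let: And5 (conj u _) _ _ _ _ := subn n in u)
  (fun n => let: And5 (conj _ u) _ _ _ _ := subn n in u) (fun n => let: conj u _ := okn n in u).
have [y yP] := @nested_intervals Cn Dn (fun n => let: And5 _ (conj u _) _ _ _ := subn n in u)
  (fun n => let: And5 _ (conj _ u) _ _ _ := subn n in u) (fun n => let: conj _ u := okn n in u).
have len n : Bn n - An n + (Dn n - Cn n) = (b - a + (d - c)) / 2 ^+ n.
  elim: n => [|n IH]; first by rewrite expr0 divr1.
  have [_ _ hb hd _] := subn n; rewrite hb hd exprS invfM mulrCA -IH; lra.
have large n : cabs (rect h a b c d) <= 4 ^+ n * cabs (rect h (An n) (Bn n) (Cn n) (Dn n)).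
  elim: n => [|n IH]; first by rewrite expr0 mul1r.
  apply: (le_trans IH); rewrite exprSr -mulrA ler_wpM2l ?exprn_ge0//.
  by have [_ _ _ _] := subn n.
set L := b - a + (d - c) in len.
have L0 : 0 <= L by rewrite /L; lra.
pose p := x +i* y.
have [l [q [cq ql fq]]] : diffable h p.
  by apply: dh; rewrite /in_rect /= (xP 0%N) (yP 0%N).
apply: cabs_lt0_eq0 => e e0.
have e1 : 0 < e / (4 * (L ^+ 2 + 1)).
  by rewrite divr_gt0// mulr_gt0// ltr_wpDl// sqr_ge0.
have [r r0 H] := nbhI fq (cq _ e1).
have [n nr] : exists n, L / 2 ^+ n < r.
  have [n /= Hn] : exists n : nat, L / r < n%:R.
    by exists (Num.truncn (L / r)).+1; rewrite truncnS_gt.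
  exists n; rewrite ltr_pdivrMr ?exprn_gt0// mulrC -ltr_pdivrMr//.
  by apply: (lt_trans Hn); rewrite -natrX ltr_nat ltn_expl.
pose k w := h w - (l * w + (h p - l * p)).
have ck w : ccont k w.
  apply: ccontB => //; apply: ccontD; last exact: ccont_cst.
  by apply: ccontM; [exact: ccont_cst|exact: ccont_id].
have hk : rect h (An n) (Bn n) (Cn n) (Dn n) = rect k (An n) (Bn n) (Cn n) (Dn n).
  rewrite -[RHS]add0r -(rect_affine l (h p - l * p) (An n) (Bn n) (Cn n) (Dn n)) -rectD//.
    by congr rect; apply/funext => w; rewrite /k addrC subrK.
  move=> z; apply: ccontD; last exact: ccont_cst.
  by apply: ccontM; [exact: ccont_cst|exact: ccont_id].
have [An_le Cn_le] := okn n.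
have := rect_bound An_le Cn_le ck.
move=> /(_ (e / (4 * (L ^+ 2 + 1)) * (L / 2 ^+ n))) kb.
apply: (le_lt_trans (large n)); rewrite hk.
have {kb} kb : cabs (rect k (An n) (Bn n) (Cn n) (Dn n)) <=
   4 * (e / (4 * (L ^+ 2 + 1)) * (L / 2 ^+ n)) * (L / 2 ^+ n).
  rewrite -[X in _ * _ * X]len; apply: kb => z /andP[zx zy].
  have zp : cabs (z - p) <= L / 2 ^+ n.
    rewrite (le_trans (cabs_le_ReIm _))// -len /p !raddfB /=; apply: lerD.
      by have := xP n; rewrite ler_norml; lra.
    by have := yP n; rewrite ler_norml; lra.
  have [hz qz] := H z (le_lt_trans zp nr).
  rewrite /k (_ : _ - _ = (q z - q p) * (z - p)); last by rewrite hz ql; ring.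
  by rewrite cabsM ler_pM ?cabs_ge0// ltW.
apply: (@le_lt_trans _ _ (4 ^+ n * (4 * (e / (4 * (L ^+ 2 + 1)) * (L / 2 ^+ n)) * (L / 2 ^+ n)))).
  by rewrite ler_wpM2l ?exprn_ge0.
have -> : 4 ^+ n = 2 ^+ n * 2 ^+ n :> R by rewrite -exprMn; congr (_ ^+ _); ring.
have n0 : 2 ^+ n != 0 :> R by rewrite expf_neq0// pnatr_eq0.
have L1 : 0 < L ^+ 2 + 1 by rewrite ltr_wpDl// sqr_ge0.
rewrite [X in X < _](_ : _ = e * (L ^+ 2 / (L ^+ 2 + 1))); last first.
  by field; rewrite n0 lt0r_neq0.
by rewrite gtr_pMr// ltr_pdivrMr// mul1r ltrDl ltr01.
Qed.

End goursat.

(** * Cauchy's formula on squares *)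

Section cauchy_formula.
Variable R : realType.
Local Notation C := R[i].
Local Notation Re := (@complex.Re R).
Local Notation Im := (@complex.Im R).
Implicit Types (h f g : C -> C) (a b c d r M : R) (z w : C).

Lemma rect_hdegenerate h a c d : rect h a a c d = 0.
Proof. by rewrite /rect !cint_id; ring. Qed.

Lemma rect_vdegenerate h a b c : rect h a b c c = 0.
Proof. by rewrite /rect !cint_id; ring. Qed.

(** Each exceptional point is enclosed in a small square: the integrals over
    the four remaining strips vanish, and that over the square tends to [0]
    with its perimeter because the function is bounded near the point. *)
Lemma goursat_except (E : seq C) h a b c d : a <= b -> c <= d ->
  (forall z, ccont h z) ->
  (forall z, in_rect a b c d z -> z \notin E -> diffable h z) ->
  rect h a b c d = 0.
Proof.
elim: E a b c d => [|p E IH] a b c d ab cd ch dh.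
  by apply: goursat => // z zr; apply: dh.
have [pr|/negP pr] := boolP (in_rect a b c d p); last first.
  apply: IH => // z zr zE; apply: dh => //; rewrite inE negb_or zE andbT.
  by apply/negP => /eqP zp; apply: pr; rewrite -zp.
have zero a' b' c' d' : a <= a' -> a' <= b' -> b' <= b -> c <= c' -> c' <= d' -> d' <= d ->
    ~~ in_rect a' b' c' d' p -> rect h a' b' c' d' = 0.
  move=> aa ab' bb cc cd' dd pr'; apply: IH => // z zr zE; apply: dh.
    by move: zr; rewrite /in_rect; lra.
  by rewrite inE negb_or zE andbT; apply/negP => /eqP zp; move: pr'; rewrite -zp zr.
set x := Re p; set y := Im p.
have [[xa xb] [yc yd]] : (a <= x /\ x <= b) /\ (c <= y /\ y <= d).
  by move: pr; rewrite /in_rect -/x -/y => /andP[/andP[? ?] /andP[? ?]].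
have [r r0 hr] := ccont_bounded (ch p).
set M := cabs (h p) + 1 in hr.
have M0 : 0 < M by rewrite ltr_wpDl// cabs_ge0.
apply: cabs_lt0_eq0 => e e0.
(* the square has half-side at most [dl], perimeter at most [8 dl] *)
pose dl := Num.min (r / 4) (e / (32 * M)).
have dl0 : 0 < dl by rewrite lt_min !divr_gt0// mulr_gt0.
have dlr : dl <= r / 4 by rewrite ge_min lexx.
have dle : dl * (32 * M) <= e by rewrite -ler_pdivlMr ?mulr_gt0// ge_min lexx orbT.
have [a1 [aa1 a1x xa1 za]] : exists a1, [/\ a <= a1, a1 <= x, x - dl <= a1 & rect h a a1 c d = 0].
  have [h1|h1] := leP a (x - dl); last by exists a; split=> //; [exact: ltW|exact: rect_hdegenerate].
  exists (x - dl); split=> //; first by lra.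
  by apply: zero => //; try lra; rewrite /in_rect -/x; apply/negP => /andP[/andP[_]]; lra.
have [b1 [bb1 b1x xb1 zb]] : exists b1, [/\ b1 <= b, x <= b1, b1 <= x + dl & rect h b1 b c d = 0].
  have [h1|h1] := leP (x + dl) b; last by exists b; split=> //; [exact: ltW|exact: rect_hdegenerate].
  exists (x + dl); split=> //; first by lra.
  by apply: zero => //; try lra; rewrite /in_rect -/x; apply/negP => /andP[/andP[]]; lra.
have [c1 [cc1 c1y yc1 zc]] : exists c1, [/\ c <= c1, c1 <= y, y - dl <= c1 & rect h a1 b1 c c1 = 0].
  have [h1|h1] := leP c (y - dl); last by exists c; split=> //; [exact: ltW|exact: rect_vdegenerate].
  exists (y - dl); split=> //; first by lra.
  by apply: zero => //; try lra; rewrite /in_rect -/y; apply/negP => /andP[_ /andP[_]]; lra.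
have [d1 [dd1 d1y yd1 zd]] : exists d1, [/\ d1 <= d, y <= d1, d1 <= y + dl & rect h a1 b1 d1 d = 0].
  have [h1|h1] := leP (y + dl) d; last by exists d; split=> //; [exact: ltW|exact: rect_vdegenerate].
  exists (y + dl); split=> //; first by lra.
  by apply: zero => //; try lra; rewrite /in_rect -/y; apply/negP => /andP[_ /andP[]]; lra.
have -> : rect h a b c d = rect h a1 b1 c1 d1.
  rewrite (rect_hsplit h a1 a b) za add0r (rect_hsplit h b1 a1 b) zb addr0.
  by rewrite (rect_vsplit h c1 a1 b1 c d) zc add0r (rect_vsplit h d1 a1 b1) zd addr0.
have ab1 : a1 <= b1 by lra.
have cd1 : c1 <= d1 by lra.
apply: (@le_lt_trans _ _ (4 * M * (b1 - a1 + (d1 - c1)))).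
  apply: rect_bound => // z zr; apply/ltW/hr.
  rewrite (le_lt_trans (cabs_le_ReIm _))// !raddfB /= -/x -/y.
  have : `|Re z - x| <= dl by rewrite ler_norml; move: zr; rewrite /in_rect; lra.
  have : `|Im z - y| <= dl by rewrite ler_norml; move: zr; rewrite /in_rect; lra.
  by lra.
apply: (@le_lt_trans _ _ (4 * M * (4 * dl))).
  by rewrite ler_wpM2l//; [rewrite mulr_ge0// ltW|lra].
by lra.
Qed.

(** The boundary of the square of half-side [r] centred at the origin: its
    four sides are the images under multiplication by a power of [i] of the
    lower one. *)
Definition edge r (k : nat) (t : R) : C := 'i%C ^+ k * (t%:C - r%:C * 'i%C).

Definition contour r f : C :=
  \sum_(k < 4) 'i%C ^+ k * cint (fun t => f (edge r k t)) (- r) r.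

Definition edge_cont r f := forall k : nat, pcont (fun t => f (edge r k t)).

Lemma cabs_iX k : cabs ('i%C ^+ k : C) = 1.
Proof. by rewrite cabsX cabs_i expr1n. Qed.

Lemma ccont_edge_cont r f : (forall z, ccont f z) -> edge_cont r f.
Proof.
move=> cf k; apply: (@pcont_comp _ f (edge r k)) => // s t.
rewrite /edge (_ : _ - _ = 'i%C ^+ k * (s - t)%:C); last by rewrite rmorphB; ring.
by rewrite cabsM cabs_iX mul1r cabs_real.
Qed.

Lemma edge_contM r f g : edge_cont r f -> edge_cont r g ->
  edge_cont r (fun z => f z * g z).
Proof.
move=> cf cg k t e e0.
set A := cabs (f (edge r k t)) + 1; set B := cabs (g (edge r k t)) + 1.
have A0 : 0 < A by rewrite ltr_wpDl// cabs_ge0.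
have B0 : 0 < B by rewrite ltr_wpDl// cabs_ge0.
have eA : 0 < e / 2 / A by rewrite !divr_gt0.
have eB : 0 < e / 2 / B by rewrite !divr_gt0.
have [d1 d10 H1] := cf k t _ eB; have [d2 d20 H2] := cg k t _ eA.
have [d3 d30 H3] := cf k t 1 ltr01.
exists (Num.min d1 (Num.min d2 d3)); first by rewrite !lt_min d10 d20 d30.
move=> s; rewrite !lt_min => /and3P[/H1 h1 /H2 h2 /H3 h3].
move: (f (edge r k s)) (g (edge r k s)) h1 h2 h3 => fs gs h1 h2 h3.
have fA : cabs fs < A by have := le_lt_trans (cabs_subl _ _) h3; rewrite /A; lra.
move: (f (edge r k t)) (g (edge r k t)) @A @B A0 B0 eA eB h1 h2 h3 fA H1 H2 H3 => ft gt A B A0 B0 eA eB h1 h2 h3 fA _ _ _.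
rewrite (_ : _ - _ = (fs - ft) * gt + fs * (gs - gt)); last by ring.
rewrite (le_lt_trans (cabsD _ _))// !cabsM.
have e1 : cabs (fs - ft) * cabs gt <= e / 2.
  rewrite -[leRHS](divfK (lt0r_neq0 B0)) ler_pM ?cabs_ge0 ?ltW//.
  by rewrite /B ltrDl.
have e2 : cabs fs * cabs (gs - gt) < e / 2.
  rewrite -[ltRHS](divfK (lt0r_neq0 A0)) mulrC (@le_lt_trans _ _ (cabs (gs - gt) * A))//.
    by rewrite ler_wpM2l ?cabs_ge0// ltW.
  by rewrite ltr_pM2r.
by lra.
Qed.

Lemma edge_contD r f g : edge_cont r f -> edge_cont r g ->
  edge_cont r (fun z => f z + g z).
Proof.
move=> cf cg k; have := pcont_lin 1 (cf k) (cg k); congr pcont.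
by apply/funext => t; rewrite mul1r.
Qed.

Lemma contour_lin r x f g : edge_cont r f -> edge_cont r g ->
  contour r (fun z => x * f z + g z) = x * contour r f + contour r g.
Proof.
move=> cf cg; rewrite /contour mulr_sumr -big_split /=; apply: eq_bigr => k _.
by rewrite cint_lin//; ring.
Qed.

Lemma contour_bound r f M : 0 <= r -> edge_cont r f ->
  (forall k t, - r <= t <= r -> cabs (f (edge r k t)) <= M) ->
  cabs (contour r f) <= 16 * r * M.
Proof.
move=> r0 cf fM; rewrite (le_trans (cabs_sum _ _))//.
rewrite (_ : 16 * r * M = \sum_(k < 4) 2 * M * (r - (- r))); last first.
  by rewrite !big_ord_recl big_ord0; lra.
apply: ler_sum => k _; rewrite cabsM cabs_iX mul1r; apply: cint_bound => //; first by lra.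
by move=> t; exact: fM.
Qed.

Lemma contour_rect r h : (forall z, ccont h z) ->
  contour r h = rect h (- r) r (- r) r.
Proof.
move=> ch; rewrite /contour !big_ord_recl big_ord0 /=.
rewrite -[bump 0 (bump 0 (bump 0 0))]/3%N -[bump 0 (bump 0 0)]/2%N -[bump 0 0]/1%N.
have -> : (fun t => h (edge r 0 t)) = horizontal h (- r).
  apply/funext => t; rewrite /horizontal /edge [t +i* _]complexE /= rmorphN /=; apply: (congr1 h); ring.
have ii : ('i%C : C) ^+ 2 = - 1 by exact: sqr_i.
have i3 : ('i%C : C) ^+ 3 = - 'i%C by rewrite exprSr ii mulN1r.
have -> : (fun t => h (edge r 1 t)) = vertical h r.
  apply/funext => t; rewrite /vertical /edge [r +i* t]complexE /=; apply: (congr1 h).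
  rewrite (_ : _ * _ = 'i%C * t%:C - 'i%C ^+ 2 * r%:C); last by ring.
  by rewrite ii; ring.
have -> : (fun t => h (edge r 2 t)) = (fun t => horizontal h r (- t)).
  apply/funext => t; rewrite /horizontal /edge [(- t) +i* r]complexE /= rmorphN /=; apply: (congr1 h).
  by rewrite ii; ring.
have -> : (fun t => h (edge r 3 t)) = (fun t => vertical h (- r) (- t)).
  apply/funext => t; rewrite /vertical /edge [(- r) +i* (- t)]complexE /= !rmorphN /=; apply: (congr1 h).
  rewrite i3 mulrBr !mulNr opprK mulrCA.
  by rewrite -expr2 ii; ring.
rewrite !cint_opp; [|exact: pcont_vertical|exact: pcont_horizontal].
rewrite /rect ii i3.
by ring.
Qed.

Lemma edge_sub r k t z : edge r k t - z = 'i%C ^+ k * (t%:C - r%:C * 'i%C - z / 'i%C ^+ k).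
Proof.
have nz : 'i%C ^+ k != 0 :> C by rewrite -cabs_gt0 cabs_iX.
by rewrite /edge; field.
Qed.

Lemma cabs_edge_sub r k t z : r - cabs z <= cabs (edge r k t - z).
Proof.
rewrite edge_sub cabsM cabs_iX mul1r (le_trans _ (Im_le_cabs _))//.
have -> (w : C) : Im (t%:C - r%:C * 'i%C - w) = - r - Im w.
  by case: w => u v /=; ring.
have : `|Im (z / 'i%C ^+ k)| <= cabs z.
  by rewrite (le_trans (Im_le_cabs _))// cabsM cabsV cabs_iX invr1 mulr1.
rewrite ler_norml => H; rewrite ler_normr; lra.
Qed.

Lemma cabs_edge r k t : r <= cabs (edge r k t).
Proof. by have := cabs_edge_sub r k t 0; rewrite cabs0 !subr0. Qed.

Lemma edge_neq r k t z : cabs z < r -> edge r k t - z != 0.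
Proof.
by move=> zr; rewrite -cabs_gt0 (lt_le_trans _ (cabs_edge_sub _ _ _ _))// subr_gt0.
Qed.

Lemma kernel_edge_cont r z : cabs z < r -> edge_cont r (fun x => (x - z)^-1).
Proof.
move=> zr k t e e0; have d0 : 0 < r - cabs z by rewrite subr_gt0.
exists (e * (r - cabs z) ^+ 2); first by rewrite mulr_gt0// exprn_gt0.
move=> s st.
have -> : (edge r k s - z)^-1 - (edge r k t - z)^-1 =
   ('i%C ^+ k * (t - s)%:C) / ((edge r k s - z) * (edge r k t - z)).
  have := edge_neq k s zr; have := edge_neq k t zr => nt ns.
  have -> : 'i%C ^+ k * (t - s)%:C = (edge r k t - z) - (edge r k s - z).
    by rewrite /edge rmorphB /=; ring.
  by field; rewrite ns nt.
rewrite cabsM cabsM cabs_iX mul1r cabs_real cabsV cabsM distrC.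
have hs := cabs_edge_sub r k s z; have ht := cabs_edge_sub r k t z.
rewrite ltr_pdivrMr ?mulr_gt0 ?(lt_le_trans d0)//.
by apply: (lt_le_trans st); rewrite ler_wpM2l ?(ltW e0)// expr2 ler_pM ?(ltW d0).
Qed.

(** Goursat's theorem is applied to the difference quotient
    [(h x - h z) / (x - z)], which is continuous at its exceptional point [z].
    A second exceptional point [0] serves for removing singularities. *)
Lemma cauchy_formula h r z : cabs z < r -> (forall w, ccont h w) ->
  diffable h z ->
  (forall w, in_rect (- r) r (- r) r w -> w != 0 -> diffable h w) ->
  h z * contour r (fun x => (x - z)^-1) = contour r (fun x => h x * (x - z)^-1).
Proof.
move=> zr ch dz dh.
have r0 : 0 <= r by rewrite (le_trans (cabs_ge0 z))// ltW.
pose k w := if w == z then cderiv h z else (h w - h z) / (w - z).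
have kE w : w != z -> nbh w (fun x => k x = (h x - h z) / (x - z)).
  by move=> wz; apply: nbhS (nbh_neq wz) => x /negPf xz; rewrite /k xz.
have ck w : ccont k w.
  have [->|wz] := eqVneq w z.
    have [q [cq ql hq]] := cderivP dz; apply: (@eq_ccont _ q) => //.
    apply: nbhS hq => x; rewrite /k; case: eqVneq => [-> _ //|xz ->].
    by rewrite addrC addKr mulfK// subr_eq0.
  apply: (@eq_ccont _ (fun x => (h x - h z) / (x - z))).
    by apply: nbhS (kE w wz) => x ->.
  apply: ccontM; first by apply: ccontB => //; exact: ccont_cst.
  apply: ccontV; last by rewrite subr_eq0.
  by apply: ccontB; [exact: ccont_id|exact: ccont_cst].
have k0 : contour r k = 0.
  rewrite contour_rect//; apply: (@goursat_except [:: z; 0]) => //; try lra.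
  move=> w wr; rewrite !inE negb_or => /andP[wz w0].
  have [l dw] := dh w wr w0.
  eexists; apply: (@eq_cder _ (fun x => (h x - h z) / (x - z))).
    by apply: nbhS (kE w wz) => x ->.
  apply: cderM; first exact: cderB dw (cder_cst _ _).
  apply: cderV; first by rewrite subr_eq0.
  exact: cderB (cder_id _) (cder_cst _ _).
have cs := kernel_edge_cont zr.
have chs := edge_contM (ccont_edge_cont r ch) cs.
have : contour r k = - h z * contour r (fun x => (x - z)^-1) + contour r (fun x => h x * (x - z)^-1).
  rewrite -contour_lin//; apply: eq_bigr => j _; congr (_ * cint _ _ _).
  apply/funext => t; rewrite /k; have := edge_neq j t zr.
  by rewrite subr_eq0 => /negPf ->; ring.
by rewrite k0 mulNr => /esym/eqP; rewrite addrC subr_eq0 => /eqP.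
Qed.

End cauchy_formula.

(** * Regularity of Cauchy transforms *)

Section cauchy_transform.
Variable R : realType.
Local Notation C := R[i].
Local Notation Re := (@complex.Re R).
Local Notation Im := (@complex.Im R).
Implicit Types (h f g : C -> C) (a b c d r M : R) (z w x : C).

Lemma eq_contour r f g : (forall k t, f (edge r k t) = g (edge r k t)) ->
  contour r f = contour r g.
Proof.
move=> fg; apply: eq_bigr => k _; congr (_ * cint _ _ _).
by apply/funext => t.
Qed.

(** Differentiation under the integral: the difference quotients [g w] of
    [f w] only have to be Lipschitz in [w], uniformly on the contour. *)
Lemma contour_cder r (f g : C -> C -> C) z L : 0 <= r -> 0 <= L ->
  nbh z (fun w => edge_cont r (f w) /\ edge_cont r (g w)) ->
  nbh z (fun w => forall k t,
    f w (edge r k t) - f z (edge r k t) = (w - z) * g w (edge r k t)) ->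
  nbh z (fun w => forall k t,
    cabs (g w (edge r k t) - g z (edge r k t)) <= L * cabs (w - z)) ->
  cder (fun w => contour r (f w)) z (contour r (g z)).
Proof.
move=> r0 L0 cfg fg gL; have [cfz cgz] := nbh_center cfg.
exists (fun w => contour r (g w)); split=> //; last first.
  apply: nbhS2 cfg fg => w [cf cg] fg; rewrite mulrC addrC -contour_lin//.
  by apply: eq_contour => k t; rewrite -fg subrK.
move=> e e0; have k0 : 0 < 16 * r * L + 1 by rewrite ltr_wpDl// !mulr_ge0.
have e1 : 0 < e / (16 * r * L + 1) by rewrite divr_gt0.
apply: nbhS2 (nbhI cfg gL) (_ : nbh z (fun w => cabs (w - z) < e / (16 * r * L + 1))) => [w [[cf cg] gLw] wz|]; last by exists (e / (16 * r * L + 1)).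
rewrite addrC -mulN1r -contour_lin//; apply: (@le_lt_trans _ _ (16 * r * (L * cabs (w - z)))).
  apply: contour_bound => //.
    by move=> k; have := pcont_lin (-1) (cgz k) (cg k).
  by move=> k t _; rewrite mulN1r addrC; exact: gLw.
have : cabs (w - z) * (16 * r * L + 1) < e by rewrite -ltr_pdivlMr.
by have := cabs_ge0 (w - z); lra.
Qed.

Definition kernel w x : C := (x - w)^-1.

Lemma kernel_bound r z k t : cabs z < r -> cabs (kernel z (edge r k t)) <= (r - cabs z)^-1.
Proof.
move=> zr; rewrite /kernel cabsV lef_pV2 ?cabs_edge_sub// posrE ?subr_gt0//.
by rewrite (lt_le_trans _ (cabs_edge_sub _ _ _ _))// subr_gt0.
Qed.

Lemma kernel_near r z : cabs z < r -> nbh z (fun w => cabs w < r /\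
  forall k t, cabs (kernel w (edge r k t)) <= ((r - cabs z) / 2)^-1).
Proof.
move=> zr; exists ((r - cabs z) / 2); first by lra.
move=> w wz; have wz' : cabs w <= (r + cabs z) / 2.
  by have := cabs_subl w z; lra.
split; first by lra.
move=> k t; apply: (le_trans (kernel_bound _ _ _)); first by lra.
by rewrite lef_pV2 ?posrE; lra.
Qed.

Lemma kernel_sub r z w k t : cabs z < r -> cabs w < r ->
  kernel w (edge r k t) - kernel z (edge r k t) =
  (w - z) * (kernel w (edge r k t) * kernel z (edge r k t)).
Proof.
move=> zr wr; have := edge_neq k t zr; have := edge_neq k t wr.
by rewrite /kernel => ? ?; field; apply/andP.
Qed.

Lemma edge_contK r z : cabs z < r -> edge_cont r (kernel z).
Proof. exact: kernel_edge_cont. Qed.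

Section transform.
Variables (r M : R) (f : C -> C).
Hypotheses (r0 : 0 < r) (M0 : 0 <= M) (cf : edge_cont r f)
  (fM : forall k t, cabs (f (edge r k t)) <= M).

Definition transform n z := contour r (fun x => f x * kernel z x ^+ n).

Lemma edge_contX z n : cabs z < r -> edge_cont r (fun x => kernel z x ^+ n).
Proof.
move=> zr; elim: n => [|n IH].
  by move=> k t e e0; exists 1 => // s _; rewrite !expr0 subrr cabs0.
by have := edge_contM (edge_contK zr) IH; under eq_fun do rewrite -exprS.
Qed.

(** [1/(x-w) - 1/(x-z) = (w-z) / ((x-w)(x-z))]. *)
Lemma transform_cder1 z : cabs z < r -> cder (transform 1) z (transform 2 z).
Proof.
move=> zr; have rp := r0; set B := ((r - cabs z) / 2)^-1.
have B0 : 0 <= B by rewrite invr_ge0; lra.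
have zB : forall k t, cabs (kernel z (edge r k t)) <= B.
  by have [] := nbh_center (kernel_near zr).
have -> : transform 2 z = contour r (fun x => f x * (kernel z x * kernel z x)).
  by apply: eq_contour => k t; rewrite expr2.
apply: (@contour_cder r (fun w x => f x * kernel w x ^+ 1)
   (fun w x => f x * (kernel w x * kernel z x)) z (M * (B * B * B))).
- exact: ltW.
- by rewrite !mulr_ge0.
- apply: nbhS (kernel_near zr) => w [wr _]; split.
    by apply: edge_contM => //; exact: edge_contX.
  by apply: edge_contM => //; apply: edge_contM; exact: edge_contK.
- apply: nbhS (kernel_near zr) => w [wr _] k t.
  by rewrite !expr1 -mulrBr (kernel_sub _ _ zr wr); ring.
- apply: nbhS (kernel_near zr) => w [wr wB] k t.
  rewrite -mulrBr -mulrBl (kernel_sub _ _ zr wr) !cabsM.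
  rewrite (_ : _ * _ = cabs (f (edge r k t)) * (cabs (kernel w (edge r k t)) *
    cabs (kernel z (edge r k t)) * cabs (kernel z (edge r k t))) * cabs (w - z)); last by ring.
  by rewrite ler_wpM2r ?cabs_ge0// ler_pM ?mulr_ge0 ?cabs_ge0// ler_pM ?mulr_ge0 ?cabs_ge0// ler_pM ?cabs_ge0.
Qed.

(** The same with squares, as [u^2 - v^2 = (u - v)(u + v)]. *)
Lemma transform_diff2 z : cabs z < r -> diffable (transform 2) z.
Proof.
move=> zr; have rp := r0; set B := ((r - cabs z) / 2)^-1.
have B0 : 0 <= B by rewrite invr_ge0; lra.
have zB : forall k t, cabs (kernel z (edge r k t)) <= B.
  by have [] := nbh_center (kernel_near zr).
eexists.
apply: (@contour_cder r (fun w x => f x * kernel w x ^+ 2)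
   (fun w x => f x * (kernel w x * kernel z x * (kernel w x + kernel z x))) z (M * (B * B * B * (3 * B)))).
- exact: ltW.
- by rewrite !mulr_ge0.
- apply: nbhS (kernel_near zr) => w [wr _]; split.
    by apply: edge_contM => //; exact: edge_contX.
  apply: edge_contM => //; apply: edge_contM.
    by apply: edge_contM; exact: edge_contK.
  by apply: edge_contD; exact: edge_contK.
- apply: nbhS (kernel_near zr) => w [wr _] k t.
  have := kernel_sub k t zr wr.
  set u := kernel w _; set v := kernel z _ => uv.
  rewrite (_ : f _ * u ^+ 2 - f _ * v ^+ 2 = f (edge r k t) * (u - v) * (u + v)); last by ring.
  by rewrite uv; ring.
- apply: nbhS (kernel_near zr) => w [wr wB] k t.
  have := kernel_sub k t zr wr; have := wB k t; have := zB k t.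
  set u := kernel w _; set v := kernel z _ => vB uB uv.
  rewrite (_ : _ - _ = f (edge r k t) * ((u - v) * v * (u + 2 * v))); last by ring.
  rewrite uv !cabsM.
  rewrite (_ : _ * _ = cabs (f (edge r k t)) * (cabs u * cabs v * cabs v * cabs (u + 2 * v)) * cabs (w - z)); last by ring.
  have h3 : cabs (u + 2 * v) <= 3 * B.
    by rewrite (le_trans (cabsD _ _))// cabsM cabs_nat; rewrite -/B in uB vB; lra.
  rewrite ler_wpM2r ?cabs_ge0// ler_pM ?mulr_ge0 ?cabs_ge0//.
  rewrite ler_pM ?mulr_ge0 ?cabs_ge0// ler_pM ?mulr_ge0 ?cabs_ge0//.
  by rewrite ler_pM ?cabs_ge0.
Qed.

Lemma transform_bound z : cabs z <= r / 2 -> cabs (transform 1 z) <= 32 * M.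
Proof.
move=> zr; have rp := r0; have zr' : cabs z < r by lra.
apply: le_trans (contour_bound (ltW r0) (M := M * (2 / r)) _ _) _.
- by apply: edge_contM => //; exact: edge_contX.
- move=> k t _; rewrite cabsM expr1 ler_pM ?cabs_ge0//.
  apply: (le_trans (kernel_bound _ _ zr')).
  by rewrite -[2 / r]invf_div lef_pV2 ?posrE; lra.
- by rewrite (_ : _ * _ = 32 * M)//; field; exact: lt0r_neq0.
Qed.

Lemma transform_lip z : cabs z <= r / 2 ->
  cabs (transform 1 z - transform 1 0) <= 32 * M / r * cabs z.
Proof.
move=> zr; have rp := r0; have zr' : cabs z < r by lra.
have r0' : cabs (0 : C) < r by rewrite cabs0.
rewrite addrC -mulN1r -contour_lin//; try by apply: edge_contM => //; exact: edge_contX.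
apply: le_trans (contour_bound (ltW r0) (M := M * (cabs z * (2 / r * r^-1))) _ _) _.
- by apply: edge_contD; [move=> k; have := pcont_lin (-1) (edge_contM cf (edge_contX 1 r0') k) (ccont_edge_cont r (fun z => ccont_cst 0 z) k); congr pcont; apply/funext => t; rewrite addr0|apply: edge_contM => //; exact: edge_contX].
- move=> k t _; rewrite mulN1r addrC !expr1 -mulrBr (kernel_sub _ _ r0' zr') subr0 !cabsM.
  rewrite ler_pM ?mulr_ge0 ?cabs_ge0// ler_wpM2l ?cabs_ge0// ler_pM ?cabs_ge0//.
    apply: (le_trans (kernel_bound _ _ zr')).
    by rewrite -[2 / r]invf_div lef_pV2 ?posrE; lra.
  by apply: (le_trans (kernel_bound _ _ r0')); rewrite cabs0 subr0.
- rewrite [leRHS](_ : _ = 16 * r * (M * (cabs z * (2 / r * r^-1))))//.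
  by field; exact: lt0r_neq0.
Qed.

End transform.

(** Each of the four sides contributes a positive imaginary part to the winding
    integral, at least [2 r / (9 r)]. *)
Lemma winding_ge r z : 0 < r -> cabs z <= r / 2 ->
  2^-1 <= cabs (transform r (fun=> 1) 1 z).
Proof.
move=> r0 zr; have zr' : cabs z < r by lra.
rewrite (le_trans _ (Im_le_cabs _))// (le_trans _ (ler_norm _))//.
rewrite /transform /contour raddf_sum /=.
rewrite (@le_trans _ _ (\sum_(k < 4) (9 * r)^-1 * (r - - r)))//.
  rewrite sumr_const card_ord (_ : _ *+ 4 = 8 / 9); first by lra.
  by rewrite -mulr_natl; field; exact: lt0r_neq0.
apply: ler_sum => k _; set p := (fun t => _).
have cp : pcont p.
  rewrite /p; have := @edge_contX r z 1 zr' k; congr pcont.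
  by apply/funext => t; rewrite mul1r.
have c0 : pcont (fun=> 0 : C) by move=> t e e0; exists 1 => // s _; rewrite subrr cabs0.
have -> : 'i%C ^+ k * cint p (- r) r = cint (fun t => 'i%C ^+ k * p t + 0) (- r) r.
  rewrite cint_lin// (_ : cint (fun=> 0) _ _ = 0) ?addr0//.
  have := @cint_affine R 0 0 (- r) r; rewrite [RHS](_ : _ = 0); last by ring.
  by under eq_fun do rewrite mul0r addr0.
apply: cint_Im_ge; first by lra.
  exact: pcont_lin.
move=> t tr; rewrite /p addr0 mul1r expr1 /kernel edge_sub.
have nz : 'i%C ^+ k != 0 :> C by rewrite -cabs_gt0 cabs_iX.
rewrite [X in Im X](_ : _ = (t%:C - r%:C * 'i%C - z / 'i%C ^+ k)^-1); last by rewrite invfM mulVKf.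
have : cabs (z / 'i%C ^+ k) <= r / 2 by rewrite cabsM cabsV cabs_iX invr1 mulr1.
case: (z / _) => u v uv.
have hu : `|u| <= r / 2 := le_trans (Re_le_cabs (u +i* v)) uv.
have hv : `|v| <= r / 2 := le_trans (Im_le_cabs (u +i* v)) uv.
have -> : t%:C - r%:C * 'i%C - (u +i* v) = (t - u) +i* (- (r + v)).
  by apply/eqP; rewrite eq_complex /=; apply/andP; split; apply/eqP; ring.
move: hu hv; rewrite !ler_norml => hu hv.
set b := r + v; set a := t - u.
have -> : Im (a +i* (- b))^-1 = b / (a ^+ 2 + b ^+ 2).
  by rewrite /= sqrrN mulNr opprK.
have b0 : r / 2 <= b by rewrite /b; lra.
have b1 : b <= 3 / 2 * r by rewrite /b; lra.
have ab : a ^+ 2 + b ^+ 2 <= 9 / 2 * r ^+ 2.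
  have a2 : a ^+ 2 <= (3 / 2 * r) ^+ 2.
    have : 0 <= (3 / 2 * r - a) * (3 / 2 * r + a) by rewrite mulr_ge0//; rewrite /a; lra.
    by lra.
  have b2 : b ^+ 2 <= (3 / 2 * r) ^+ 2 by rewrite ler_pXn2r ?nnegrE//; lra.
  by move: a2 b2; rewrite exprMn; lra.
have ab0 : 0 < a ^+ 2 + b ^+ 2 by rewrite ltr_wpDl ?sqr_ge0// exprn_gt0//; lra.
rewrite ler_pdivlMr// mulrC ler_pdivrMr ?mulr_gt0//.
apply: (le_trans ab); rewrite expr2.
rewrite (_ : 9 / 2 * (r * r) = r / 2 * (9 * r)); last by ring.
by rewrite ler_wpM2r//; lra.
Qed.

(** Here [h = A / W], where [A] is the Cauchy transform of [h] and [W] that of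
    the constant [1].  Both have two derivatives and [W] stays away from [0]. *)
Section regularity.
Variables (r M : R) (h : C -> C).
Hypotheses (r0 : 0 < r) (ch : forall z, ccont h z) (hM : forall z, cabs (h z) <= M)
  (dh : forall w, in_rect (- r) r (- r) r w -> w != 0 -> diffable h w).

Let W := transform r (fun=> 1) 1.
Let W2 := transform r (fun=> 1) 2.
Let A := transform r h 1.
Let A2 := transform r h 2.

Let M0 : 0 <= M. Proof. exact: le_trans (cabs_ge0 (h 0)) (hM 0). Qed.

Let c1 : edge_cont r (fun=> 1).
Proof. by move=> k t e e0; exists 1 => // s _; rewrite subrr cabs0. Qed.

Let b1 k t : cabs ((fun=> 1 : C) (edge r k t)) <= 1 :> R.
Proof. by rewrite cabs1. Qed.

Let dW z : cabs z < r -> cder W z (W2 z).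
Proof. by move=> zr; have rp := r0; exact: (transform_cder1 r0 ler01 c1 b1 zr). Qed.

Let dA z : cabs z < r -> cder A z (A2 z).
Proof.
move=> zr; have rp := r0; apply: (transform_cder1 r0 M0 _ _ zr) => //; exact: ccont_edge_cont.
Qed.

Let W_neq0 z : cabs z <= r / 2 -> W z != 0.
Proof. by move=> zr; have rp := r0; rewrite -cabs_gt0 (lt_le_trans _ (winding_ge r0 zr))// invr_gt0. Qed.

Let hW z : cabs z < r -> h z * W z = A z.
Proof.
move=> zr; have rp := r0; wlog z0 : z zr / z != 0.
  move=> H; have [->|] := eqVneq z 0; last exact: H.
  have z0r : cabs (0 : C) < r by rewrite cabs0.
  apply: (@ccont_eq _ (fun z => h z * W z)).
  - by apply: ccontM => //; exact: cder_ccont (dW z0r).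
  - exact: cder_ccont (dA z0r).
  - by exists r => // w; rewrite subr0; exact: H.
have zin : in_rect (- r) r (- r) r z.
  have := Re_le_cabs z; have := Im_le_cabs z; rewrite !ler_norml /in_rect; lra.
have := cauchy_formula zr ch (dh zin z0) dh.
rewrite (@eq_contour _ _ (fun x => 1 * kernel z x ^+ 1)).
  rewrite -/(transform _ _ _ _) -/W => ->.
  by apply: eq_contour => k t; rewrite expr1.
by move=> k t; rewrite mul1r expr1.
Qed.

Let hE z : cabs z <= r / 2 -> h z = A z * (W z)^-1.
Proof.
move=> zr; have rp := r0; rewrite -hW; last by lra.
by rewrite mulfK// W_neq0.
Qed.

Let near_half z : cabs z < r / 2 -> nbh z (fun w => cabs w < r / 2).
Proof. by move=> zr; have rp := r0; have := @nbh_ball _ 0 (r / 2) z; rewrite subr0 => /(_ zr); apply: nbhS => w; rewrite subr0. Qed.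

Let dh' z : cabs z < r / 2 -> cder h z (A2 z * (W z)^-1 + A z * (- W2 z / W z ^+ 2)).
Proof.
move=> zr; have rp := r0; apply: (@eq_cder _ (fun w => A w * (W w)^-1)).
  by apply: nbhS (near_half zr) => w wr; rewrite hE// ltW.
apply: cderM; first by apply: dA; lra.
apply: cderV; first by rewrite W_neq0// ltW.
by apply: dW; lra.
Qed.

Lemma regularity_diff z : cabs z < r / 2 -> diffable h z.
Proof. by move=> /dh' ?; eexists; eassumption. Qed.

Lemma regularity_cderiv z : cabs z < r / 2 -> diffable (cderiv h) z.
Proof.
move=> zr; have rp := r0; have zr' : cabs z < r by lra.
have [A3 dA2] : diffable A2 z.
  apply: (transform_diff2 r0 M0 _ _ zr') => //; exact: ccont_edge_cont.
have [W3 dW2] : diffable W2 z by exact: (transform_diff2 r0 ler01 c1 b1 zr').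
have Wz := W_neq0 (ltW zr).
eexists; apply: (@eq_cder _ (fun w => A2 w * (W w)^-1 + A w * (- W2 w * (W w ^+ 2)^-1))).
  by apply: nbhS (near_half zr) => w /dh'/cderivE ->.
apply: cderD; first exact: (cderM dA2 (cderV Wz (dW zr'))).
apply: cderM; first exact: dA.
apply: cderM; first exact: (cderN dW2).
by apply: cderV; [rewrite expf_neq0|apply: cderX; exact: dW].
Qed.

(** Only the values on the boundary enter: a weak maximum principle. *)
Lemma regularity_bound M' z :
  (forall k t, cabs (h (edge r k t)) <= M') -> cabs z <= r / 2 ->
  cabs (h z) <= 64 * M'.
Proof.
move=> hM' zr; have rp := r0; have M'0 : 0 <= M' := le_trans (cabs_ge0 _) (hM' 0%N 0).
rewrite hE// cabsM cabsV.
have := transform_bound r0 (ccont_edge_cont r ch) hM' zr.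
have Wz := winding_ge r0 zr; rewrite -/A => Az.
rewrite -/W in Wz; have Wp : 0 < cabs (W z) by rewrite (lt_le_trans _ Wz)// invr_gt0.
by rewrite ler_pdivrMr//; apply: (le_trans Az); nra.
Qed.

Lemma regularity_lip z : cabs z <= r / 2 ->
  cabs (h z - h 0) <= 128 * M / r * cabs z.
Proof.
move=> zr; have rp := r0; have z0r : cabs (0 : C) <= r / 2 by rewrite cabs0; lra.
have Wz := winding_ge r0 z0r; rewrite -/W in Wz.
have e : (h z - h 0) * W 0 = (A z - A 0) - h z * (W z - W 0).
  by rewrite -!hW ?cabs0//; [ring|lra].
have hA := transform_lip r0 (ccont_edge_cont r ch) (fun k t => hM _) zr.
have hWl := transform_lip r0 c1 b1 zr; rewrite mulr1 -/W in hWl.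
have : cabs ((h z - h 0) * W 0) <= 64 * M / r * cabs z.
  rewrite e (le_trans (cabsB _ _))// cabsM.
  have : cabs (h z) * cabs (W z - W 0) <= M * (32 / r * cabs z).
    by rewrite ler_pM ?cabs_ge0.
  by rewrite -/A in hA; lra.
rewrite cabsM => H; have : cabs (h z - h 0) * 2^-1 <= 64 * M / r * cabs z.
  by apply: le_trans H; rewrite ler_wpM2l ?cabs_ge0.
lra.
Qed.

End regularity.

End cauchy_transform.

(** * Local theory of holomorphic functions *)

Section local_theory.
Variable R : realType.
Local Notation C := R[i].
Local Notation Re := (@complex.Re R).
Local Notation Im := (@complex.Im R).
Implicit Types (h k f g : C -> C) (r s M : R) (z w x : C).

Definition holo h z := nbh z (diffable h).

Definition clip s z : C :=
  (Num.max (- s) (Num.min s (Re z))) +i* (Num.max (- s) (Num.min s (Im z))).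

(** [clip s] retracts the plane onto a square; composing with it extends local
    functions to the whole plane, where the integrals are defined. *)
Lemma ccont_clip s z : 0 < s -> ccont (clip s) z.
Proof.
move=> s0 e e0; exists (e / 2); first by lra.
have lip_max (u v : R) : u <= v ->
    0 <= Num.max (- s) v - Num.max (- s) u <= v - u.
  by move=> uv; case: (leP (- s) v) => ?; case: (leP (- s) u) => ?; lra.
have lip_min (u v : R) : u <= v -> 0 <= Num.min s v - Num.min s u <= v - u.
  by move=> uv; case: (leP s v) => ?; case: (leP s u) => ?; lra.
have lip (x y : R) : `|Num.max (- s) (Num.min s x) - Num.max (- s) (Num.min s y)| <= `|x - y|.
  wlog xy : x y / x <= y.
    by move=> H; have [/H//|/ltW/H] := leP x y; rewrite distrC [leRHS]distrC.
  have /andP[m0 m1] := lip_min _ _ xy.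
  have /andP[M0 M1] : 0 <= Num.max (- s) (Num.min s y) - Num.max (- s) (Num.min s x)
      <= Num.min s y - Num.min s x by apply: lip_max; rewrite -subr_ge0.
  by rewrite distrC ger0_norm// distrC ger0_norm ?subr_ge0//; exact: le_trans m1.
move=> w wz; rewrite (le_lt_trans (cabs_le_ReIm _))//=.
have := Re_le_cabs (w - z); have := Im_le_cabs (w - z); rewrite !raddfB /=.
by have := lip (Re w) (Re z); have := lip (Im w) (Im z); lra.
Qed.

Lemma clip_id s z : `|Re z| <= s -> `|Im z| <= s -> clip s z = z.
Proof.
case: z => u v /=; rewrite !ler_norml => /andP[u1 u2] /andP[v1 v2].
by rewrite /clip /= !(min_idPr _)// !(max_idPr _).
Qed.

Lemma cabs_clip s z : 0 <= s -> cabs (clip s z) <= 2 * s.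
Proof.
move=> s0; rewrite (le_trans (cabs_le_ReIm _))//=.
have H (x : R) : `|Num.max (- s) (Num.min s x)| <= s.
  rewrite ler_norml le_max lexx /= ge_max ge_min lexx/= andbT; lra.
by have := H (Re z); have := H (Im z); lra.
Qed.

Lemma cder_shift h z0 z l : cder h (z0 + z) l -> cder (fun w => h (z0 + w)) z l.
Proof.
move=> dh; have := cderD (cder_cst z0 z) (cder_id z); rewrite add0r => ds.
by have := cder_comp ds dh; rewrite mulr1.
Qed.

(** The retraction is onto the square of half-side [s / 4], so that its image
    lies in the disc of radius [s] and a neighbourhood of the smaller square of
    half-side [s / 8] is left fixed. *)
Lemma localize h z0 s M : 0 < s ->
  (forall w, cabs (w - z0) < s -> ccont h w) ->
  (forall w, cabs (w - z0) < s -> w != z0 -> diffable h w) ->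
  (forall w, cabs (w - z0) < s -> cabs (h w) <= M) ->
  exists H : C -> C,
    [/\ forall z, ccont H z, forall z, cabs (H z) <= M,
        forall w, in_rect (- (s / 8)) (s / 8) (- (s / 8)) (s / 8) w -> w != 0 ->
          diffable H w &
        forall w, `|Re w| < s / 4 -> `|Im w| < s / 4 -> H w = h (z0 + w)].
Proof.
move=> s0 ch dh hM; have s40 : 0 < s / 4 by lra.
have small z : cabs (z0 + clip (s / 4) z - z0) < s.
  by rewrite addrC addKr; have := cabs_clip z (ltW s40); lra.
have HE w : `|Re w| < s / 4 -> `|Im w| < s / 4 -> h (z0 + clip (s / 4) w) = h (z0 + w).
  by move=> /ltW rw /ltW iw; rewrite clip_id.
exists (fun w => h (z0 + clip (s / 4) w)); split=> //.
- move=> z; apply: (@ccont_comp _ (fun w => z0 + clip (s / 4) w) h); last exact/ch.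
  by apply: ccontD; [exact: ccont_cst|exact: ccont_clip].
- by move=> z; exact: hM.
- move=> w wr w0.
  have ws : cabs (z0 + w - z0) < s.
    rewrite addrC addKr (le_lt_trans (cabs_le_ReIm _))//.
    have : `|Re w| <= s / 8 by rewrite ler_norml; move: wr; rewrite /in_rect; lra.
    have : `|Im w| <= s / 8 by rewrite ler_norml; move: wr; rewrite /in_rect; lra.
    by lra.
  have wz0 : z0 + w != z0 by rewrite -subr_eq0 addrC addKr.
  have [l dl] := dh _ ws wz0.
  exists l; apply: (@eq_cder _ (fun w => h (z0 + w))); last exact: cder_shift.
  exists (s / 8); first by lra.
  move=> x xw; rewrite HE//.
    have := Re_le_cabs (x - w); rewrite raddfB /= ler_norml => H.
    by move: wr; rewrite /in_rect ltr_norml; lra.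
  have := Im_le_cabs (x - w); rewrite raddfB /= ler_norml => H.
  by move: wr; rewrite /in_rect ltr_norml; lra.
Qed.

Lemma unshift h z0 (H : C -> C) (s : R) z l : 
  (forall w, `|Re w| < s -> `|Im w| < s -> H w = h (z0 + w)) ->
  cabs (z - z0) < s -> cder H (z - z0) l -> cder h z l.
Proof.
move=> HE zs dH; apply: (@eq_cder _ (fun w => H (- z0 + w))).
  apply: nbhS (nbh_ball zs) => w ws; rewrite HE ?addrA ?subrr ?add0r//.
    by rewrite (le_lt_trans (Re_le_cabs _))// addrC.
  by rewrite (le_lt_trans (Im_le_cabs _))// addrC.
by apply: cder_shift; rewrite addrC.
Qed.

(** Cauchy's formula does not see an isolated point of the square at which the
    function is merely continuous. *)
Lemma holo_removable h z0 : nbh z0 (ccont h) ->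
  nbh z0 (fun w => w != z0 -> diffable h w) -> holo h z0 /\ holo (cderiv h) z0.
Proof.
move=> ch dh; have [s s0 H] := nbhI (nbhI ch dh) (ccont_bounded (nbh_center ch)).
have [K [cK KM dK KE]] : exists H : C -> C,
    [/\ forall z, ccont H z, forall z, cabs (H z) <= cabs (h z0) + 1,
        forall w, in_rect (- (s / 8)) (s / 8) (- (s / 8)) (s / 8) w -> w != 0 ->
          diffable H w &
        forall w, `|Re w| < s / 4 -> `|Im w| < s / 4 -> H w = h (z0 + w)].
  apply: localize => // w /H[[]]//.
  by move=> _ _ /ltW.
have s8 : 0 < s / 8 by lra.
have hD z : cabs (z - z0) < s / 16 -> cder h z (cderiv K (z - z0)).
  move=> zs; apply: (unshift KE); first by lra.
  by apply/cderivP/(regularity_diff s8 cK KM dK); lra.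
split; first by exists (s / 16); [lra|move=> w /hD; exists (cderiv K (w - z0))].
exists (s / 16); first by lra.
move=> w ws; have [|l dl] := regularity_cderiv s8 cK KM dK (z := w - z0); first by lra.
exists l; apply: (@eq_cder _ (fun x => cderiv K (- z0 + x))).
  by apply: nbhS (nbh_ball ws) => x /hD/cderivE ->; rewrite addrC.
by apply: cder_shift; rewrite addrC.
Qed.

Lemma diffable_ccont h z : diffable h z -> ccont h z.
Proof. by move=> [l]; exact: cder_ccont. Qed.

Lemma holo_cderiv h z : holo h z -> holo (cderiv h) z.
Proof.
move=> hh; have [] // := @holo_removable h z; first by apply: nbhS hh => w /diffable_ccont.
by apply: nbhS hh.
Qed.

Lemma holo_lip h z0 s M z : 0 < s ->
  (forall w, cabs (w - z0) < s -> diffable h w /\ cabs (h w) <= M) ->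
  cabs (z - z0) <= s / 16 -> cabs (h z - h z0) <= 1024 * M / s * cabs (z - z0).
Proof.
move=> s0 H zs.
have [|||K [cK KM dK KE]] := @localize h z0 s M s0.
- by move=> w /H[dw _]; exact: diffable_ccont.
- by move=> w /H[].
- by move=> w /H[].
have s8 : 0 < s / 8 by lra.
have KE' w : cabs (w - z0) <= s / 16 -> K (w - z0) = h w.
  move=> ws; rewrite KE ?subrKC//; first by rewrite (le_lt_trans (Re_le_cabs _))//; lra.
  by rewrite (le_lt_trans (Im_le_cabs _))//; lra.
have := regularity_lip s8 cK KM dK (z := z - z0).
have -> : K 0 = h z0 by rewrite -KE' subrr ?cabs0//; lra.
rewrite KE'//.
rewrite (_ : 128 * M / (s / 8) = 1024 * M / s); last by field; exact: lt0r_neq0.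
by apply; lra.
Qed.

(** The derivative is the value at [z0] of the difference quotient, which
    [holo_lip] bounds at nearby points. *)
Lemma cauchy_estimate h z0 s M : 0 < s ->
  (forall w, cabs (w - z0) < s -> diffable h w /\ cabs (h w) <= M) ->
  cabs (cderiv h z0) <= 1024 * M / s.
Proof.
move=> s0 H; have [dz0 hz0] : diffable h z0 /\ cabs (h z0) <= M by apply: H; rewrite subrr cabs0.
have [q [cq <- hq]] := cderivP dz0.
rewrite leNgt; apply/negP => Hlt; set L := 1024 * M / s in Hlt.
have e0 : 0 < cabs (q z0) - L by rewrite subr_gt0.
have s16 : nbh z0 (fun w => cabs (w - z0) < s / 16) by exists (s / 16) => //; lra.
have [w wz] : exists2 w, w != z0 &
   [/\ h w = h z0 + q w * (w - z0), cabs (q w - q z0) < cabs (q z0) - L & cabs (w - z0) < s / 16].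
  apply: nbh_punctured_ex; apply: nbhS2 (nbhI hq (cq _ e0)) s16 => w [? ?] ? _.
  by split.
move=> [hw qw ws]; have := holo_lip s0 H (ltW ws).
rewrite hw addrC addKr cabsM ler_pM2r ?cabs_gt0 ?subr_eq0// -/L => qL.
by have := cabs_subl (q z0) (q w); rewrite [cabs (q z0 - _)]cabsC; lra.
Qed.

Section factorization.
Variables (r : R).
Hypothesis r0 : 0 < r.

(** Functions defined on the plane to which [cauchy_formula] applies on the
    square of half-side [r], the origin being a possible singularity. *)
Definition regular0 h := [/\ forall z, ccont h z, exists M, forall z, cabs (h z) <= M &
  forall w, in_rect (- r) r (- r) r w -> w != 0 -> diffable h w].

Lemma regular0_div h : regular0 h -> h 0 = 0 ->
  exists2 k, regular0 k & forall w, h w = w * k w.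
Proof.
move=> [ch [M hM] dh] h0; have rp := r0.
have d0 : diffable h 0 by apply: (regularity_diff r0 ch hM dh); rewrite cabs0; lra.
pose k w := if w == 0 then cderiv h 0 else h w / w.
have kE w : w != 0 -> nbh w (fun x => h x / x = k x).
  by move=> w0; apply: nbhS (nbh_neq w0) => x /negPf x0; rewrite /k x0.
have ck0 : ccont k 0.
  have [q [cq ql hq]] := cderivP d0; apply: (@eq_ccont _ q) => //.
  apply: nbhS hq => x; rewrite /k; case: eqVneq => [-> _ //|x0 ->].
  by rewrite h0 add0r subr0 mulfK.
exists k; last first.
  by move=> w; rewrite /k; case: eqVneq => [->|w0]; rewrite ?mul0r// mulrC divfK.
split.
- move=> z; have [->//|z0] := eqVneq z 0.
  apply: (eq_ccont (kE z z0)); apply: ccontM => //.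
  by apply: (@ccontV _ id) => //; exact: ccont_id.
- have [d dp H] := ccont_bounded ck0; have M0 := le_trans (cabs_ge0 _) (hM 0).
  exists (cabs (k 0) + 1 + M / d) => z.
  have [zd|zd] := ltP (cabs z) d.
    have := H z; rewrite subr0 => /(_ zd) /ltW ?.
    by rewrite (le_trans (_ : _ <= cabs (k 0) + 1))// lerDl divr_ge0// ltW.
  have z0 : z != 0 by rewrite -cabs_gt0 (lt_le_trans dp).
  have -> : k z = h z / z by rewrite /k (negPf z0).
  rewrite cabsM cabsV; apply: (@le_trans _ _ (M / d)); last first.
    by rewrite lerDr addr_ge0// cabs_ge0.
  rewrite ler_pM ?cabs_ge0 ?invr_ge0 ?cabs_ge0//.
  by rewrite lef_pV2// posrE (lt_le_trans dp).
- move=> w wr w0; have [l dl] := dh w wr w0.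
  eexists; apply: (eq_cder (kE w w0)); apply: cderM dl _.
  exact: (@cderV _ id _ _ w0 (cder_id _)).
Qed.

(** If the origin could be divided out [m] times for every [m], the quotients
    [h / z^m] would be bounded by [64 M / r^m] inside the square, by their values
    on its boundary, so that [h] would be at most [64 M / 2^m] there. *)
Lemma regular0_factor h : regular0 h ->
  (forall z, cabs z <= r / 2 -> h z = 0) \/
  exists m k, [/\ regular0 k, k 0 != 0 & forall w, h w = w ^+ m * k w].
Proof.
move=> rh; have [|nex] := pselect (exists m k, [/\ regular0 k, k 0 != 0 & forall w, h w = w ^+ m * k w]).
  by right.
left; have rp := r0.
have chain m : exists2 k, regular0 k & forall w, h w = w ^+ m * k w.
  elim: m => [|m [k rk hk]]; first by exists h => // w; rewrite expr0 mul1r.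
  have [k0|k0] := eqVneq (k 0) 0; last by exfalso; apply: nex; exists m, k.
  have [k' rk' kk'] := regular0_div rk k0; exists k' => // w.
  by rewrite hk kk' exprSr mulrA.
have [_ [M hM] _] := rh.
have M0 : 0 <= M := le_trans (cabs_ge0 _) (hM 0).
move=> z zr.
have bound m : cabs (h z) <= 64 * M / 2 ^+ m.
  have [k [ck [Mk hMk] dk] hk] := chain m.
  have kedge j t : cabs (k (edge r j t)) <= M / r ^+ m.
    rewrite ler_pdivlMr ?exprn_gt0//.
    apply: le_trans (hM (edge r j t)); rewrite hk cabsM cabsX mulrC.
    rewrite ler_wpM2r ?cabs_ge0// lerXn2r ?nnegrE ?cabs_ge0 ?(ltW r0)//.
    exact: cabs_edge.
  have kz := regularity_bound r0 ck hMk dk kedge zr.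
  rewrite hk cabsM cabsX.
  apply: (@le_trans _ _ ((r / 2) ^+ m * (64 * (M / r ^+ m)))).
    rewrite ler_pM ?exprn_ge0 ?cabs_ge0// lerXn2r ?nnegrE ?cabs_ge0//; lra.
  rewrite le_eqVlt; apply/orP; left; apply/eqP; rewrite expr_div_n; field.
  by rewrite !expf_neq0// ?pnatr_eq0// lt0r_neq0.
apply: cabs_lt0_eq0 => e e0.
have [m Hm] : exists m : nat, 64 * M / e < m%:R.
  by exists (Num.truncn (64 * M / e)).+1; rewrite truncnS_gt.
apply: le_lt_trans (bound m) _; rewrite ltr_pdivrMr ?exprn_gt0//.
rewrite [ltRHS]mulrC -ltr_pdivrMr//; apply: (lt_trans Hm).
by rewrite -natrX ltr_nat ltn_expl.
Qed.

End factorization.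

Lemma holo_factor h z0 : holo h z0 ->
  nbh z0 (fun w => h w = 0) \/
  exists m k, [/\ holo k z0, k z0 != 0 & nbh z0 (fun w => h w = (w - z0) ^+ m * k w)].
Proof.
move=> hh; have [s s0 H] := nbhI hh (ccont_bounded (diffable_ccont (nbh_center hh))).
have [|||K [cK KM dK KE]] := @localize h z0 s (cabs (h z0) + 1) s0.
- by move=> w /H[dw _]; exact: diffable_ccont.
- by move=> w /H[].
- by move=> w /H[_ ?]; exact: ltW.
have s8 : 0 < s / 8 by lra.
have rK : regular0 (s / 8) K by split=> //; exists (cabs (h z0) + 1).
have KE' w : cabs (w - z0) < s / 16 -> h w = K (w - z0).
  move=> ws; rewrite KE ?subrKC//; first by rewrite (le_lt_trans (Re_le_cabs _))//; lra.
  by rewrite (le_lt_trans (Im_le_cabs _))//; lra.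
have [K0|[m [k [[ck [Mk kMk] dk] k0 Kk]]]] := regular0_factor s8 rK; [left|right].
  by exists (s / 16); [lra|move=> w ws; rewrite KE'// K0//; lra].
exists m, (fun w => k (- z0 + w)); split.
- exists (s / 16); first by lra.
  move=> w ws; have [|l dl] := regularity_diff s8 ck kMk dk (z := w - z0); first by lra.
  by exists l; apply: cder_shift; rewrite addrC.
- by rewrite addNr.
- by exists (s / 16); [lra|move=> w ws; rewrite KE'// Kk [- z0 + w]addrC].
Qed.

End local_theory.

(** * Holomorphic and meromorphic functions *)

Section holomorphic_algebra.
Variable R : realType.
Local Notation C := R[i].
Implicit Types (h k f g : C -> C) (r s M : R) (z w x : C).

Lemma eq_holo f g z : nbh z (fun w => f w = g w) -> holo f z -> holo g z.
Proof.
move=> fg; apply: nbhS2 (nbh_open fg) => w fgw [l dl]; exists l.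
exact: eq_cder fgw dl.
Qed.

Lemma holo_cst c z : holo (fun=> c) z.
Proof. by apply: nbhT => w; exists 0; exact: cder_cst. Qed.

Lemma holo_id z : holo id z.
Proof. by apply: nbhT => w; exists 1; exact: cder_id. Qed.

Lemma holoD f g z : holo f z -> holo g z -> holo (fun w => f w + g w) z.
Proof. by apply: nbhS2 => w [l dl] [m dm]; eexists; exact: cderD dl dm. Qed.

Lemma holoN f z : holo f z -> holo (fun w => - f w) z.
Proof. by apply: nbhS => w [l dl]; eexists; exact: cderN dl. Qed.

Lemma holoB f g z : holo f z -> holo g z -> holo (fun w => f w - g w) z.
Proof. by move=> hf hg; apply: holoD => //; exact: holoN. Qed.

Lemma holoM f g z : holo f z -> holo g z -> holo (fun w => f w * g w) z.
Proof. by apply: nbhS2 => w [l dl] [m dm]; eexists; exact: cderM dl dm. Qed.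

Lemma holoX f n z : holo f z -> holo (fun w => f w ^+ n) z.
Proof. by apply: nbhS => w [l dl]; eexists; exact: cderX dl. Qed.

Lemma holo_ccont f z : holo f z -> ccont f z.
Proof. by move=> /nbh_center /diffable_ccont. Qed.

Lemma holoV f z : holo f z -> f z != 0 -> holo (fun w => (f w)^-1) z.
Proof.
move=> hf fz; apply: nbhS2 hf (ccont_nbh_neq0 (holo_ccont hf) fz) => w [l dl] fw.
by eexists; exact: cderV dl.
Qed.

Lemma holo_horner (p : {poly C}) f z : holo f z -> holo (fun w => p.[f w]) z.
Proof. by apply: nbhS => w [l dl]; eexists; exact: cder_horner dl. Qed.

Lemma holo_prod (I : Type) (s : seq I) (P : pred I) (F : I -> C -> C) z :
  (forall i, P i -> holo (F i) z) -> holo (fun w => \prod_(i <- s | P i) F i w) z.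
Proof.
move=> hF; elim: s => [|i s IH].
  by apply: eq_holo (holo_cst 1 z); apply: nbhT => w; rewrite big_nil.
have [Pi|Pi] := boolP (P i).
  apply: eq_holo (holoM (hF i Pi) IH); apply: nbhT => w.
  by rewrite big_cons Pi.
by apply: eq_holo IH; apply: nbhT => w; rewrite big_cons (negPf Pi).
Qed.

Lemma eq_cderiv f g z : nbh z (fun w => f w = g w) -> cderiv f z = cderiv g z.
Proof.
move=> fg; rewrite /cderiv; congr (xget _ _); apply/seteqP; split=> l /=.
  exact: eq_cder.
by apply: eq_cder; apply: nbhS fg.
Qed.

Lemma holomorphic_at_holo h z : holomorphic_at h z -> holo h z.
Proof. by rewrite /holomorphic_at nbhE; apply: nbhS => w; exact: derivable_diffable. Qed.

(** Cancelling the smaller power would leave a function vanishing at [z]. *)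
Lemma order_unique (a b : C -> C) m n z : ccont a z -> ccont b z ->
  a z != 0 -> b z != 0 ->
  nbh z (fun w => w != z -> (w - z) ^+ m * a w = (w - z) ^+ n * b w) -> m = n.
Proof.
wlog mn : a b m n / (m <= n)%N.
  move=> H ca cb a0 b0 ab; have [mn|/ltnW nm] := leqP m n; first exact: (H a b).
  by apply/esym; apply: (H b a) => //; apply: nbhS ab => w ab wz; rewrite ab.
move=> ca cb a0 b0 ab; apply/eqP; rewrite eqn_leq mn /= leqNgt; apply/negP => lt.
suff : a z = 0 by move/eqP; rewrite (negPf a0).
have -> : 0 = (z - z) ^+ (n - m) * b z by rewrite subrr expr0n subn_eq0 leqNgt lt mul0r.
apply: (@ccont_eq _ a (fun w => (w - z) ^+ (n - m) * b w)) => //.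
  by apply: ccontM => //; apply: ccontX; apply: ccontB; [exact: ccont_id|exact: ccont_cst].
apply: nbhS ab => w ab wz; have := ab wz; rewrite -{1}(subnKC mn) exprD -mulrA.
by move/mulfI; apply; rewrite expf_neq0// subr_eq0.
Qed.

(** Connectedness of segments, in the form of a property that is locally
    constant along one.  The point reached is the supremum of the parameters up
    to which the property holds. *)
Lemma segment_clopen (S : C -> Prop) z1 z2 :
  (forall t : R, 0 <= t <= 1 -> let w := z1 + t%:C * (z2 - z1) in
     (S w -> nbh w S) /\ (~ S w -> nbh w (fun x => ~ S x))) ->
  S z1 -> S z2.
Proof.
pose g (t : R) := z1 + t%:C * (z2 - z1).
have gsub s t : cabs (g s - g t) = `|s - t| * cabs (z2 - z1).
  rewrite (_ : g s - g t = (s - t)%:C * (z2 - z1)) ?cabsM ?cabs_real//.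
  by rewrite /g rmorphB /=; ring.
have gc t (T : C -> Prop) : nbh (g t) T ->
    exists2 d : R, 0 < d & forall s, `|s - t| < d -> T (g s).
  move=> [d d0 H]; have k0 : 0 < cabs (z2 - z1) + 1 by rewrite ltr_wpDl// cabs_ge0.
  exists (d / (cabs (z2 - z1) + 1)); first by rewrite divr_gt0.
  move=> s; rewrite ltr_pdivlMr// => st; apply: H; rewrite gsub.
  by apply: le_lt_trans st; rewrite ler_wpM2l// lerDl.
move=> H S1.
pose A : set R := [set t | 0 <= t <= 1 /\ forall s, 0 <= s <= t -> S (g s)].
have A0 : A 0.
  split; first by rewrite lexx ler01.
  move=> s s0; have -> : s = 0 by apply/eqP; rewrite eq_le andbC.
  by rewrite /g mul0r addr0.
have supA : has_sup A.
  by split; [exists 0|exists 1; move=> t [] /andP[]].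
pose m := sup A.
have m01 : 0 <= m <= 1.
  apply/andP; split; first exact: sup_upper_bound.
  by apply: ge_sup; [exists 0|move=> t [/andP[]]].
have below s : 0 <= s < m -> S (g s).
  move=> /andP[s0 sm]; have ms : 0 < m - s by rewrite subr_gt0.
  have [t [_ At] ts] := sup_adherent ms supA.
  by apply: At; rewrite s0 ltW//; move: ts; rewrite -/m; lra.
have Sm : S (g m).
  apply: contrapT => nS; have [d d0 Hd] := gc m _ ((H m m01).2 nS).
  have [t [/andP[t0 t1] At] ts] := sup_adherent d0 supA.
  have tm : t <= m by apply: sup_upper_bound => //; split=> //; apply/andP.
  apply: (Hd t); last by apply: At; rewrite t0 lexx.
  by rewrite distrC ger0_norm ?subr_ge0//; rewrite -/m in ts; lra.
have [d d0 Hd] := gc m _ ((H m m01).1 Sm).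
have [m1|m1] := leP 1 m.
  have -> : z2 = g m; last exact: Sm.
  have -> : m = 1 by apply/eqP; rewrite eq_le m1 andbT; case/andP: m01.
  by rewrite /g mul1r addrC subrK.
pose t := Num.min 1 (m + d / 2).
have mt : m < t by rewrite lt_min m1 ltrDl divr_gt0.
have : A t.
  split; first by rewrite ge_min lexx/= andbT; apply: le_trans (ltW mt); case/andP: m01.
  move=> s /andP[s0 st]; have [sm|sm] := ltP s m; first by apply: below; rewrite s0.
  apply: Hd; rewrite ger0_norm ?subr_ge0//.
  by move: st; rewrite /t le_min => /andP[_]; lra.
by move=> /(sup_upper_bound supA); rewrite -/m leNgt mt.
Qed.

End holomorphic_algebra.

Section meromorphic.
Variable R : realType.
Local Notation C := R[i].
Implicit Types (f g : C -> option C) (z w x : C).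

(** The dummy value [0] at poles makes it possible to speak of derivatives. *)
Definition finval f w : C := odflt 0 (f w).

Definition reg f z := holo (finval f) z /\ nbh z (fun w => f w = Some (finval f w)).

Definition pole f z m h := [/\ (0 < m)%N, f z = None, holo h z, h z != 0 &
  nbh z (fun w => w != z -> f w = Some (h w / (w - z) ^+ m))].

Lemma meromorphicP f z : meromorphic f -> reg f z \/ exists m h, pole f z m h.
Proof.
move=> /(_ z)[[h /holomorphic_at_holo hh /nbhE fh]|[fz [m [h [m0 /holomorphic_at_holo hh hz /nbhE fh]]]]]; [left|right].
  split; last by apply: nbhS fh => w; rewrite /finval => ->.
  by apply: eq_holo hh; apply: nbhS fh => w; rewrite /finval => ->.
by exists m, h.
Qed.

Lemma pole_near_reg f z m h : pole f z m h -> nbh z (fun w => w != z -> reg f w).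
Proof.
move=> [m0 fz hh hz fh]; apply: nbhS2 (nbh_open hh) (nbh_open fh) => w hw fw wz.
have fw' : nbh w (fun x => f x = Some (h x / (x - z) ^+ m)).
  by apply: nbhS2 fw (nbh_neq wz) => x; exact.
split; last by apply: nbhS fw' => x; rewrite /finval => ->.
apply: (@eq_holo _ (fun x => h x / (x - z) ^+ m)).
  by apply: nbhS fw' => x; rewrite /finval => ->.
apply: holoM => //; apply: holoV; last by rewrite expf_neq0// subr_eq0.
by apply: holoX; apply: holoB; [exact: holo_id|exact: holo_cst].
Qed.

Lemma reg_near f z : reg f z -> nbh z (reg f).
Proof. by move=> [/nbh_open H /nbh_open H']; apply: nbhS2 H H'. Qed.

Lemma meromorphic_near_reg f z : meromorphic f -> nbh z (fun w => w != z -> reg f w).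
Proof.
move=> /(meromorphicP z)[/reg_near|[m [h /pole_near_reg//]]].
by apply: nbhS.
Qed.

Lemma reg_val f z : reg f z -> f z = Some (finval f z).
Proof. by move=> [_ /nbh_center]. Qed.

Lemma meromorphic_punctured f z : meromorphic f ->
  exists m h, [/\ holo h z, nbh z (fun w => w != z -> f w = Some (h w / (w - z) ^+ m)),
    m = 0%N -> f z = Some (h z) & (0 < m)%N -> f z = None /\ h z != 0].
Proof.
move=> /(meromorphicP z)[rf|[m [h [m0 fz hh hz fh]]]].
  have [hf ff] := rf; exists 0%N, (finval f); split=> //.
    by apply: nbhS ff => w -> _; rewrite expr0 divr1.
  by rewrite reg_val.
by exists m, h; split=> // m0'; rewrite m0' in m0.
Qed.

(** The numerator [h (w-z)^n - k (w-z)^m] of the difference is holomorphic, so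
    that it vanishes identically near [z] or nowhere else than at [z]. *)
Lemma meromorphic_dichotomy f g z : meromorphic f -> meromorphic g ->
  nbh z (fun w => f w = g w) \/ nbh z (fun w => w != z -> f w <> g w).
Proof.
move=> /(meromorphic_punctured z)[m [h [hh fh f0 fp]]].
move=> /(meromorphic_punctured z)[n [k [hk gk g0 gp]]].
pose N w := h w * (w - z) ^+ n - k w * (w - z) ^+ m.
have hX j : holo (fun w => (w - z) ^+ j) z.
  by apply: holoX; apply: holoB; [exact: holo_id|exact: holo_cst].
have hN : holo N z by apply: holoB; apply: holoM.
have [N0|[l [K [hK K0 NK]]]] := holo_factor hN; [left|right]; last first.
  apply: nbhS2 (nbhI fh gk) (nbhI NK (ccont_nbh_neq0 (holo_ccont hK) K0)).
  move=> w [fw gw] [Nw Kw] wz; rewrite fw// gw// => -[] /eqP.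
  rewrite eqr_div ?expf_neq0 ?subr_eq0// -subr_eq0 -/(N w) Nw.
  by rewrite mulf_eq0 (negPf Kw) orbF expf_eq0 subr_eq0 (negPf wz) andbF.
have N0z := nbh_center N0.
have fgp : nbh z (fun w => w != z -> f w = g w).
  apply: nbhS2 (nbhI fh gk) N0 => w [fw gw] Nw wz; rewrite fw// gw//; congr Some.
  by apply/eqP; rewrite eqr_div ?expf_neq0 ?subr_eq0// -subr_eq0 -/(N w) Nw.
suff fgz : f z = g z.
  by apply: nbhS fgp => w; have [->|_] := eqVneq w z; [|exact].
case: m n @N hN N0z fh f0 fp gk g0 gp N0 => [|m] [|n] N hN N0z fh f0 fp gk g0 gp N0.
- by rewrite f0// g0//; congr Some; move: N0z; rewrite /N !expr0 !mulr1 => /subr0_eq.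
- exfalso; have [_ /eqP] := gp isT; apply; move: N0z.
  by rewrite /N subrr expr0n mulr0 expr0 mulr1 sub0r => /eqP; rewrite oppr_eq0 => /eqP.
- exfalso; have [_ /eqP] := fp isT; apply; move: N0z.
  by rewrite /N subrr expr0 mulr1 exprS mul0r mulr0 subr0.
- by rewrite (fp isT).1 (gp isT).1.
Qed.

Lemma meromorphic_identity f g z0 : meromorphic f -> meromorphic g ->
  nbh z0 (fun w => f w = g w) -> forall z, f z = g z.
Proof.
move=> mf mg fg z; suff : nbh z (fun w => f w = g w) by move/nbh_center.
apply: (@segment_clopen _ (fun z => nbh z (fun w => f w = g w)) z0 z) => // t _ w.
split=> [/nbh_open//|nfg].
have [//|H] := meromorphic_dichotomy w mf mg.
apply: nbhS H => x H fgx; have [xw|xw] := eqVneq x w; first by apply: nfg; rewrite -xw.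
by apply: H => //; exact: nbh_center fgx.
Qed.

Lemma meromorphic_cst c : meromorphic (fun=> Some c : option C).
Proof.
move=> z; left; exists (fun=> c); last by apply/nbhE/nbhT.
by apply/nbhE/nbhT => w; exact: (@derivable_cst R[i] R[i]^o R[i]^o).
Qed.

Lemma meromorphic_neq f g z : meromorphic f -> meromorphic g ->
  ~ (forall w, f w = g w) -> nbh z (fun w => w != z -> f w <> g w).
Proof.
move=> mf mg nfg; by have [/(meromorphic_identity mf mg)|] := meromorphic_dichotomy z mf mg.
Qed.

Lemma meromorphic_neq_cst f c z : meromorphic f -> ~ constant_fun f ->
  nbh z (fun w => w != z -> f w <> Some c).
Proof.
move=> mf nf; apply: meromorphic_neq => //; first exact: meromorphic_cst.
by move=> H; apply: nf; exists c.
Qed.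

End meromorphic.

(** * Two holomorphic forms on the curve P(x) = P(y) *)

Section curve.
Variable R : realType.
Local Notation C := R[i].
Variables (P Q : {poly C}) (d : 'I_3 -> C).
Hypothesis hP' : P^`() = \prod_(j < 3) ('X - (d j)%:P) * Q.
Hypothesis dinj : injective d.
Hypothesis Qd : forall j, Q.[d j] != 0.
Hypothesis only_crit : forall j x, P.[x] = P.[d j] -> P^`().[x] = 0 -> x = d j.
Implicit Types (f g : C -> option C) (w x y z : C) (i j : 'I_3).

Definition dprod z : C := \prod_(j < 3) (z - d j).

Lemma dprod_eq0 z : (dprod z == 0) = [exists j, z == d j].
Proof.
apply/idP/existsP => [|[j /eqP ->]].
  by rewrite prodf_seq_eq0 => /hasP[j _ /=]; rewrite subr_eq0; exists j.
by rewrite /dprod (bigD1 j)//= subrr mul0r.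
Qed.

Lemma dprod_neq0 z : (forall j, z != d j) -> dprod z != 0.
Proof.
by move=> H; rewrite dprod_eq0 negb_exists; apply/forallP => j; exact: H.
Qed.

Lemma deriv_dprod z : P^`().[z] = dprod z * Q.[z].
Proof.
by rewrite hP' hornerM horner_prod; congr (_ * _); apply: eq_bigr => j _; rewrite !hornerE.
Qed.

(** [d i] is exactly a double zero of [P - P(d i)], because the derivative has
    a simple zero there. *)
Lemma double_point i : exists2 S : {poly C}, S.[d i] != 0 &
  forall z, P.[z] = P.[d i] + (z - d i) ^+ 2 * S.[z].
Proof.
have : root (P - P.[d i]%:P) (d i) by rewrite /root !hornerE subrr.
move=> /factor_theorem[A PA].
have P'A : P^`() = A + A^`() * ('X - (d i)%:P).
  have -> : P = A * ('X - (d i)%:P) + P.[d i]%:P by rewrite -PA subrK.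
  by rewrite derivD derivM derivXsubC derivC addr0 mulr1 addrC.
have /factor_theorem[S AS] : root A (d i).
  have := congr1 (fun p => p.[d i]) P'A.
  rewrite deriv_dprod /dprod (bigD1 i)//= subrr !mul0r.
  by rewrite !hornerE subrr mulr0 addr0 => /esym/eqP.
exists S; last first.
  move=> z; have := congr1 (fun p => p.[z]) PA; rewrite AS !hornerE => /eqP.
  by rewrite subr_eq => /eqP ->; rewrite expr2; ring.
have nz : 'X - (d i)%:P != 0 by rewrite polyXsubC_eq0.
have eqS : \prod_(j < 3 | j != i) ('X - (d j)%:P) * Q = S *+ 2 + S^`() * ('X - (d i)%:P).
  apply: (mulIf nz); transitivity P^`().
    by rewrite hP' [in RHS](bigD1 i)//=; ring.
  by rewrite P'A AS derivM derivXsubC; ring.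
have := congr1 (fun p => p.[d i]) eqS.
rewrite !hornerE subrr mulr0 addr0 horner_prod => H.
apply/negP => /eqP S0; move/eqP: H; rewrite S0 ?addr0 ?mul0rn mulf_eq0 (negPf (Qd i)) orbF.
rewrite prodf_seq_eq0 => /hasP[j _ /andP[ji]]; rewrite !hornerE subr_eq0 => /eqP/dinj ij.
by rewrite ij eqxx in ji.
Qed.

(** The reciprocal polynomial [x^n P(1/x)], which describes [P] at infinity. *)
Definition revP : {poly C} := \poly_(i < size P) P`_((size P).-1 - i).

Lemma revP_horner x : x != 0 -> revP.[x] = x ^+ (size P).-1 * P.[x^-1].
Proof.
move=> x0; rewrite /revP horner_poly horner_coef mulr_sumr.
rewrite (reindex_inj rev_ord_inj) /=; apply: eq_bigr => j _.
have jn : (j <= (size P).-1)%N by rewrite -ltnS (ltn_predK (ltn_ord j)) ltn_ord.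
have e : (size P - j.+1 = (size P).-1 - j)%N by rewrite -[in RHS]subn1 -subnDA add1n.
rewrite e subKn// mulrCA exprVn; congr (_ * _).
by rewrite -expfB_cond// (negPf x0) ?add0n.
Qed.

Lemma revP0 : revP.[0] = lead_coef P.
Proof.
rewrite horner_coef0 coef_poly; case: ltnP => [_|]; first by rewrite subn0.
by rewrite leqn0 size_poly_eq0 => /eqP ->; rewrite lead_coef0.
Qed.

(** A pair of functions contradicting uniqueness; the rest of the proof shows
    that there is none. *)
Definition refuting_pair f g := [/\ meromorphic f, meromorphic g,
  ~ constant_fun f /\ ~ constant_fun g,
  (forall z, poly_comp P f z = poly_comp P g z) & ~ (forall z, f z = g z)].

Lemma refuting_sym f g : refuting_pair f g -> refuting_pair g f.
Proof.
move=> [mf mg [cf cg] e n]; split=> //.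
by move=> H; apply: n => z; rewrite H.
Qed.

Lemma refuting_reg f g z : refuting_pair f g -> reg f z -> reg g z.
Proof.
move=> [_ mg _ e _] rf; have [//|[m [h [_ gz _ _ _]]]] := meromorphicP z mg.
by have := e z; rewrite /poly_comp (reg_val rf) gz.
Qed.

Lemma refuting_val f g z : refuting_pair f g -> reg f z ->
  nbh z (fun w => P.[finval f w] = P.[finval g w]).
Proof.
move=> fg rf; have rg := refuting_reg fg rf; have [_ _ _ e _] := fg.
apply: nbhS2 (rf.2) (rg.2) => w fw gw.
by have := e w; rewrite /poly_comp fw gw /= => -[].
Qed.

Lemma refuting_cderiv f g z : refuting_pair f g -> reg f z ->
  P^`().[finval f z] * cderiv (finval f) z = P^`().[finval g z] * cderiv (finval g) z.
Proof.
move=> fg rf; have rg := refuting_reg fg rf.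
have df := cderivP (nbh_center rf.1); have dg := cderivP (nbh_center rg.1).
apply: (cder_unique (cder_horner P df)).
apply: eq_cder (cder_horner P dg).
by apply: nbhS (refuting_val fg rf) => w.
Qed.

Definition generic f g w := [/\ reg f w, reg g w,
  forall j, finval f w != d j, forall j, finval g w != d j & finval f w != finval g w].

Lemma nbh_all (I : finType) z (S : I -> C -> Prop) :
  (forall a, nbh z (S a)) -> nbh z (fun w => forall a, S a w).
Proof.
move=> H; have : nbh z (fun w => forall a, a \in enum I -> S a w).
  elim: (enum I) => [|a s IH]; first exact: nbhT.
  by apply: nbhS2 (H a) IH => w Sa Ss b; rewrite inE => /predU1P[->|/Ss].
by apply: nbhS => w H' a; apply: H'; rewrite mem_enum.
Qed.

Lemma generic_near f g z : refuting_pair f g -> nbh z (fun w => w != z -> generic f g w).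
Proof.
move=> [mf mg [cf cg] e n].
have nf j : nbh z (fun w => w != z -> f w <> Some (d j)) by exact: meromorphic_neq_cst.
have ng j : nbh z (fun w => w != z -> g w <> Some (d j)) by exact: meromorphic_neq_cst.
apply: nbhS2 (nbhI (meromorphic_near_reg z mf) (meromorphic_near_reg z mg))
  (nbhI (nbhI (nbh_all nf) (nbh_all ng)) (meromorphic_neq z mf mg n)).
move=> w [rf rg] [[fd gd] fg] wz; have {}rf := rf wz; have {}rg := rg wz.
split=> // [j|j|].
- by apply/eqP => H; apply: (fd j wz); rewrite (reg_val rf) H.
- by apply/eqP => H; apply: (gd j wz); rewrite (reg_val rg) H.
- by apply/eqP => H; apply: (fg wz); rewrite (reg_val rf) (reg_val rg) H.
Qed.

(** The coefficient of the pullback along [(f, g)] of the differential form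
    [(x - y) dx / prod_j (y - d j)] of the curve [P(x) = P(y)]. *)
Definition curve_form f g w : C := (finval f w - finval g w) * cderiv (finval f) w / dprod (finval g w).

Lemma dprodD1 i z : dprod z = (z - d i) * \prod_(j < 3 | j != i) (z - d j).
Proof. by rewrite /dprod (bigD1 i). Qed.

(** Where [g] avoids the [d j] the definition itself is holomorphic. *)
Lemma form_reg f g z : refuting_pair f g -> reg f z -> (forall j, finval g z != d j) ->
  exists2 U, holo U z & nbh z (fun w => w != z -> curve_form f g w = U w).
Proof.
move=> fg rf gd; have rg := refuting_reg fg rf.
exists (curve_form f g); last exact: nbhT.
apply: holoM; first by apply: holoM; [exact: holoB rf.1 rg.1|exact: holo_cderiv rf.1].
apply: holoV; last exact: dprod_neq0.
by apply: holo_prod => j _; apply: holoB; [exact: rg.1|exact: holo_cst].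
Qed.

(** [P'(x) dx = P'(y) dy] gives a second expression, whose denominator
    [P'(x)] does not vanish at the simple preimages of [P(d i)]. *)
Lemma form_swap f g w : refuting_pair f g -> generic f g w ->
  P^`().[finval f w] != 0 ->
  curve_form f g w = (finval f w - finval g w) * cderiv (finval g) w * Q.[finval g w] / P^`().[finval f w].
Proof.
move=> fg [rf rg fd gd _] Pf; have := refuting_cderiv fg rf.
rewrite [P^`().[finval g w]]deriv_dprod => H.
have gn := dprod_neq0 gd; rewrite /curve_form.
apply/eqP; rewrite eqr_div//; apply/eqP; rewrite -!mulrA; congr (_ * _).
by rewrite [LHS]mulrC H; ring.
Qed.

Lemma form_ramified f g z i : refuting_pair f g -> reg f z -> finval g z = d i -> finval f z != d i ->
  exists2 U, holo U z & nbh z (fun w => w != z -> curve_form f g w = U w).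
Proof.
move=> fg rf gd fd; have rg := refuting_reg fg rf.
(* a critical point with the critical value of [d i] would be [d i] *)
have Pf : P^`().[finval f z] != 0.
  apply: contra fd => /eqP H; apply/eqP/only_crit => //.
  by rewrite (nbh_center (refuting_val fg rf)) gd.
have hPf : holo (fun w => P^`().[finval f w]) z by exact: holo_horner rf.1.
exists (fun w => (finval f w - finval g w) * cderiv (finval g) w * Q.[finval g w] / P^`().[finval f w]).
  apply: holoM; last exact: holoV.
  apply: holoM; last exact: holo_horner rg.1.
  by apply: holoM; [exact: holoB rf.1 rg.1|exact: holo_cderiv rg.1].
apply: nbhS2 (generic_near z fg) (ccont_nbh_neq0 (holo_ccont hPf) Pf) => w gw Pw wz.
by rewrite form_swap//; exact: gw.
Qed.

Lemma reg_order f z c : meromorphic f -> ~ constant_fun f -> reg f z ->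
  exists m k, [/\ holo k z, k z != 0 & nbh z (fun w => finval f w - c = (w - z) ^+ m * k w)].
Proof.
move=> mf cf rf; have hf : holo (fun w => finval f w - c) z.
  by apply: holoB; [exact: rf.1|exact: holo_cst].
have [H|//] := holo_factor hf; exfalso.
(* [f = c] near [z] would propagate to the whole plane *)
have [w _ fw] : exists2 w, w != z & finval f w - c = 0 /\ f w = Some (finval f w) /\ f w <> Some c.
  by apply: nbh_punctured_ex; apply: nbhS2 H (nbhI rf.2 (meromorphic_neq_cst c z mf cf)) => w H [? H'] /H'.
by move: fw => [/subr0_eq -> [-> ]].
Qed.

(** From [(f - d i)^2 S(f) = (g - d i)^2 S(g)] both functions take the value
    [d i] to the same order, which cancels between [f - g] and [g - d i]. *)
Lemma form_diagonal f g z i : refuting_pair f g -> reg f z -> finval g z = d i -> finval f z = d i ->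
  exists2 U, holo U z & nbh z (fun w => w != z -> curve_form f g w = U w).
Proof.
move=> fg rf gd fd; have rg := refuting_reg fg rf.
have [mf mg [cf cg] _ _] := fg.
have [m [k [hk k0 fk]]] := reg_order (d i) mf cf rf.
have [n [l [hl l0 gl]]] := reg_order (d i) mg cg rg.
have [S S0 PS] := double_point i.
have mn : m = n.
  have hS h : holo h z -> h z = d i -> forall a : C -> C, holo a z -> a z != 0 ->
      ccont (fun w => a w ^+ 2 * S.[h w]) z /\ a z ^+ 2 * S.[h z] != 0.
    move=> hh hz a ha az; split; last by rewrite mulf_neq0 ?expf_neq0// hz.
    by apply: holo_ccont; apply: holoM; [exact: holoX|exact: holo_horner].
  have [c1 n1] := hS _ rf.1 fd k hk k0.
  have [c2 n2] := hS _ rg.1 gd l hl l0.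
  have := @order_unique _ _ _ (m * 2) (n * 2) z c1 c2 n1 n2.
  move=> H; apply/eqP; rewrite -(@eqn_pmul2r 2)//; apply/eqP/H.
  apply: nbhS2 (refuting_val fg rf) (nbhI fk gl) => w Pw [fw gw] _.
  move: Pw; rewrite (PS (finval f w)) (PS (finval g w)) fw gw => /addrI.
  by rewrite !exprMn -!exprM !mulrA.
have rest : \prod_(j < 3 | j != i) (finval g z - d j) != 0.
  apply/prodf_neq0 => j ji; rewrite gd subr_eq0; apply: contra ji => /eqP/dinj ->//.
have hrest : holo (fun w => \prod_(j < 3 | j != i) (finval g w - d j)) z.
  by apply: holo_prod => j _; apply: holoB; [exact: rg.1|exact: holo_cst].
exists (fun w => (k w - l w) * (l w)^-1 * cderiv (finval f) w * (\prod_(j < 3 | j != i) (finval g w - d j))^-1).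
  apply: holoM; last exact: holoV.
  apply: holoM; last exact: holo_cderiv rf.1.
  by apply: holoM; [exact: holoB|exact: holoV].
apply: nbhS2 (nbhI fk gl) (nbhI (ccont_nbh_neq0 (holo_ccont hl) l0) (ccont_nbh_neq0 (holo_ccont hrest) rest)).
move=> w [fw gw] [lw rw] wz; rewrite /curve_form (dprodD1 i) gw -mn.
have -> : finval f w - finval g w = (w - z) ^+ m * (k w - l w).
  by rewrite mulrBr -fw mn -gw; ring.
have wn : (w - z) ^+ m != 0 by rewrite expf_neq0// subr_eq0.
move: (\prod_(j < 3 | _) _) rw => r rw.
by field; rewrite wn lw rw.
Qed.

(** The equation [P(f) = P(g)], rewritten for [1/f] and [1/g] by means of the
    reciprocal polynomial, compares the orders. *)
Lemma pole_order f g z m n h k : refuting_pair f g -> (1 < size P)%N ->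
  pole f z m h -> pole g z n k -> m = n.
Proof.
move=> fg sP [m0 fz hh h0 fh] [n0 gz hk k0 gk]; set N := (size P).-1.
have N0 : (0 < N)%N by rewrite /N -subn1 subn_gt0.
have [_ _ _ e _] := fg.
have hX (j : nat) : holo (fun w => (w - z) ^+ j) z.
  by apply: holoX; apply: holoB; [exact: holo_id|exact: holo_cst].
have side (a b : C -> C) (j : nat) : (0 < j)%N -> holo a z -> a z != 0 -> holo b z -> b z != 0 ->
    ccont (fun w => revP.[(w - z) ^+ j * (a w)^-1] * (b w ^+ N)^-1) z /\
    revP.[(z - z) ^+ j * (a z)^-1] * (b z ^+ N)^-1 != 0.
  move=> j0 ha a0 hb b0; split.
    apply: holo_ccont; apply: holoM; last by apply: holoV; [exact: holoX|rewrite expf_neq0].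
    by apply: holo_horner; apply: holoM => //; exact: holoV.
  rewrite subrr expr0n (gtn_eqF j0) mul0r revP0 mulf_neq0 ?invr_eq0 ?expf_neq0//.
  by rewrite lead_coef_eq0 -size_poly_eq0 -lt0n ltnW.
have [c1 n1] := side h k m m0 hh h0 hk k0.
have [c2 n2] := side k h n n0 hk k0 hh h0.
have : (n * N = m * N)%N.
  apply: (order_unique c1 c2 n1 n2).
  apply: nbhS2 (nbhI fh gk) (nbhI (ccont_nbh_neq0 (holo_ccont hh) h0) (ccont_nbh_neq0 (holo_ccont hk) k0)).
  move=> w [fw gw] [hw kw] wz; have wn : w - z != 0 by rewrite subr_eq0.
  have := e w; rewrite /poly_comp fw// gw//= => -[Pe].
  rewrite !revP_horner ?mulf_neq0 ?expf_neq0 ?invr_eq0// !invfM !invrK.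
  rewrite ![(_ ^- _) * _]mulrC Pe -/N !exprMn !exprVn -!exprM.
  have hn : h w ^+ N != 0 by rewrite expf_neq0.
  have kn : k w ^+ N != 0 by rewrite expf_neq0.
  by field; rewrite hn kn.
by move/eqP; rewrite eqn_pmul2r// => /eqP.
Qed.

(** With poles of order [m] the numerator has a pole of order at most
    [m + (m + 1)] and the denominator one of order [3 m], which is larger or
    equal as [m >= 1]. *)
Lemma form_pole f g z m h n k : refuting_pair f g -> (1 < size P)%N -> pole f z m h -> pole g z n k ->
  exists2 U, holo U z & nbh z (fun w => w != z -> curve_form f g w = U w).
Proof.
move=> fg sP pf pg; have mn := pole_order fg sP pf pg; subst n.
have [m0 fz hh h0 fh] := pf; have [_ gz hk k0 gk] := pg.
case: m m0 fh gk {pf pg} => // m _ fh gk.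
have hX (j : nat) : holo (fun w => (w - z) ^+ j) z.
  by apply: holoX; apply: holoB; [exact: holo_id|exact: holo_cst].
have hden : holo (fun w => \prod_(j < 3) (k w - d j * (w - z) ^+ m.+1)) z.
  apply: holo_prod => j _; apply: holoB => //; apply: holoM => //; exact: holo_cst.
have den0 : \prod_(j < 3) (k z - d j * (z - z) ^+ m.+1) != 0.
  by apply/prodf_neq0 => j _; rewrite subrr expr0n mulr0 subr0.
exists (fun w => (h w - k w) * (cderiv h w * (w - z) - m.+1%:R * h w) * (w - z) ^+ m
    * (\prod_(j < 3) (k w - d j * (w - z) ^+ m.+1))^-1).
  apply: holoM; last exact: holoV.
  apply: holoM; last exact: hX.
  apply: holoM; first exact: holoB.
  apply: holoB; apply: holoM => //; [exact: holo_cderiv| |exact: holo_cst].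
  by apply: holoB; [exact: holo_id|exact: holo_cst].
apply: nbhS2 (nbhI (nbh_open fh) (nbhI fh gk)) (nbhI hh (ccont_nbh_neq0 (holo_ccont hden) den0)).
move=> w [fw' [fw gw]] [hw dw] wz.
have wn : w - z != 0 by rewrite subr_eq0.
have fvE : finval f w = h w / (w - z) ^+ m.+1 by rewrite /finval fw.
have gvE : finval g w = k w / (w - z) ^+ m.+1 by rewrite /finval gw.
have DfE : cderiv (finval f) w = (cderiv h w * (w - z) - m.+1%:R * h w) / (w - z) ^+ m.+2.
  rewrite (@eq_cderiv _ _ (fun x => h x * ((x - z) ^+ m.+1)^-1)); last first.
    by apply: nbhS2 fw' (nbh_neq wz) => x fx xz; rewrite /finval fx.
  have ds := cderX m.+1 (cderB (cder_id w) (cder_cst z w)).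
  have wn1 : (w - z) ^+ m.+1 != 0 by rewrite expf_neq0.
  rewrite (cderivE (cderM (cderivP hw) (@cderV _ (fun x => (x - z) ^+ m.+1) w _ wn1 ds))) /= subr0 mulr1 !exprS.
  have wm : (w - z) ^+ m != 0 by rewrite expf_neq0.
  by field; rewrite wn wm.
rewrite /curve_form fvE gvE DfE /dprod.
have -> : \prod_(j < 3) (k w / (w - z) ^+ m.+1 - d j) =
    \prod_(j < 3) (k w - d j * (w - z) ^+ m.+1) / ((w - z) ^+ m.+1) ^+ 3.
  have -> : ((w - z) ^+ m.+1) ^+ 3 = \prod_(j < 3) (w - z) ^+ m.+1 by rewrite prodr_const card_ord.
  rewrite -prodf_div; apply: eq_bigr => j _; field.
  by rewrite expf_neq0.
move: (\prod_(j < 3) _) dw => r dw; rewrite !exprS.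
have wm : (w - z) ^+ m != 0 by rewrite expf_neq0.
by field; rewrite wn wm dw.
Qed.

Lemma form_extends f g z : refuting_pair f g -> (1 < size P)%N ->
  exists2 U, holo U z & nbh z (fun w => w != z -> curve_form f g w = U w).
Proof.
move=> fg sP; have [mf mg _ e _] := fg.
have [rf|[m [h pf]]] := meromorphicP z mf; last first.
  have [rg|[n [k pg]]] := meromorphicP z mg; last exact: (form_pole fg sP pf pg).
  have := reg_val (refuting_reg (refuting_sym fg) rg).
  by have [_ -> _ _ _] := pf.
have [gd|] := pselect (forall j, finval g z != d j); first exact: form_reg.
move=> /existsNP[i /negP]; rewrite negbK => /eqP gd.
have [fd|fd] := eqVneq (finval f z) (d i); first exact: (form_diagonal fg rf gd fd).
exact: (form_ramified fg rf gd fd).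
Qed.

(** The local extensions agree on punctured neighbourhoods, hence by continuity
    wherever two of them are defined. *)
Lemma entire_form f g : refuting_pair f g -> (1 < size P)%N ->
  exists u : C -> C, (forall z, holo u z) /\
    forall z, nbh z (fun w => w != z -> u w = curve_form f g w).
Proof.
move=> fg sP.
have /choice[U HU] : forall z, exists U : C -> C,
    holo U z /\ nbh z (fun w => w != z -> curve_form f g w = U w).
  by move=> z; have [U ? ?] := form_extends z fg sP; exists U.
have uU z : nbh z (fun w => w != z -> U w w = U z w).
  have [hz Uz] := HU z; apply: nbhS2 (nbh_open hz) (nbh_open Uz) => w hw Uzw wz.
  have [hw' Uw] := HU w; apply: ccont_eq; [exact: holo_ccont|exact: holo_ccont|].
  apply: nbhS2 Uw (nbhI Uzw (nbh_neq wz)) => x Ux [Uzx xz] xw.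
  by rewrite -Ux// Uzx.
exists (fun z => U z z); split=> z.
  apply: eq_holo (HU z).1; apply: nbhS (uU z) => w H.
  by have [->//|/H ->] := eqVneq w z.
by apply: nbhS2 (uU z) (HU z).2 => w H H' wz; rewrite H// H'.
Qed.

Lemma form_relation f g w : refuting_pair f g -> generic f g w ->
  curve_form f g w * Q.[finval f w] + curve_form g f w * Q.[finval g w] = 0.
Proof.
move=> fg [rf rg fd gd _]; have := refuting_cderiv fg rf; rewrite !deriv_dprod => H.
rewrite /curve_form; have fn := dprod_neq0 fd; have gn := dprod_neq0 gd.
rewrite (_ : _ + _ = (finval f w - finval g w) *
  (dprod (finval f w) * Q.[finval f w] * cderiv (finval f) w - dprod (finval g w) * Q.[finval g w] * cderiv (finval g) w)
   / (dprod (finval f w) * dprod (finval g w))); last by field; rewrite fn gn.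
by rewrite H subrr mulr0 mul0r.
Qed.

End curve.

(** * Bounding the forms by spherical metrics *)

Section polynomial_growth.
Variable R : realType.
Local Notation C := R[i].
Implicit Types (p q : {poly C}) (x y z : C) (B M : R).

Lemma poly_split p : p != 0 -> exists2 rs : seq C, size rs = (size p).-1 &
  forall x, p.[x] = lead_coef p * \prod_(r <- rs) (x - r).
Proof.
move=> p0; have [rs ->] := closed_field_poly_normal p; exists rs.
  by rewrite size_scale ?lead_coef_eq0// size_prod_XsubC.
move=> x; rewrite hornerZ lead_coefZ lead_coef_prod_XsubC mulr1 horner_prod.
by congr (_ * _); apply: eq_bigr => r _; rewrite !hornerE.
Qed.

Lemma poly_bounded p B : exists2 M, 0 < M & forall x, cabs x <= B -> cabs p.[x] <= M.
Proof.
elim/poly_ind: p => [|p c [M M0 IH]].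
  by exists 1 => // x _; rewrite horner0 cabs0.
exists (M * `|B| + cabs c + 1).
  by rewrite ltr_wpDl// addr_ge0 ?cabs_ge0// mulr_ge0// ltW.
move=> x xB; rewrite !hornerE (le_trans (cabsD _ _))// cabsM.
have : cabs p.[x] * cabs x <= M * `|B|.
  by rewrite ler_pM ?cabs_ge0 ?IH// (le_trans xB)// ler_norm.
lra.
Qed.

Lemma prod_upper (rs : seq C) : exists2 M, 0 < M & forall x,
  cabs (\prod_(r <- rs) (x - r)) <= M * (1 + cabs x) ^+ size rs.
Proof.
elim: rs => [|r rs [M M0 IH]].
  by exists 1 => // x; rewrite big_nil cabs1 expr0 mulr1.
exists (M * (1 + cabs r)); first by rewrite mulr_gt0// ltr_wpDr// cabs_ge0.
move=> x; rewrite big_cons cabsM /= exprS.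
rewrite [leRHS](_ : _ = ((1 + cabs r) * (1 + cabs x)) * (M * (1 + cabs x) ^+ size rs)); last by ring.
rewrite ler_pM ?cabs_ge0// (le_trans (cabsB _ _))//.
by have := cabs_ge0 r; have := cabs_ge0 x; nra.
Qed.

(** Each factor is at least [|x| / 2] as soon as [|x| >= 2 |r|]. *)
Lemma prod_lower (rs : seq C) : exists2 B, 1 <= B & forall x, B <= cabs x ->
  (cabs x / 2) ^+ size rs <= cabs (\prod_(r <- rs) (x - r)).
Proof.
elim: rs => [|r rs [B B1 IH]].
  by exists 1 => // x _; rewrite big_nil cabs1 expr0.
exists (B + 2 * cabs r); first by rewrite (le_trans B1)// lerDl mulr_ge0// cabs_ge0.
move=> x xB; rewrite big_cons cabsM /= exprS.
have r0 := cabs_ge0 r; have x0 := cabs_ge0 x.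
rewrite ler_pM ?exprn_ge0 ?divr_ge0//; last by apply: IH; lra.
by rewrite (le_trans _ (cabs_subl _ _))//; lra.
Qed.

Lemma poly_upper p : exists2 M, 0 < M & forall x,
  cabs p.[x] <= M * (1 + cabs x) ^+ (size p).-1.
Proof.
have [->|p0] := eqVneq p 0.
  by exists 1 => // x; rewrite horner0 cabs0 mulr_ge0// exprn_ge0// addr_ge0// cabs_ge0.
have [rs srs pE] := poly_split p0; have [M M0 HM] := prod_upper rs.
have l0 : 0 < cabs (lead_coef p) by rewrite cabs_gt0 lead_coef_eq0.
exists (cabs (lead_coef p) * M); first by rewrite mulr_gt0.
by move=> x; rewrite pE cabsM -mulrA -srs ler_wpM2l ?cabs_ge0.
Qed.

(** Both sides of [p(x) = p(y)] grow like the same power, so that the two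
    coordinates of a point of the curve go to infinity together. *)
Lemma same_value_growth p : (1 < size p)%N -> exists2 A, 1 <= A &
  forall x y, p.[x] = p.[y] -> cabs x <= A * (1 + cabs y).
Proof.
move=> sp; have p0 : p != 0 by rewrite -size_poly_gt0 ltnW.
set N := (size p).-1; have N0 : (0 < N)%N by rewrite /N -subn1 subn_gt0.
have [M M0 HM] := poly_upper p.
have [rs srs pE] := poly_split p0; have [B B1 HB] := prod_lower rs.
have l0 : 0 < cabs (lead_coef p) by rewrite cabs_gt0 lead_coef_eq0.
set l := cabs (lead_coef p) in l0.
pose A := 1 + M / l.
have A1 : 1 <= A by rewrite /A lerDl divr_ge0// ltW.
exists (B + 2 * A); first by lra.
move=> x y xy; have y0 := cabs_ge0 y.
have [xB|xB] := leP (cabs x) B.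
  apply: (le_trans xB); rewrite -[leLHS]mulr1 ler_pM//; lra.
have h1 : l * (cabs x / 2) ^+ N <= M * (1 + cabs y) ^+ N.
  apply: le_trans (HM y); rewrite -xy pE cabsM -/l ler_wpM2l ?(ltW l0)// /N -srs HB//.
  exact: ltW.
have h2 : cabs x / 2 <= A * (1 + cabs y).
  rewrite -(@ler_pXn2r _ N)// ?nnegrE ?divr_ge0 ?cabs_ge0 ?mulr_ge0//; try lra.
  rewrite [leRHS]exprMn (@le_trans _ _ (M / l * (1 + cabs y) ^+ N))//.
    by rewrite mulrAC ler_pdivlMr// [leLHS]mulrC.
  rewrite ler_wpM2r ?exprn_ge0//; first by lra.
  rewrite (@le_trans _ _ A)//; first by rewrite /A; lra.
  by rewrite -[leLHS]expr1 ler_weXn2l.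
nra.
Qed.

End polynomial_growth.

Section form_bound.
Variable R : realType.
Local Notation C := R[i].
Variables (P Q : {poly C}) (d : 'I_3 -> C).
Hypothesis hP' : P^`() = \prod_(j < 3) ('X - (d j)%:P) * Q.
Hypothesis dinj : injective d.
Hypothesis Qd : forall j, Q.[d j] != 0.
Hypothesis only_crit : forall j x, P.[x] = P.[d j] -> P^`().[x] = 0 -> x = d j.
Hypothesis sP : (1 < size P)%N.
Implicit Types (x y z : C) (i j : 'I_3).

Lemma fin_choice_bound (I : finType) (S : I -> R -> Prop) :
  (forall a M M', M <= M' -> S a M -> S a M') ->
  (forall a, exists M, S a M) -> exists2 M, 0 < M & forall a, S a M.
Proof.
move=> mono /choice[F HF]; exists (1 + \sum_a `|F a|).
  by rewrite ltr_wpDr// sumr_ge0.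
move=> a; apply: mono (HF a); rewrite (bigD1 a)//=.
have : 0 <= \sum_(i | i != a) `|F i| by rewrite sumr_ge0.
by have := ler_norm (F a); lra.
Qed.

Lemma separated : exists2 e : R, 0 < e & forall i j, i != j -> 2 * e <= cabs (d i - d j).
Proof.
have [||M M0 HM] := @fin_choice_bound ('I_3 * 'I_3)%type
  (fun a M => a.1 != a.2 -> 1 <= M * cabs (d a.1 - d a.2)).
- move=> a M M' MM' H a12; apply: le_trans (H a12) _.
  by rewrite ler_wpM2r ?cabs_ge0.
- move=> a; exists (cabs (d a.1 - d a.2))^-1 => a12; rewrite mulVf//.
  by rewrite cabs_eq0 subr_eq0; apply: contra a12 => /eqP/dinj ->.
exists (2 * M)^-1; first by rewrite invr_gt0 mulr_gt0.
move=> i j ij; have := HM (i, j) ij => /= H.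
rewrite invfM mulrA mulfV ?mul1r ?pnatr_eq0//.
by rewrite -[M^-1]mul1r ler_pdivrMr// mulrC.
Qed.

(** The length of the tangent vector [x'] at [x] in the spherical metric of the
    Riemann sphere, up to a factor [2]. *)
Definition spherical x x' : R := cabs x' / (1 + cabs x ^+ 2).

Lemma spherical_le x x' B : cabs x <= B -> cabs x' <= (1 + B ^+ 2) * spherical x x'.
Proof.
move=> xB; have x0 := cabs_ge0 x; have p0 : 0 < 1 + cabs x ^+ 2 by rewrite ltr_wpDr// sqr_ge0.
rewrite /spherical mulrCA ler_peMr ?cabs_ge0// ler_pdivlMr// mul1r lerD2l.
by rewrite lerXn2r// nnegrE// (le_trans x0).
Qed.

Lemma spherical_ge0 x x' : 0 <= spherical x x'.
Proof. by rewrite divr_ge0 ?cabs_ge0// addr_ge0// sqr_ge0. Qed.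

(** Pairs [(x', y')] tangent to the curve at a point [(x, y)] at which the
    forms are given by their formulas. *)
Definition tangent x y x' y' := [/\ P.[x] = P.[y], forall j, x != d j,
  forall j, y != d j & P^`().[x] * x' = P^`().[y] * y'].

(** Near the points where [y = d i], the form is bounded either because
    [x - y] is small as well, or by its second expression. *)
Lemma form_bound_near i B e : 0 < e -> 
  (forall j, i != j -> 2 * e <= cabs (d i - d j)) ->
  exists2 K, 0 < K & forall x y x' y', tangent x y x' y' ->
  cabs x <= B -> cabs y <= B -> cabs (y - d i) < e ->
  cabs ((x - y) * x' / dprod d y) <= K * (cabs x' + cabs y').
Proof.
move=> e0 de; have [S S0 PS] := double_point hP' dinj Qd i.
(* [x] cannot be close both to a zero of [S] and to a critical point *)
have cop : coprimep S P^`().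
  apply/Pdiv.ClosedField.coprimepP => r; rewrite !rootE => /eqP Sr.
  apply/negP => /eqP P'r; have rd : r = d i by apply: only_crit => //; rewrite PS Sr mulr0 addr0.
  by move: S0; rewrite -rd Sr eqxx.
have [[u v] /= uv] := Bezout_eq1_coprimepP _ _ cop.
have [M1 M10 uM] := poly_bounded u B; have [M2 M20 vM] := poly_bounded v B.
have [M3 M30 SM] := poly_bounded S B; have [M4 M40 QM] := poly_bounded Q B.
pose M := M1 + M2; have M0 : 0 < M by rewrite addr_gt0.
pose L := 2 * M * M3 + 1; have L0 : 0 < L by rewrite ltr_wpDl// !mulr_ge0// ltW.
exists ((L + 1) / e ^+ 2 + 2 * `|B| * M4 * (2 * M)).
  apply: ltr_wpDr; first by rewrite !mulr_ge0 ?(ltW M0) ?(ltW M40).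
  by rewrite divr_gt0 ?exprn_gt0// ltr_wpDr.
move=> x y x' y' [Pxy xd yd Pt] xB yB ye.
have x'0 := cabs_ge0 x'; have y'0 := cabs_ge0 y'.
have B0 : `|B| = B by rewrite ger0_norm// (le_trans (cabs_ge0 x)).
have yn : y - d i != 0 by rewrite subr_eq0.
have rest : e ^+ 2 <= cabs (\prod_(j < 3 | j != i) (y - d j)).
  rewrite cabs_prod (_ : e ^+ 2 = \prod_(j < 3 | j != i) e); last first.
    by rewrite prodr_const; congr (_ ^+ _); have := cardC1 i; rewrite card_ord.
  apply: ler_prod => j ji; rewrite (ltW e0)/=.
  have ij : i != j by rewrite eq_sym.
  have := de j ij; have := cabs_subD y (d i) (d j); rewrite [cabs (d i - y)]cabsC.
  by lra.
have e2 : 0 < e ^+ 2 by rewrite exprn_gt0.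
have r0 : 0 < cabs (\prod_(j < 3 | j != i) (y - d j)) by exact: lt_le_trans rest.
have bez : 1 <= M * cabs S.[x] + M * cabs P^`().[x].
  have /(congr1 (fun p => p.[x])) := uv; rewrite !hornerE => uvx.
  rewrite -[1]/(1 : R) -(cabs1 R) -uvx (le_trans (cabsD _ _))// !cabsM.
  have := uM x xB; have := vM x xB => vx ux.
  by rewrite lerD// ler_wpM2r ?cabs_ge0// /M; lra.
have [SP|SP] := leP (cabs S.[x]) (2 * M)^-1.
  (* here [x] is close to a simple preimage of [P (d i)] *)
  have P'x : 1 <= 2 * M * cabs P^`().[x].
    have h : M * cabs S.[x] <= 1 / 2.
      rewrite (@le_trans _ _ (M * (2 * M)^-1))//; first by rewrite ler_wpM2l// ltW.
      by rewrite invfM mulrCA mulfV ?mulr1 ?lt0r_neq0//; lra.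
    by lra.
  have P'0 : P^`().[x] != 0.
    by apply/negP => /eqP H; move: P'x; rewrite H cabs0 mulr0 ler10.
  have yn0 : dprod d y != 0 by exact: dprod_neq0.
  have -> : (x - y) * x' / dprod d y = (x - y) * y' * Q.[y] / P^`().[x].
    move: Pt; rewrite [P^`().[y]](deriv_dprod hP') => H.
    apply/eqP; rewrite eqr_div//; apply/eqP; rewrite -!mulrA; congr (_ * _).
    by rewrite [LHS]mulrC H; ring.
  rewrite !cabsM cabsV.
  have xy : cabs (x - y) <= 2 * `|B| by rewrite (le_trans (cabsB _ _))// B0; lra.
  have P'i : (cabs P^`().[x])^-1 <= 2 * M.
    by rewrite -[leLHS]mul1r ler_pdivrMr// cabs_gt0.
  apply: (@le_trans _ _ (2 * `|B| * cabs y' * M4 * (2 * M))).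
    rewrite ler_pM ?mulr_ge0 ?invr_ge0 ?cabs_ge0// ler_pM ?mulr_ge0 ?cabs_ge0//.
      by rewrite ler_wpM2r ?cabs_ge0.
    exact: QM.
  rewrite (_ : 2 * `|B| * cabs y' * M4 * (2 * M) = 2 * `|B| * M4 * (2 * M) * cabs y'); last by ring.
  rewrite ler_pM// ?mulr_ge0 ?(ltW M0) ?(ltW M40)//; first by rewrite lerDr divr_ge0 ?(ltW e2)//; lra.
  by rewrite lerDr.
(* here [x - d i] is comparable to [y - d i] *)
have xyL : cabs (x - d i) <= L * cabs (y - d i).
  have h1 : cabs (x - d i) ^+ 2 * cabs S.[x] = cabs (y - d i) ^+ 2 * cabs S.[y].
    by rewrite -!cabsX -!cabsM; congr cabs; move: Pxy; rewrite (PS x) (PS y) => /addrI.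
  have h2 : cabs (x - d i) ^+ 2 <= (2 * M * M3) * cabs (y - d i) ^+ 2.
    rewrite [leRHS](_ : _ = (cabs (y - d i) ^+ 2 * M3) / (2 * M)^-1); last by rewrite invrK; ring.
    rewrite ler_pdivlMr ?invr_gt0 ?mulr_gt0//.
    apply: (@le_trans _ _ (cabs (x - d i) ^+ 2 * cabs S.[x])).
      by rewrite ler_wpM2l ?sqr_ge0// ltW.
    by rewrite h1 ler_wpM2l ?sqr_ge0// SM.
  rewrite -(@ler_pXn2r _ 2)// ?nnegrE ?mulr_ge0 ?cabs_ge0 ?(ltW L0)//.
  rewrite exprMn (le_trans h2)// ler_wpM2r ?sqr_ge0//.
  have : 0 <= 2 * M * M3 by rewrite !mulr_ge0 ?(ltW M0) ?(ltW M30).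
  by rewrite /L; nra.
rewrite (dprodD1 d i) !cabsM cabsV cabsM.
have xy : cabs (x - y) <= (L + 1) * cabs (y - d i).
  have := cabs_subD (d i) x y; rewrite [cabs (d i - y)]cabsC; lra.
have y0 : 0 < cabs (y - d i) by rewrite cabs_gt0.
apply: (@le_trans _ _ ((L + 1) * cabs (y - d i) * cabs x' / (cabs (y - d i) * e ^+ 2))).
  rewrite ler_pM ?mulr_ge0 ?invr_ge0 ?cabs_ge0 ?mulr_ge0 ?cabs_ge0//.
    by rewrite ler_wpM2r ?cabs_ge0.
  by rewrite lef_pV2 ?posrE ?mulr_gt0// ler_wpM2l ?cabs_ge0.
rewrite [leLHS](_ : _ = (L + 1) / e ^+ 2 * cabs x'); last by field; rewrite !lt0r_neq0.
have k0 : 0 <= (L + 1) / e ^+ 2 by rewrite divr_ge0 ?(ltW e2)//; lra.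
rewrite ler_pM//; last by rewrite lerDl.
by rewrite lerDl !mulr_ge0 ?(ltW M0) ?(ltW M40).
Qed.

(** The form is bounded with respect to the spherical metrics of both
    coordinates: it is holomorphic on the compactified curve. *)
Lemma form_bound : exists2 K, 0 < K & forall x y x' y', tangent x y x' y' ->
  cabs ((x - y) * x' / dprod d y) <= K * (spherical x x' + spherical y y').
Proof.
have [A A1 HA] := same_value_growth sP.
have [B0 B01 HB0] := prod_lower [seq d j | j <- enum 'I_3].
have {}HB0 y : B0 <= cabs y -> (cabs y / 2) ^+ 3 <= cabs (dprod d y).
  by move=> /HB0; rewrite size_map -cardE card_ord big_map big_enum.
(* beyond [B0] the point counts as close to infinity *)
pose B := A * (1 + B0).
have BB0 : B0 <= B by rewrite /B; nra.
have [e e0 de] := separated.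
have [||K1 K10 HK1] := @fin_choice_bound 'I_3 (fun i K => forall x y x' y', tangent x y x' y' ->
  cabs x <= B -> cabs y <= B -> cabs (y - d i) < e ->
  cabs ((x - y) * x' / dprod d y) <= K * (cabs x' + cabs y')).
- move=> i M M' MM' H x y x' y' t xB yB ye; apply: le_trans (H _ _ _ _ t xB yB ye) _.
  by rewrite ler_wpM2r// addr_ge0// cabs_ge0.
- by move=> i; have [K _ HK] := @form_bound_near i B e e0 (de i); exists K.
have B10 : 0 <= B by lra.
pose K2 := 2 * B / e ^+ 3; have K20 : 0 <= K2 by rewrite divr_ge0 ?exprn_ge0 ?(ltW e0)// mulr_ge0.
pose K3 := 8 * (2 * A + 1) * (1 + 4 * A ^+ 2).
have K30 : 0 <= K3 by rewrite mulr_ge0 ?addr_ge0// ?mulr_ge0 ?sqr_ge0//; lra.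
have N0 : 0 <= 1 + B ^+ 2 by rewrite addr_ge0// sqr_ge0.
exists ((K1 + K2) * (1 + B ^+ 2) + K3 + 1).
  by rewrite ltr_wpDl// addr_ge0// mulr_ge0// addr_ge0// ltW.
move=> x y x' y' t; have [Pxy xd yd Pt] := t.
have sx0 := spherical_ge0 x x'; have sy0 := spherical_ge0 y y'.
have xA := HA x y Pxy.
have [yB|yB] := leP (cabs y) B0.
  have yB' : cabs y <= B by lra.
  have xB : cabs x <= B by apply: (le_trans xA); rewrite ler_wpM2l//; lra.
  apply: (@le_trans _ _ ((K1 + K2) * (cabs x' + cabs y'))); last first.
    apply: (@le_trans _ _ ((K1 + K2) * ((1 + B ^+ 2) * (spherical x x' + spherical y y')))).
      rewrite ler_wpM2l ?addr_ge0 ?(ltW K10)// mulrDr; apply: lerD; exact: spherical_le.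
    by rewrite mulrA ler_wpM2r ?addr_ge0//; lra.
  have [/existsP[i yi]|/existsPn far] := boolP [exists i, cabs (y - d i) < e].
    apply: le_trans (HK1 i x y x' y' t xB yB' yi) _.
    by rewrite ler_wpM2r ?addr_ge0 ?cabs_ge0//; lra.
  have dy : e ^+ 3 <= cabs (dprod d y).
    rewrite /dprod cabs_prod (_ : e ^+ 3 = \prod_(j < 3) e); last by rewrite prodr_const card_ord.
    by apply: ler_prod => j _; rewrite (ltW e0)/= leNgt far.
  have e3 : 0 < e ^+ 3 by rewrite exprn_gt0.
  rewrite !cabsM cabsV (@le_trans _ _ (K2 * cabs x'))//.
    rewrite /K2 [leRHS]mulrAC ler_pM ?invr_ge0 ?mulr_ge0 ?cabs_ge0//; last first.
      by rewrite lef_pV2// posrE// (lt_le_trans e3).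
    by rewrite ler_wpM2r ?cabs_ge0// (le_trans (cabsB _ _))//; lra.
  by rewrite ler_pM ?cabs_ge0//; [lra|rewrite lerDl cabs_ge0].
have y1 : 1 <= cabs y by lra.
have y0 : 0 < cabs y by lra.
have dy := HB0 y (ltW yB).
have x2 : cabs x <= 2 * A * cabs y by nra.
have dy0 : 0 < (cabs y / 2) ^+ 3 by rewrite exprn_gt0// divr_gt0.
apply: (@le_trans _ _ (K3 * spherical x x')); last first.
  apply: (@le_trans _ _ (K3 * (spherical x x' + spherical y y'))).
    by rewrite ler_wpM2l// lerDl.
  rewrite ler_wpM2r ?addr_ge0//.
  have kk : 0 <= (K1 + K2) * (1 + B ^+ 2) by rewrite mulr_ge0// addr_ge0// ltW.
  by lra.
have x'le : cabs x' <= (1 + 4 * A ^+ 2) * cabs y ^+ 2 * spherical x x'.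
  have p0 : 0 < 1 + cabs x ^+ 2 by rewrite ltr_wpDr// sqr_ge0.
  rewrite /spherical mulrCA ler_peMr ?cabs_ge0// ler_pdivlMr// mul1r.
  have x0 := cabs_ge0 x.
  have : cabs x ^+ 2 <= (2 * A * cabs y) ^+ 2 by rewrite lerXn2r// nnegrE// mulr_ge0//; lra.
  have : 1 <= cabs y ^+ 2 by rewrite exprn_ege1.
  by rewrite !exprMn; lra.
rewrite !cabsM cabsV.
apply: (@le_trans _ _ ((2 * A + 1) * cabs y * ((1 + 4 * A ^+ 2) * cabs y ^+ 2 * spherical x x') / (cabs y / 2) ^+ 3)).
  rewrite ler_pM ?invr_ge0 ?mulr_ge0 ?cabs_ge0//.
    rewrite ler_pM ?cabs_ge0// (le_trans (cabsB _ _))//; lra.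
  by rewrite lef_pV2// posrE// (lt_le_trans dy0).
rewrite [leLHS](_ : _ = K3 * spherical x x')// /K3.
by field; rewrite lt0r_neq0.
Qed.

End form_bound.

(** * Elimination on the curve *)

Section primitive_part.
Variable F : closedFieldType.
Implicit Types (p q : {poly F}) (G H : {poly {poly F}}) (a x y : F).

Local Notation ev a := (map_poly (horner_eval a)).

(** Vanishing on the line [x = a] means that all coefficients in [y] are
    divisible by [x - a]. *)
Lemma ev_eq0 G a : ev a G = 0 -> exists G1, G = ('X - a%:P) *: G1.
Proof.
move=> G0; exists (\poly_(i < size G) (G`_i %/ ('X - a%:P))).
apply/polyP => i; rewrite coefZ coef_poly; case: ltnP => [_|iG]; last first.
  by rewrite mulr0 nth_default.
rewrite mulrC divpK// dvdp_XsubCl; apply/rootP.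
by have := congr1 (fun p => p`_i) G0; rewrite coef_map coef0.
Qed.

(** Over an algebraically closed field, the coefficients have no common factor
    if and only if they have no common zero. *)
Definition primitive G := forall a, ev a G != 0.

(** Common factors [x - a] are divided out one at a time; the degree of the
    leading coefficient decreases. *)
Lemma primitive_part G : G != 0 ->
  exists2 G1, primitive G1 & exists2 c, c != 0 & G = c *: G1.
Proof.
have [n] := ubnP (size (lead_coef G)); elim: n => // n IH in G *.
rewrite ltnS => Gn G0.
have [prim|/existsNP[a /negP]] := pselect (primitive G).
  by exists G => //; exists 1; rewrite ?oner_neq0// scale1r.
rewrite negbK => /eqP /ev_eq0[G1 GE].
have X0 : 'X - a%:P != 0 by rewrite polyXsubC_eq0.
have G10 : G1 != 0 by apply: contra G0 => /eqP G10; rewrite GE G10 scaler0.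
have [|G2 pG2 [c c0 G1E]] := IH G1 _ G10.
  by rewrite (leq_trans _ Gn)// GE lead_coefZ size_mul ?lead_coef_eq0// size_XsubC.
exists G2 => //; exists (('X - a%:P) * c); first by rewrite mulf_neq0.
by rewrite GE G1E scalerA.
Qed.

(** Gauss's lemma: a primitive polynomial divides in [F[x][y]] what it divides
    in [F(x)[y]]. *)
Lemma gauss_divides (c : {poly F}) G H K : primitive G -> c != 0 ->
  c *: K = H * G -> exists H1, K = H1 * G.
Proof.
move=> pG; have [n] := ubnP (size c); elim: n => // n IH in c H *.
rewrite ltnS => cn c0 cK.
have [|c1] := leqP (size c) 1.
  move=> /size1_polyC cE; have c00 : c`_0 != 0.
    by apply: contra c0 => /eqP H0; rewrite cE H0.
  exists ((c`_0)^-1%:P *: H); rewrite -scalerAl -cK cE scalerA -polyCM.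
  by rewrite coefC /= mulVf// scale1r.
have [a /factor_theorem[c1' cE]] : exists a, root c a.
  by apply/closed_rootP; rewrite gtn_eqF.
have X0 : 'X - a%:P != 0 by rewrite polyXsubC_eq0.
have Ha : ev a H = 0.
  apply/eqP; have /eqP := congr1 (ev a) cK; rewrite rmorphM /= map_polyZ /=.
  rewrite /horner_eval cE hornerM !hornerE subrr mulr0 scale0r eq_sym mulf_eq0.
  by rewrite (negPf (pG a)) orbF.
have [H1 HE] := ev_eq0 Ha.
have c1'0 : c1' != 0 by apply: contra c0 => /eqP c10; rewrite cE c10 mul0r.
apply: (IH c1' H1) => //.
  by rewrite (leq_trans _ cn)// cE size_Mmonic ?monicXsubC// size_XsubC addn2.
have : ('X - a%:P)%:P * (c1' *: K - H1 * G) = 0.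
  by rewrite mul_polyC scalerBr scalerA mulrC -cE cK HE -scalerAl subrr.
move/eqP; rewrite mulf_eq0 polyC_eq0 (negPf X0) /= subr_eq0 => /eqP //.
Qed.

Lemma common_factor K L : (1 < size (Pdiv.Idomain.gcdp K L))%N ->
  exists G, [/\ primitive G, (1 < size G)%N, exists H, K = H * G & exists H, L = H * G].
Proof.
set G := Pdiv.Idomain.gcdp K L => sG.
have G0 : G != 0 by rewrite -size_poly_gt0 ltnW.
have [G1 pG1 [c c0 GE]] := primitive_part G0.
have div (M : {poly {poly F}}) : Pdiv.Idomain.dvdp G M -> exists H, M = H * G1.
  move=> /Pdiv.Idomain.dvdpP[[e H] /= e0 eM].
  by apply: (gauss_divides pG1 e0 (H := c *: H)); rewrite eM GE -scalerAr scalerAl.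
exists G1; split=> //.
- by move: sG; rewrite GE size_scale.
- exact: div (Pdiv.Idomain.dvdp_gcdl _ _).
- exact: div (Pdiv.Idomain.dvdp_gcdr _ _).
Qed.

End primitive_part.

(** Polynomials in [{poly {poly C}}] have outer variable [y] and inner variable
    [x], so that [u.[y, x]] is the value at the point [(x, y)]. *)
Section elimination.
Variable R : realType.
Local Notation C := R[i].
Variables (P Q : {poly C}) (d : 'I_3 -> C).
Hypothesis hP' : P^`() = \prod_(j < 3) ('X - (d j)%:P) * Q.
Hypothesis dinj : injective d.
Hypothesis Qd : forall j, Q.[d j] != 0.
Hypothesis only_crit : forall j x, P.[x] = P.[d j] -> P^`().[x] = 0 -> x = d j.
Hypothesis Q'd : forall j, Q^`().[d j] != 0.
Hypothesis sP : (2 < size P)%N.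
Implicit Types (x y z : C) (i j : 'I_3) (u v : {poly {poly C}}).

Definition partial_x u x y := ((swapXY u)^`()).[x, y].
Definition partial_y u x y := u^`().[y, x].

Lemma partial_xM u v x y : partial_x (u * v) x y = partial_x u x y * v.[y, x] + u.[y, x] * partial_x v x y.
Proof. by rewrite /partial_x rmorphM /= derivM !hornerE !horner2_swapXY. Qed.

Lemma partial_yM u v x y : partial_y (u * v) x y = partial_y u x y * v.[y, x] + u.[y, x] * partial_y v x y.
Proof. by rewrite /partial_y derivM !hornerE. Qed.

(** At a zero of the common factor both gradients are multiples of its gradient. *)
Lemma common_factor_gradient u v K L x y : v.[y, x] = 0 -> K = u * v -> forall w, L = w * v ->
  partial_x K x y * partial_y L x y = partial_y K x y * partial_x L x y.
Proof.
by move=> v0 -> w ->; rewrite !partial_xM !partial_yM v0; ring.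
Qed.


Lemma horner2_map_polyC (p : {poly C}) x y : (p^:P).[y, x] = p.[y].
Proof. by rewrite horner_map hornerC. Qed.

Lemma horner2_polyC (p : {poly C}) x y : (p%:P).[y, x] = p.[x].
Proof. by rewrite hornerC. Qed.

(** [K] is the polynomial [(P(y) - P(x)) / (y - x)]. *)
Lemma curve_quotient : exists2 K : {poly {poly C}},
  K * ('X - 'Y) = P^:P - P%:P & swapXY K = K.
Proof.
have /factor_theorem[K KE] : root (P^:P - P%:P) 'X.
  rewrite /root !hornerE subr_eq0; apply/eqP.
  by have := comp_polyXr P; rewrite /comp_poly.
exists K; first by rewrite KE.
have nz : 'X - 'Y != 0 :> {poly {poly C}} by rewrite polyXsubC_eq0.
apply: (mulIf nz); rewrite -KE.
have := congr1 swapXY KE; rewrite rmorphM !rmorphB /= swapXY_X swapXY_Y swapXY_polyC swapXY_map_polyC => H.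
by apply: oppr_inj; rewrite -mulrN !opprB H.
Qed.

Section quotient.
Variable K : {poly {poly C}}.
Hypotheses (KE : K * ('X - 'Y) = P^:P - P%:P) (KS : swapXY K = K).

Lemma quotient_sub x y : K.[y, x] * (y - x) = P.[y] - P.[x].
Proof.
have := congr1 (fun u => u.[y, x]) KE.
by rewrite /= !hornerE horner2_map_polyC.
Qed.

Lemma quotient_sym x y : K.[y, x] = K.[x, y].
Proof. by rewrite -{1}KS horner2_swapXY. Qed.

Lemma quotient_partial_y x y : partial_y K x y * (y - x) + K.[y, x] = P^`().[y].
Proof.
have := congr1 (fun u => u^`().[y, x]) KE.
by rewrite /partial_y derivM !derivB derivX !derivC !subr0 mulr1 deriv_map !hornerE horner2_map_polyC.
Qed.

Lemma quotient_partial_x x y : partial_x K x y = partial_y K y x.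
Proof. by rewrite /partial_x /partial_y KS. Qed.

Lemma quotient_partial_y_diag x : partial_y K x x *+ 2 = P^`(2).[x].
Proof.
have e1 : (P^:P - P%:P)^`()^`() = (P^`(2))^:P.
  by rewrite !derivB derivC deriv0 subr0 !deriv_map.
have e2 : (K * ('X - 'Y))^`()^`() = K^`()^`() * ('X - 'Y) + K^`() *+ 2.
  rewrite derivM derivB derivX derivC subr0 mulr1 derivD derivM derivB derivX derivC.
  by rewrite subr0 mulr1; ring.
have := congr1 (fun u => u.[x, x]) e1; rewrite -KE e2 /= horner2_map_polyC => <-.
by rewrite /partial_y !hornerE /= subrr mulr0 add0r mulr2n.
Qed.

Lemma quotient_size : (1 < size K)%N /\ lead_coef K = (lead_coef P)%:P.
Proof.
have lt : (size (- (P%:P : {poly {poly C}})) < size P^:P)%N.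
  by rewrite size_polyN size_map_polyC (leq_ltn_trans (size_polyC_leq1 _))// ltnW.
have sK : size (P^:P - P%:P) = size P by rewrite size_polyDl// size_map_polyC.
have lK : lead_coef (P^:P - P%:P) = (lead_coef P)%:P.
  by rewrite lead_coefDl// lead_coef_map_inj//; exact: polyC_inj.
have K0 : K != 0.
  by apply: contraTneq sP => K0; rewrite -sK -KE K0 mul0r size_poly0.
split; last by rewrite -lK -KE lead_coef_Mmonic ?monicXsubC.
by move: sP; rewrite -sK -KE size_Mmonic ?monicXsubC// size_XsubC addn2.
Qed.

End quotient.

Lemma second_derivative_neq0 i : P^`(2).[d i] != 0.
Proof.
rewrite /derivn /= hP' (bigD1 i)//= -mulrA derivM derivXsubC mul1r !hornerE subrr mul0r ?addr0.
rewrite mulf_neq0// horner_prod; apply/prodf_neq0 => j ji; rewrite !hornerE subr_eq0.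
by apply: contra ji => /eqP/dinj ->.
Qed.

(** The quotient [Q(y) / Q(x)] of two holomorphic forms is not constant on
    any component of the curve: a common factor of [K] and [a1 Q(x) + a2 Q(y)]
    would vanish at some point above [x = d 0], where the gradients of both
    polynomials are known; their proportionality forces [a2 = 0]. *)
Lemma no_common_factor (K G H1 H2 : {poly {poly C}}) (a1 a2 : C) : K * ('X - 'Y) = P^:P - P%:P -> swapXY K = K ->
  (1 < size G)%N -> K = H1 * G -> (a1 *: Q)%:P + (a2 *: Q)^:P = H2 * G ->
  a2 = 0.
Proof.
move=> KE KS sG KG EG; pose x0 := d ord0.
have [_ lK] := quotient_size KE.
have lG : (lead_coef G).[x0] != 0.
  apply/negP => /eqP lG0; have := congr1 (fun p => p.[x0]) lK.
  rewrite KG lead_coefM hornerM lG0 mulr0 hornerC => /esym/eqP.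
  by rewrite lead_coef_eq0 -size_poly_eq0; case: (size P) sP.
have [y0 /rootP Gy0] : exists y0, root (map_poly (horner_eval x0) G) y0.
  apply/closed_rootP; rewrite size_map_poly_id0//; by rewrite gtn_eqF.
have {}Gy0 : G.[y0, x0] = 0.
  by rewrite -[RHS]Gy0 -[y0 in RHS](hornerC y0 x0) horner_map.
set E := _ + _ in EG.
have EE : E.[y0, x0] = a1 * Q.[x0] + a2 * Q.[y0].
  by rewrite /E hornerD hornerD horner2_map_polyC horner2_polyC !hornerZ.
have partial_xE : partial_x E x0 y0 = a1 * Q^`().[x0].
  by rewrite /partial_x /E rmorphD /= swapXY_polyC swapXY_map_polyC derivD derivC addr0 deriv_map horner2_map_polyC derivZ hornerZ.
have partial_yE : partial_y E x0 y0 = a2 * Q^`().[y0].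
  by rewrite /partial_y /E derivD derivC add0r deriv_map horner2_map_polyC derivZ hornerZ.
have E0 : a1 * Q.[x0] + a2 * Q.[y0] = 0 by rewrite -EE EG !hornerM Gy0 mulr0.
have K0 : K.[y0, x0] = 0 by rewrite KG !hornerM Gy0 mulr0.
have grad := common_factor_gradient Gy0 KG EG.
have Pxy : P.[y0] = P.[x0].
  by apply/eqP; rewrite -subr_eq0 -(quotient_sub KE) K0 mul0r.
have [yx|yx] := eqVneq y0 x0.
  move: E0 grad; rewrite partial_xE partial_yE yx (quotient_partial_x KS) => E0 grad.
  have s0 : partial_y K x0 x0 != 0.
    have := second_derivative_neq0 ord0; rewrite -(quotient_partial_y_diag KE).
    by apply: contra => /eqP ->; rewrite mul0rn.
  have := mulfI s0 grad; move/(mulIf (Q'd ord0)) => a12.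
  move/eqP: E0; rewrite -a12 -mulr2n mulrn_eq0 mulf_eq0 (negPf (Qd ord0)) orbF /=.
  by move=> /eqP.
have P'x : P^`().[x0] = 0 by rewrite (deriv_dprod hP') (dprodD1 _ ord0) subrr !mul0r.
have P'y : P^`().[y0] != 0.
  by apply: contra yx => /eqP H; apply/eqP/(only_crit Pxy H).
have partial_yK : partial_y K x0 y0 != 0.
  apply: contra P'y => /eqP H; rewrite -(quotient_partial_y KE x0) H mul0r add0r K0//.
have partial_xK : partial_x K x0 y0 = 0.
  have := quotient_partial_y KE y0 x0; rewrite -(quotient_partial_x KS) -(quotient_sym KS) K0 addr0 P'x.
  by move/eqP; rewrite mulf_eq0 subr_eq0 [x0 == y0]eq_sym (negPf yx) orbF => /eqP.
move: grad; rewrite partial_xK mul0r partial_xE => /esym/eqP; rewrite !mulf_eq0 (negPf partial_yK) (negPf (Q'd ord0)) orbF /=.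
move=> /eqP a10; move/eqP: E0; rewrite a10 mul0r add0r mulf_eq0 => /orP[/eqP //|/eqP Qy].
by move: P'y; rewrite (deriv_dprod hP') Qy mulr0 eqxx.
Qed.

(** [T] is the resultant with respect to [y] of [K] and
    [a1 Q(x) + a2 Q(y)], and [K] vanishes at the points of the curve. *)
Lemma elimination a1 a2 : (1 < size Q)%N -> (a1 != 0) || (a2 != 0) ->
  exists T : {poly C}, T != 0 /\ exists v : {poly {poly C}}, forall x y,
    P.[x] = P.[y] -> x != y -> T.[x] = v.[y, x] * (a1 * Q.[x] + a2 * Q.[y]).
Proof.
move=> sQ a12; have [a20|a20] := eqVneq a2 0.
  exists (a1 *: Q); split.
    by move: a12; rewrite a20 eqxx orbF => a10; rewrite scaler_eq0 negb_or a10 -size_poly_gt0 ltnW.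
  by exists 1 => x y _ _; rewrite hornerZ a20 mul0r addr0 !hornerC mul1r.
have [K KE KS] := curve_quotient; have [sK _] := quotient_size KE.
pose E := (a1 *: Q)%:P + (a2 *: Q)^:P.
have sE : (1 < size E)%N.
  by rewrite /E addrC size_polyDl size_map_polyC size_scale// (leq_ltn_trans (size_polyC_leq1 _)).
have [[u v] /= _ uv] := resultant_in_ideal sK sE.
exists (resultant K E); split.
  rewrite resultant_eq0; apply/negP => /common_factor[G [_ sG [H1 KG] [H2 EG]]].
  by move: a20; rewrite (no_common_factor KE KS sG KG EG) eqxx.
exists v => x y Pxy xy.
have K0 : K.[y, x] = 0.
  have := quotient_sub KE x y; rewrite Pxy subrr => /eqP.
  by rewrite mulf_eq0 subr_eq0 [y == x]eq_sym (negPf xy) orbF => /eqP.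
have := congr1 (fun w => w.[y, x]) uv; rewrite /= hornerC => ->.
by rewrite hornerD hornerD !hornerM K0 mulr0 add0r /E hornerD hornerD horner2_map_polyC horner2_polyC !hornerZ.
Qed.

End elimination.

(** * Functions confined near finitely many points *)

Section clusters.
Variable R : realType.
Local Notation C := R[i].
Implicit Types (e : R) (x y z w r : C) (rs : seq C) (f g : C -> option C).

(** The [e]-neighbourhood of [rs] and infinity on the Riemann sphere. *)
Definition close_to rs e x := e^-1 < cabs x \/ exists2 r, r \in rs & cabs (x - r) < e.

(** The condition under which the pieces of [close_to rs e] are disjoint. *)
Definition sparse rs e := (forall r r', r \in rs -> r' \in rs -> r != r' -> 2 * e <= cabs (r - r')) /\
  (forall r, r \in rs -> cabs r + e <= e^-1).

Lemma positive_lower_bound (s : seq R) : (forall t, t \in s -> 0 < t) ->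
  exists2 e, 0 < e & forall t, t \in s -> e <= t.
Proof.
elim: s => [|t s IH] H; first by exists 1.
have [|e e0 He] := IH; first by move=> x xs; apply: H; rewrite inE xs orbT.
exists (Num.min t e); first by rewrite lt_min e0 H// mem_head.
move=> x; rewrite inE => /predU1P[->|/He ex]; first by rewrite ge_min lexx.
by rewrite ge_min ex orbT.
Qed.

Lemma sparse_ex rs : exists2 e0, 0 < e0 & forall e, 0 < e -> e <= e0 -> sparse rs e.
Proof.
have [|e1 e10 H1] := @positive_lower_bound
  [seq (if p.1 == p.2 then 1 else cabs (p.1 - p.2) / 2) | p <- [seq (r, r') | r <- rs, r' <- rs]].
  move=> t /mapP[[r r'] _ ->] /=; case: eqVneq => // rr'.
  by rewrite divr_gt0// cabs_gt0 subr_eq0.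
have [|e2 e20 H2] := @positive_lower_bound [seq (cabs r + 1)^-1 | r <- rs].
  by move=> t /mapP[r _ ->]; rewrite invr_gt0 ltr_wpDl// cabs_ge0.
exists (Num.min 1 (Num.min e1 e2)); first by rewrite !lt_min ltr01 e10 e20.
move=> e e0; rewrite !le_min => /and3P[e_1 ee1 ee2]; split.
- move=> r r' rin r'in rr'.
  have : e1 <= cabs (r - r') / 2.
    apply: H1; apply/mapP; exists (r, r'); first by apply/allpairsP; exists (r, r').
    by rewrite /= (negPf rr').
  by lra.
- move=> r rin; have r0 : 0 < cabs r + 1 by rewrite ltr_wpDl// cabs_ge0.
  have : e <= (cabs r + 1)^-1 by rewrite (le_trans ee2)// H2//; apply/mapP; exists r.
  rewrite -[X in X <= _]invrK lef_pV2 ?posrE ?invr_gt0// => H.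
  by apply: le_trans H; rewrite lerD2l.
Qed.

Lemma prod_ge rs e x : 0 <= e -> (forall r, r \in rs -> e <= cabs (x - r)) ->
  e ^+ size rs <= cabs (\prod_(r <- rs) (x - r)).
Proof.
move=> e0; elim: rs => [|r rs IH] H; first by rewrite big_nil cabs1.
rewrite big_cons cabsM /= exprS ler_pM ?exprn_ge0//; first by rewrite H// mem_head.
by apply: IH => r' r'in; rewrite H// inE r'in orbT.
Qed.

Lemma close_to_roots (T : {poly C}) n : T != 0 ->
  exists rs, forall e, 0 < e -> exists2 t, 0 < t &
  forall x, cabs T.[x] <= t * (1 + cabs x) ^+ n -> close_to rs e x.
Proof.
move=> T0; have [rs _ TE] := poly_split T0; exists rs => e e0.
have l0 : 0 < cabs (lead_coef T) by rewrite cabs_gt0 lead_coef_eq0.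
set k := (1 + e^-1) ^+ n; have k0 : 0 < k by rewrite exprn_gt0// ltr_wpDr// invr_ge0 ltW.
set m := cabs (lead_coef T) * e ^+ size rs; have m0 : 0 < m by rewrite mulr_gt0// exprn_gt0.
exists (m / 2 / k); first by rewrite !divr_gt0.
move=> x Tx; have [xe|xe] := ltP e^-1 (cabs x); [by left|right].
apply: contrapT => far.
have h1 : m <= cabs T.[x].
  rewrite TE cabsM ler_wpM2l ?cabs_ge0// prod_ge ?(ltW e0)// => r rin.
  by rewrite leNgt; apply/negP => H; apply: far; exists r.
have : cabs T.[x] <= m / 2.
  apply: (le_trans Tx); rewrite -[leRHS](divfK (lt0r_neq0 k0)) ler_wpM2l ?divr_ge0 ?(ltW m0) ?(ltW k0)//.
  rewrite /k lerXn2r ?nnegrE ?addr_ge0 ?cabs_ge0 ?invr_ge0 ?(ltW e0)//.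
  by rewrite lerD2l.
by lra.
Qed.

(** Passing from [e / 2] to [e] absorbs the limit from generic points, where the
    values are controlled, to all points. *)
Lemma close_to_lim rs e f w : 0 < e -> reg f w ->
  nbh w (fun x => x != w -> close_to rs (e / 2) (finval f x)) -> close_to rs e (finval f w).
Proof.
move=> e0 rf H; have ei : 0 < e^-1 by rewrite invr_gt0.
have cf := holo_ccont rf.1.
have m0 : 0 < Num.min (e / 2) e^-1 by rewrite lt_min divr_gt0.
have [x xw [cx xe]] : exists2 x, x != w & close_to rs (e / 2) (finval f x) /\
    cabs (finval f x - finval f w) < Num.min (e / 2) e^-1.
  by apply: nbh_punctured_ex; apply: nbhS2 H (cf _ m0) => x Hx ? /Hx.
move: xe; rewrite lt_min => /andP[xe1 xe2].
case: cx => [far|[r rin rx]]; [left|right].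
  have : cabs (finval f x) - cabs (finval f w) <= cabs (finval f x - finval f w) := cabs_subl _ _.
  have : (e / 2)^-1 = 2 * e^-1 by rewrite invf_div.
  by lra.
exists r => //; have := cabs_subD (finval f x) (finval f w) r; rewrite [cabs (finval f w - finval f x)]cabsC.
by lra.
Qed.

Definition close_inf e f w := forall x, f w = Some x -> e^-1 < cabs x.
Definition close_pt e f r w := exists2 x, f w = Some x & cabs (x - r) < e.

Lemma close_pt_open e f r w : meromorphic f -> close_pt e f r w -> nbh w (close_pt e f r).
Proof.
move=> mf [x fx xr].
have rf : reg f w by have [//|[m [h [_ fw _ _ _]]]] := meromorphicP w mf; rewrite fw in fx.
have xE : finval f w = x by rewrite /finval fx.
have d0 : 0 < e - cabs (x - r) by rewrite subr_gt0.
apply: nbhS2 (holo_ccont rf.1 d0) rf.2 => w' H fw'; exists (finval f w') => //.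
by have := cabs_subD x (finval f w') r; rewrite xE in H; lra.
Qed.

Lemma close_inf_open e f w : 0 < e -> meromorphic f -> close_inf e f w -> nbh w (close_inf e f).
Proof.
move=> e0 mf H; have [rf|[m [h [m0 fw hh h0 fh]]]] := meromorphicP w mf.
  have Hw := H _ (reg_val rf).
  have d0 : 0 < cabs (finval f w) - e^-1 by rewrite subr_gt0.
  apply: nbhS2 (holo_ccont rf.1 d0) rf.2 => w' H' fw' x; rewrite fw' => -[<-].
  by have := cabs_subl (finval f w) (finval f w'); rewrite [cabs (_ w - _)]cabsC; lra.
have cm : ccont (fun x => (x - w) ^+ m) w.
  by apply: ccontX; apply: ccontB; [exact: ccont_id|exact: ccont_cst].
have d0 : 0 < cabs (h w) / 2 * e by rewrite mulr_gt0// divr_gt0// cabs_gt0.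
apply: nbhS2 (nbhI fh (cm _ d0)) (ccont_neq0 (holo_ccont hh) h0) => x [fx xm] hx y fy.
have [xw|xw] := eqVneq x w; first by rewrite xw fw in fy.
move: fy; rewrite fx// => -[<-]; rewrite cabsM cabsV.
move: xm; rewrite subrr expr0n (gtn_eqF m0) subr0 => xm.
have xm0 : 0 < cabs ((x - w) ^+ m) by rewrite cabs_gt0 expf_neq0// subr_eq0.
rewrite ltr_pdivlMr// mulrC ltr_pdivrMr//; apply: (lt_trans xm).
by rewrite ltr_pM2r.
Qed.

(** On a connected disc the function cannot jump from one of the disjoint pieces
    of [close_to rs e] to another. *)
Lemma cluster rs e f z s : 0 < e -> sparse rs e -> meromorphic f -> 0 < s ->
  (forall w, cabs (w - z) < s -> reg f w -> close_to rs e (finval f w)) ->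
  (forall w, cabs (w - z) < s -> close_inf e f w) \/
  exists r, forall w, cabs (w - z) < s -> close_pt e f r w.
Proof.
move=> e0 [sep far] mf s0 H.
have cases w : cabs (w - z) < s -> close_inf e f w \/ exists2 r, r \in rs & close_pt e f r w.
  move=> ws; have [rf|[m [h [_ fw _ _ _]]]] := meromorphicP w mf; last first.
    by left => x; rewrite fw.
  case: (H w ws rf) => [inf|[r rin fr]]; [left|right].
    by move=> x; rewrite (reg_val rf) => -[<-].
  by exists r => //; exists (finval f w) => //; exact: reg_val.
have disj1 r w : r \in rs -> close_pt e f r w -> close_inf e f w -> False.
  move=> rin [x fx xr] /(_ x fx); have := far r rin.
  by have := cabs_subl x r; lra.
have disj2 r r' w : r \in rs -> r' \in rs -> close_pt e f r w -> close_pt e f r' w -> r = r'.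
  move=> rin r'in [x fx xr] [y]; rewrite fx => -[<-] xr'; apply/eqP/negPn/negP => rr'.
  have := sep r r' rin r'in rr'; have := cabs_subD x r r'; rewrite [cabs (r - x)]cabsC.
  by lra.
have seg w (t : R) : cabs (w - z) < s -> 0 <= t <= 1 -> cabs (z + t%:C * (w - z) - z) < s.
  move=> ws /andP[t0 t1]; rewrite addrC addKr cabsM cabs_real ger0_norm//.
  by apply: le_lt_trans ws; rewrite ler_piMl ?cabs_ge0.
have zs : cabs (z - z) < s by rewrite subrr cabs0.
have [inf|[r rin cr]] := cases z zs; [left|right].
  move=> w ws; apply: (@segment_clopen R (close_inf e f) z w) => // t t01 x.
  have xs := seg w t ws t01; split; first exact: close_inf_open.
  move=> ninf; have [//|[r rin cr]] := cases x xs.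
  by apply: nbhS (close_pt_open mf cr) => y; exact: disj1.
exists r => w ws; apply: (@segment_clopen R (close_pt e f r) z w) => // t t01 x.
have xs := seg w t ws t01; split; first exact: close_pt_open.
move=> nr; have [inf|[r' r'in cr']] := cases x xs.
  by apply: nbhS (close_inf_open e0 mf inf) => y cy /disj1; apply.
apply: nbhS (close_pt_open mf cr') => y cy cy'; apply: nr.
by rewrite (disj2 r r' y rin r'in cy' cy).
Qed.

(** Cauchy's estimate for [f - r] or, near infinity, for [1 / f], which is
    holomorphic and vanishes at the poles. *)
Lemma spherical_small rs e f z s w : 0 < e -> sparse rs e -> meromorphic f -> 0 < s ->
  (forall w, cabs (w - z) < s -> reg f w -> close_to rs e (finval f w)) ->
  cabs (w - z) < s / 2 -> reg f w ->
  spherical (finval f w) (cderiv (finval f) w) <= 2048 * e / s.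
Proof.
move=> e0 sp mf s0 H ws rf; have s20 : 0 < s / 2 by lra.
have inball x : cabs (x - w) < s / 2 -> cabs (x - z) < s.
  by move=> xw; have := cabs_subD w x z; lra.
have p0 : 0 < 1 + cabs (finval f w) ^+ 2 by rewrite ltr_wpDr// sqr_ge0.
have sE : 2048 * e / s = 1024 * e / (s / 2) by field; exact: lt0r_neq0.
rewrite sE.
case: (cluster e0 sp mf s0 H) => [inf|[r pt]].
  pose k x := if f x is Some y then y^-1 else 0.
  have kreg x : reg f x -> cabs (x - z) < s ->
      cder k x (- cderiv (finval f) x / finval f x ^+ 2) /\ cabs (k x) <= e.
    move=> rx xs; have fx := inf x xs _ (reg_val rx).
    have f0 : 0 < cabs (finval f x) by rewrite (lt_trans _ fx)// invr_gt0.
    split.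
      apply: (@eq_cder _ (fun y => (finval f y)^-1)); first by apply: nbhS rx.2 => y; rewrite /k => ->.
      by apply: cderV (cderivP (nbh_center rx.1)); rewrite -cabs_gt0.
    by rewrite /k (reg_val rx) cabsV -[leRHS]invrK lef_pV2 ?posrE ?invr_gt0// ltW.
  have kball x : cabs (x - w) < s / 2 -> diffable k x /\ cabs (k x) <= e.
    move=> /inball xs; have [rx|[m [h [m0 fx hh h0 fh]]]] := meromorphicP x mf.
      by have [dk ke] := kreg x rx xs; split=> //; eexists; exact: dk.
    split; last by rewrite /k fx cabs0 ltW.
    suff /nbh_center : holo k x by [].
    apply: (@eq_holo _ (fun y => (y - x) ^+ m * (h y)^-1)).
      apply: nbhS2 fh (ccont_nbh_neq0 (holo_ccont hh) h0) => y fy hy.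
      have [->|yx] := eqVneq y x.
        by rewrite /k fx subrr expr0n (gtn_eqF m0) mul0r.
      by rewrite /k fy// invfM invrK mulrC.
    apply: holoM; last exact: holoV.
    by apply: holoX; apply: holoB; [exact: holo_id|exact: holo_cst].
  have ws' : cabs (w - z) < s by lra.
  have [/cderivE kD _] := kreg w rf ws'.
  have fw := inf w ws' _ (reg_val rf).
  have f0 : 0 < cabs (finval f w) by rewrite (lt_trans _ fw)// invr_gt0.
  apply: le_trans (cauchy_estimate s20 kball); rewrite kD /spherical cabsM cabsN cabsV cabsX.
  by rewrite ler_wpM2l ?cabs_ge0// lef_pV2 ?posrE ?exprn_gt0// lerDr.
have fball x : cabs (x - w) < s / 2 -> diffable (fun y => finval f y - r) x /\ cabs (finval f x - r) <= e.
  move=> /inball xs; have [y fy yr] := pt x xs.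
  have rx : reg f x by have [//|[m [h [_ fx _ _ _]]]] := meromorphicP x mf; rewrite fx in fy.
  split; last by rewrite /finval fy ltW.
  by have [l dl] := nbh_center rx.1; eexists; exact: cderB dl (cder_cst r x).
have := cauchy_estimate s20 fball.
rewrite (cderivE (cderB (cderivP (nbh_center rf.1)) (cder_cst r w))) subr0 => Dle.
apply: le_trans Dle; rewrite /spherical ler_pdivrMr// ler_peMr ?cabs_ge0//.
by rewrite lerDl sqr_ge0.
Qed.

End clusters.

(** * Rescaling and confinement of the two functions *)

Section point_picking.
Variable R : realType.
Local Notation C := R[i].
Implicit Types (z w : C).

Lemma complex_cauchy (s : nat -> C) (c : R) : 0 <= c ->
  (forall n, cabs (s n.+1 - s n) <= c / 2 ^+ n) ->
  exists z, forall n, cabs (s n - z) <= 4 * c / 2 ^+ n.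
Proof.
move=> c0 H.
have half n : c / 2 ^+ n.+1 = c / 2 ^+ n / 2 by rewrite exprS invfM; lra.
have real_part (t : nat -> R) : (forall n, `|t n.+1 - t n| <= c / 2 ^+ n) ->
    exists x, forall n, `|t n - x| <= 2 * c / 2 ^+ n.
  move=> Ht; have [|||x xP] := @nested_intervals R (fun n => t n - 2 * (c / 2 ^+ n)) (fun n => t n + 2 * (c / 2 ^+ n)).
  - by move=> n; rewrite half; have := Ht n; rewrite ler_norml; lra.
  - by move=> n; rewrite half; have := Ht n; rewrite ler_norml; lra.
  - by move=> n; have p : 0 <= c / 2 ^+ n; [rewrite divr_ge0// exprn_ge0|lra].
  exists x => n; have := xP n; rewrite -mulrA ler_norml; lra.
have [|x xP] := real_part (fun n => complex.Re (s n)).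
  by move=> n; have := Re_le_cabs (s n.+1 - s n); rewrite raddfB /= => /le_trans; apply.
have [|y yP] := real_part (fun n => complex.Im (s n)).
  by move=> n; have := Im_le_cabs (s n.+1 - s n); rewrite raddfB /= => /le_trans; apply.
exists (x +i* y) => n; rewrite (le_trans (cabs_le_ReIm _))// !raddfB /=.
by have := xP n; have := yP n; lra.
Qed.

(** Hofer's form of the rescaling argument of Bloch, Zalcman and Brody: some
    disc, large at the scale given by [M] at its centre, on which [M] is at
    most twice its value at the centre. *)
Lemma point_picking (M : C -> R) z0 (N : R) : 0 < N ->
  (forall z, nbh z (fun w => M w < M z + 1)) -> 0 < M z0 ->
  exists z, 0 < M z /\ forall w, cabs (w - z) < N / M z -> M w <= 2 * M z.
Proof.
move=> N0 Mloc M0; apply: contrapT => nex.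
have step (q : {z | 0 < M z}) : {q' : {z | 0 < M z} |
    cabs (sval q' - sval q) < N / M (sval q) /\ 2 * M (sval q) < M (sval q')}.
  case: q => z Mz; apply: cid; apply: contrapT => nz; apply: nex; exists z; split=> //.
  move=> w wz; rewrite leNgt; apply/negP => Mw; apply: nz.
  have Mw0 : 0 < M w by apply: lt_trans Mw; rewrite mulr_gt0.
  by exists (exist _ w Mw0).
pose s := fun n => iter n (fun q => sval (step q)) (exist (fun z => 0 < M z) z0 M0).
have sn n : cabs (sval (s n.+1) - sval (s n)) < N / M (sval (s n)) /\
    2 * M (sval (s n)) < M (sval (s n.+1)) by exact: (svalP (step (s n))).
have grow n : 2 ^+ n * M z0 <= M (sval (s n)).
  elim: n => [|n IH]; first by rewrite expr0 mul1r.
  by rewrite exprS; have [_] := sn n; lra.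
have NM0 : 0 <= N / M z0 by rewrite divr_ge0// ltW.
have [|z zP] := @complex_cauchy (fun n => sval (s n)) (N / M z0) NM0.
  move=> n; have [/ltW H _] := sn n; apply: (le_trans H).
  rewrite -mulrA -invfM ler_wpM2l ?(ltW N0)// lef_pV2 ?posrE ?mulr_gt0 ?exprn_gt0//.
    by rewrite mulrC.
  exact: (svalP (s n)).
have [d d0 Hd] := Mloc z.
have pow (a : R) : exists n : nat, a < 2 ^+ n.
  exists (Num.truncn a).+1; apply: lt_trans (truncnS_gt a) _.
  by rewrite -natrX ltr_nat ltn_expl.
have [n1 Hn1] := pow (4 * (N / M z0) / d); have [n2 Hn2] := pow ((M z + 1) / M z0).
pose n := maxn n1 n2.
have p1 : 4 * (N / M z0) / d < 2 ^+ n.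
  by apply: (lt_le_trans Hn1); rewrite ler_weXn2l ?leq_maxl// ler1n.
have p2 : (M z + 1) / M z0 < 2 ^+ n.
  by apply: (lt_le_trans Hn2); rewrite ler_weXn2l ?leq_maxr// ler1n.
have snz : cabs (sval (s n) - z) < d.
  by apply: le_lt_trans (zP n) _; rewrite ltr_pdivrMr ?exprn_gt0// [ltRHS]mulrC -ltr_pdivrMr.
have := Hd _ snz; have := grow n; move: p2; rewrite ltr_pdivrMr//; lra.
Qed.

Lemma uniform_interval (S : R -> R -> Prop) :
  (forall t e e', 0 < e' -> e' <= e -> S t e -> S t e') ->
  (forall t, -1 <= t <= 1 -> exists2 e, 0 < e & forall t', `|t' - t| < e -> S t' e) ->
  exists2 e, 0 < e & forall t, -1 <= t <= 1 -> S t e.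
Proof.
move=> mono loc.
have := @segment_compact R (-1) 1; move/compact_near_coveringP.
move=> /(_ R (at_right 0) (fun e t => S t e) _) cov.
have : \forall e \near 0^'+, (`[(-1 : R), 1] : set R) `<=` S^~ e.
  apply: cov => t /=; rewrite in_itv /= => /loc[e e0 He].
  exists ([set x | `|x - t| < e], [set x | 0 < x <= e]) => /=; first split.
  - by exists e => //= x; rewrite /ball /= distrC.
  - near=> x; apply/andP; split; near: x; first exact: nbhs_right_gt.
    exact: nbhs_right_le.
  - by case=> x y /= [xt /andP[y0 ye]]; apply: (mono _ e) => //; exact: He.
move=> [e /= e0 He]; exists (e / 2); first by rewrite divr_gt0.
move=> t t1; have := He (e / 2); rewrite /ball /= sub0r normrN gtr0_norm ?divr_gt0//.
move=> /(_ _ _)/(_ t); apply; rewrite ?in_itv//.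
by rewrite ltr_pdivrMr// mulr_natr mulr2n ltrDl.
Unshelve. all: by end_near. Qed.

(** Compactness of the unit disc, from that of an interval used for the
    imaginary and then for the real part. *)
Lemma uniform_disc (S : C -> R -> Prop) :
  (forall b e e', 0 < e' -> e' <= e -> S b e -> S b e') ->
  (forall b, exists2 e, 0 < e & forall b', cabs (b' - b) < e -> S b' e) ->
  exists2 e, 0 < e & forall b, cabs b <= 1 -> S b e.
Proof.
move=> mono loc.
have [||e e0 He] := @uniform_interval (fun x e => forall y, -1 <= y <= 1 -> S (x +i* y) e).
- by move=> x e e' e'0 ee' H y y1; exact: (mono _ _ _ e'0 ee' (H y y1)).
- move=> x _.
  have [||e e0 He] := @uniform_interval (fun y e => forall x', `|x' - x| < e -> S (x' +i* y) e).
  + move=> y e e' e'0 ee' H x' xx'; apply: (mono _ _ _ e'0 ee'); apply: H.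
    exact: lt_le_trans ee'.
  + move=> y _; have [e e0 He] := loc (x +i* y); exists (e / 2); first by rewrite divr_gt0.
    move=> y' yy' x' xx'; apply: (mono _ e); [by rewrite divr_gt0|lra|].
    apply: He; rewrite (le_lt_trans (cabs_le_ReIm _))//=; lra.
  by exists e => // x' xx' y y1; exact: He.
exists e => // b b1; have := Re_le_cabs b; have := Im_le_cabs b.
case: b b1 => x y b1 /= yb xb; apply: He; move: yb xb; rewrite !ler_norml; lra.
Qed.

End point_picking.

Section uniqueness.
Variable R : realType.
Local Notation C := R[i].
Variables (P Q : {poly C}) (d : 'I_3 -> C).
Hypothesis hP' : P^`() = \prod_(j < 3) ('X - (d j)%:P) * Q.
Hypothesis dinj : injective d.
Hypothesis Qd : forall j, Q.[d j] != 0.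
Hypothesis only_crit : forall j x, P.[x] = P.[d j] -> P^`().[x] = 0 -> x = d j.
Hypothesis Q'd : forall j, Q^`().[d j] != 0.
Hypothesis sP : (2 < size P)%N.
Hypothesis sQ : (1 < size Q)%N.
Implicit Types (f g : C -> option C) (x y z w b : C) (i j : 'I_3).

(** Along the curve [|y|] is at most comparable to [1 + |x|]. *)
Lemma bivariate_growth (v : {poly {poly C}}) (A : R) : 0 <= A -> exists2 M, 0 < M & exists n,
  forall x y, cabs y <= A * (1 + cabs x) -> cabs v.[y, x] <= M * (1 + cabs x) ^+ n.
Proof.
move=> A0; elim/poly_ind: v => [|v c [M M0 [n IH]]].
  by exists 1 => //; exists 0%N => x y _; rewrite !horner0 cabs0 mul1r exprn_ge0// addr_ge0// cabs_ge0.
have [M' M'0 Hc] := poly_upper c.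
exists (M * A + M'); first by rewrite ltr_wpDl// mulr_ge0// ltW.
exists (n.+1 + (size c).-1)%N => x y yx.
have x1 : 1 <= 1 + cabs x by rewrite lerDl cabs_ge0.
have x0 : 0 <= 1 + cabs x by lra.
rewrite !hornerE (le_trans (cabsD _ _))// cabsM mulrDl; apply: lerD.
  apply: (@le_trans _ _ (M * (1 + cabs x) ^+ n * (A * (1 + cabs x)))).
    by rewrite ler_pM ?cabs_ge0// IH.
  rewrite mulrACA -exprSr ler_wpM2l ?mulr_ge0 ?(ltW M0)//.
  by rewrite ler_weXn2l// leq_addr.
apply: (le_trans (Hc x)); rewrite ler_wpM2l ?(ltW M'0)//.
by rewrite ler_weXn2l// leq_addl.
Qed.

(** [T] is bounded at [x] by its cofactor times [a1 Q(x) + a2 Q(y)], hence by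
    [t] times a power of [1 + |x|]. *)
Lemma confinement a1 a2 : (a1 != 0) || (a2 != 0) ->
  exists rs, forall e, 0 < e -> exists2 t, 0 < t & forall x y, P.[x] = P.[y] -> x != y ->
    cabs (a1 * Q.[x] + a2 * Q.[y]) <= t * (cabs Q.[x] + cabs Q.[y]) -> close_to rs e x.
Proof.
move=> a12; have [T [T0 [v Tv]]] := elimination hP' dinj Qd only_crit Q'd sP sQ a12.
have [A A1 HA] := same_value_growth (ltnW sP).
have A0 : 0 <= A by lra.
have [M M0 [n Hv]] := bivariate_growth v A0.
have [M' M'0 HQ] := poly_upper Q; set q := (size Q).-1 in HQ.
have [rs Hrs] := close_to_roots (n + q) T0; exists rs => e e0.
have [t t0 Ht] := Hrs e e0.
pose c := M * (M' * (1 + (2 * A) ^+ q)).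
have c0 : 0 < c by rewrite !mulr_gt0// ltr_wpDr// exprn_ge0//; lra.
exists (t / c); first by rewrite divr_gt0.
move=> x y Pxy xy small; apply: Ht.
have x1 : 1 <= 1 + cabs x by rewrite lerDl cabs_ge0.
have yx := HA y x (esym Pxy).
have Qx := HQ x.
have Qy : cabs Q.[y] <= M' * (2 * A) ^+ q * (1 + cabs x) ^+ q.
  apply: (le_trans (HQ y)); rewrite -mulrA ler_wpM2l ?(ltW M'0)// -exprMn.
  rewrite lerXn2r ?nnegrE ?addr_ge0 ?mulr_ge0 ?cabs_ge0//; nra.
have QQ : cabs Q.[x] + cabs Q.[y] <= M' * (1 + (2 * A) ^+ q) * (1 + cabs x) ^+ q by lra.
rewrite (Tv x y Pxy xy) cabsM.
apply: (@le_trans _ _ ((M * (1 + cabs x) ^+ n) * (t / c * (M' * (1 + (2 * A) ^+ q) * (1 + cabs x) ^+ q)))).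
  rewrite ler_pM ?cabs_ge0//; first exact: Hv.
  by apply: (le_trans small); rewrite ler_wpM2l// divr_ge0// ltW.
rewrite [leLHS](_ : _ = t / c * c * ((1 + cabs x) ^+ n * (1 + cabs x) ^+ q)); last by rewrite /c; ring.
by rewrite divfK ?lt0r_neq0// exprD.
Qed.

Definition form_ext f g (u : C -> C) := (forall z, holo u z) /\
  forall z, nbh z (fun w => w != z -> u w = curve_form d f g w).

(** If both forms are almost proportional on a disc, both functions are
    confined there, hence their forms are small compared to the inverse of
    the radius. *)
Lemma forms_not_proportional b : exists2 t, 0 < t & forall f g u v z s (c : C),
  refuting_pair P f g -> form_ext f g u -> form_ext g f v -> 0 < s -> c != 0 ->
  (forall w, cabs (w - z) < s -> cabs (u w - c) <= t * cabs c /\ cabs (v w - b * c) <= t * cabs c) ->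
  s * cabs (u z) < 2^-1.
Proof.
have [rs Hrs] := confinement (a1 := 1) (a2 := b) (introT orP (or_introl (oner_neq0 _))).
have [rs' Hrs'] := confinement (a1 := b) (a2 := 1) (introT orP (or_intror (oner_neq0 _))).
have [K K0 HK] := form_bound hP' dinj Qd only_crit (ltnW sP).
have [e1 e10 He1] := sparse_ex rs; have [e2 e20 He2] := sparse_ex rs'.
(* [e] so small that [form_bound] and [spherical_small] give at most [1 / 4] *)
pose e := Num.min (Num.min e1 e2) (128 * 256 * K)^-1.
have e0 : 0 < e by rewrite !lt_min e10 e20 invr_gt0 !mulr_gt0.
have sp1 : sparse rs e by apply: He1 => //; rewrite !ge_min lexx.
have sp2 : sparse rs' e by apply: He2 => //; rewrite !ge_min lexx !orbT.
have eK : K * e <= (128 * 256)^-1.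
  have : e <= (128 * 256 * K)^-1 by rewrite ge_min lexx orbT.
  by move=> /(ler_wpM2l (ltW K0)); rewrite invfM mulrCA mulfV ?mulr1// lt0r_neq0.
have e20' : 0 < e / 2 by rewrite divr_gt0.
have [t1 t10 Ht1] := Hrs _ e20'; have [t2 t20 Ht2] := Hrs' _ e20'.
exists (Num.min t1 t2); first by rewrite lt_min t10.
move=> f g u v z s c fg [hu uE] [hv vE] s0 c0 H.
have [mf mg _ _ _] := fg.
have cc : 0 < cabs c by rewrite cabs_gt0.
have near_w w : cabs (w - z) < s -> nbh w (fun x => x != w ->
    [/\ generic d f g x, close_to rs (e / 2) (finval f x) & close_to rs' (e / 2) (finval g x)]).
  move=> ws.
  apply: nbhS2 (nbhI (generic_near d w fg) (nbh_ball ws)) (nbhI (uE w) (vE w)).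
  move=> x [gx xs] [ux vx] xw; have {}gx := gx xw.
  have [rf rg fd gd fgx] := gx.
  have [Hu Hv] := H x xs.
  have rel := form_relation hP' fg gx; rewrite -ux// -vx// in rel.
  have Pxy : P.[finval f x] = P.[finval g x] by exact: nbh_center (refuting_val fg rf).
  have key : cabs (Q.[finval f x] + b * Q.[finval g x]) <= Num.min t1 t2 * (cabs Q.[finval f x] + cabs Q.[finval g x]).
    rewrite -(ler_pM2l cc) -cabsM.
    rewrite (_ : c * _ = (c - u x) * Q.[finval f x] + (b * c - v x) * Q.[finval g x]); last first.
      by rewrite -[LHS]subr0 -rel; ring.
    rewrite (le_trans (cabsD _ _))// !cabsM.
    move: (cabs Q.[finval f x]) (cabs Q.[finval g x]) (cabs_ge0 Q.[finval f x]) (cabs_ge0 Q.[finval g x]) => A B A0 B0.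
    rewrite [leRHS](_ : _ = Num.min t1 t2 * cabs c * A + Num.min t1 t2 * cabs c * B); last by ring.
    by apply: lerD; rewrite ler_wpM2r// cabsC.
  split=> //.
  - apply: (Ht1 _ (finval g x)) => //; rewrite mul1r (le_trans key)// ler_wpM2r ?addr_ge0 ?cabs_ge0//.
    by rewrite ge_min lexx.
  - apply: (Ht2 _ (finval f x)) => //; first by rewrite eq_sym.
    rewrite mul1r addrC (le_trans key)// [leRHS]mulrC [leLHS]mulrC [cabs Q.[finval g x] + _]addrC.
    by rewrite ler_wpM2l ?addr_ge0 ?cabs_ge0// ge_min lexx orbT.
have cf w : cabs (w - z) < s -> reg f w -> close_to rs e (finval f w).
  move=> ws rf; apply: close_to_lim => //; apply: nbhS (near_w w ws) => x Hx xw.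
  by have [] := Hx xw.
have cg w : cabs (w - z) < s -> reg g w -> close_to rs' e (finval g w).
  move=> ws rf; apply: close_to_lim => //; apply: nbhS (near_w w ws) => x Hx xw.
  by have [] := Hx xw.
have zs : cabs (z - z) < s / 2 by rewrite subrr cabs0 divr_gt0.
have small : nbh z (fun w => w != z -> cabs (u w) <= K * (4096 * e / s)).
  apply: nbhS2 (nbhI (uE z) (nbh_ball zs)) (generic_near d z fg) => w [uw ws] gw wz.
  rewrite uw//; have {}gw := gw wz; have [rf rg fd gd _] := gw.
  apply: le_trans (HK _ _ (cderiv (finval f) w) (cderiv (finval g) w) _) _.
    split=> //; first exact: nbh_center (refuting_val fg rf).
    exact: (refuting_cderiv fg rf).
  rewrite ler_wpM2l ?(ltW K0)//.
  have := spherical_small e0 sp1 mf s0 cf ws rf.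
  have := spherical_small e0 sp2 mg s0 cg ws rg.
  by rewrite (_ : 4096 * e / s = 2048 * e / s + 2048 * e / s); [lra|field; exact: lt0r_neq0].
have bound : cabs (u z) <= 2 * (K * (4096 * e / s)).
  have k0 : 0 < K * (4096 * e / s) by rewrite mulr_gt0// divr_gt0// mulr_gt0.
  rewrite leNgt; apply/negP => lt; have uz : u z != 0 by rewrite -cabs_gt0 (lt_trans _ lt)// mulr_gt0.
  have [w wz [uw1 uw2]] : exists2 w, w != z & cabs (u z) / 2 < cabs (u w) /\ cabs (u w) <= K * (4096 * e / s).
    apply: nbh_punctured_ex; apply: nbhS2 small (ccont_neq0 (holo_ccont (hu z)) uz) => w Hw ? /Hw.
    by [].
  by lra.
apply: (@le_lt_trans _ _ (s * (2 * (K * (4096 * e / s))))); first by rewrite ler_wpM2l// ltW.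
rewrite (_ : s * _ = 8192 * (K * e)); last by field; exact: lt0r_neq0.
by apply: (@le_lt_trans _ _ (8192 * (128 * 256)^-1)); [rewrite ler_wpM2l|lra].
Qed.

End uniqueness.

(** * Uniqueness *)

Section conclusion.
Variable R : realType.
Local Notation C := R[i].
Variables (P Q : {poly C}) (d : 'I_3 -> C).
Hypothesis hP' : P^`() = \prod_(j < 3) ('X - (d j)%:P) * Q.
Hypothesis dinj : injective d.
Hypothesis Qd : forall j, Q.[d j] != 0.
Hypothesis only_crit : forall j x, P.[x] = P.[d j] -> P^`().[x] = 0 -> x = d j.
Hypothesis Q'd : forall j, Q^`().[d j] != 0.
Hypothesis sP : (2 < size P)%N.
Hypothesis sQ : (1 < size Q)%N.
Implicit Types (f g : C -> option C) (x y z w b : C) (i j : 'I_3).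

Lemma derivative_neq0 f z : meromorphic f -> ~ constant_fun f -> reg f z ->
  nbh z (fun w => w != z -> cderiv (finval f) w != 0).
Proof.
move=> mf cf rf; have [m [k [hk k0 fk]]] := reg_order (finval f z) mf cf rf.
case: m fk => [|m] fk.
  by have := nbh_center fk; rewrite subrr expr0 mul1r => /eqP; rewrite eq_sym (negPf k0).
pose l w := m.+1%:R * k w + (w - z) * cderiv k w.
have cl : ccont l z.
  apply: holo_ccont; apply: holoD; first by apply: holoM => //; exact: holo_cst.
  by apply: holoM; [apply: holoB; [exact: holo_id|exact: holo_cst]|exact: holo_cderiv].
have l0 : l z != 0 by rewrite /l subrr mul0r addr0 mulf_neq0// pnatr_eq0.
apply: nbhS2 (nbhI (nbh_open fk) hk) (ccont_nbh_neq0 cl l0) => w [fkw dk] lw wz.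
have -> : cderiv (finval f) w = (w - z) ^+ m * l w.
  have ds := cderX m.+1 (cderB (cder_id w) (cder_cst z w)).
  have dkw := cderD (cderM ds (cderivP dk)) (cder_cst (finval f z) w).
  rewrite (cderivE (eq_cder _ dkw)); last first.
    by apply: nbhS fkw => x /= <-; rewrite subrK.
  by rewrite /l /= exprS; ring.
by rewrite mulf_neq0// expf_neq0// subr_eq0.
Qed.

(** At a generic point only the factor [f'] could vanish. *)
Lemma form_nonzero f g u : refuting_pair P f g -> form_ext d f g u -> exists z, u z != 0.
Proof.
move=> fg [_ uE]; have [mf mg [cf _] _ _] := fg.
have [z _ gz] := nbh_punctured_ex (generic_near d 0 fg).
have rf : reg f z by case: gz.
have [w wz [gw [Dw uw]]] : exists2 w, w != z &
    generic d f g w /\ (cderiv (finval f) w != 0 /\ u w = curve_form d f g w).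
  apply: nbh_punctured_ex; apply: nbhS2 (generic_near d z fg) (nbhI (derivative_neq0 mf cf rf) (uE z)).
  by move=> w Hg [HD Hu] wz; split; [exact: Hg|split; [exact: HD|exact: Hu]].
have [_ _ _ gd fgw] := gw.
exists w; rewrite uw /curve_form mulf_neq0 ?invr_eq0 ?dprod_neq0//.
by rewrite mulf_neq0// subr_eq0.
Qed.

(** The constant of [forms_not_proportional] is locally uniform in [b], because
    a small change of [b] is absorbed by half of the tolerance. *)
Lemma uniform_forms : exists2 t, 0 < t & forall b, cabs b <= 1 -> forall f g u v z s (c : C),
  refuting_pair P f g -> form_ext d f g u -> form_ext d g f v -> 0 < s -> c != 0 ->
  (forall w, cabs (w - z) < s -> cabs (u w - c) <= t * cabs c /\ cabs (v w - b * c) <= t * cabs c) ->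
  s * cabs (u z) < 2^-1.
Proof.
pose S (b : C) (t : R) := forall f g u v z s (c : C),
  refuting_pair P f g -> form_ext d f g u -> form_ext d g f v -> 0 < s -> c != 0 ->
  (forall w, cabs (w - z) < s -> cabs (u w - c) <= t * cabs c /\ cabs (v w - b * c) <= t * cabs c) ->
  s * cabs (u z) < 2^-1.
apply: (@uniform_disc R S).
  move=> b t t' t'0 tt' H f g u v z s c fg hu hv s0 c0 Hw.
  apply: (H f g u v z s c fg hu hv s0 c0) => w ws; have [H1 H2] := Hw w ws.
  by split; [apply: (le_trans H1)|apply: (le_trans H2)]; rewrite ler_wpM2r ?cabs_ge0.
move=> b; have [t t0 Ht] := forms_not_proportional hP' dinj Qd only_crit Q'd sP sQ b.
exists (t / 2); first by rewrite divr_gt0.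
move=> b' bb' f g u v z s c fg hu hv s0 c0 Hw.
apply: (Ht f g u v z s c fg hu hv s0 c0) => w ws; have [H1 H2] := Hw w ws.
have cc := cabs_ge0 c; split; first by nra.
rewrite (_ : v w - b * c = (v w - b' * c) + (b' - b) * c); last by ring.
rewrite (le_trans (cabsD _ _))// cabsM.
have : cabs (b' - b) * cabs c <= t / 2 * cabs c by rewrite ler_wpM2r// ltW.
by lra.
Qed.

(** With [c = u z] and [b = v z / u z], which has modulus at most [1], Cauchy's
    estimate on the disc of radius [N / M] bounds the variation of [u] and [v] on
    the disc of radius [1 / M] by [2048 M / N <= t |c|], as [M <= 2 |c|]. *)
Lemma rescaling_contradiction t (N : R) f g u v z : 0 < t -> 16 <= N -> 4096 / t <= N ->
  (forall b, cabs b <= 1 -> forall f g u v z s (c : C),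
    refuting_pair P f g -> form_ext d f g u -> form_ext d g f v -> 0 < s -> c != 0 ->
    (forall w, cabs (w - z) < s -> cabs (u w - c) <= t * cabs c /\ cabs (v w - b * c) <= t * cabs c) ->
    s * cabs (u z) < 2^-1) ->
  refuting_pair P f g -> form_ext d f g u -> form_ext d g f v ->
  0 < cabs (u z) + cabs (v z) -> cabs (v z) <= cabs (u z) ->
  (forall w, cabs (w - z) < N / (cabs (u z) + cabs (v z)) ->
     cabs (u w) + cabs (v w) <= 2 * (cabs (u z) + cabs (v z))) -> False.
Proof.
move=> t0 N16 Nt H fg hu hv; set M := cabs (u z) + cabs (v z) => M0 vu small.
have u2 : M <= 2 * cabs (u z) by rewrite /M; lra.
have uz : u z != 0 by rewrite -cabs_gt0; lra.
have N0 : 0 < N by lra.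
have NM0 : 0 < N / M by rewrite divr_gt0.
have lip (h : C -> C) : (forall z, holo h z) ->
    (forall w, cabs (w - z) < N / M -> cabs (h w) <= 2 * M) ->
    forall w, cabs (w - z) < M^-1 -> cabs (h w - h z) <= t * cabs (u z).
  move=> hh hM w wM; have Mi : 0 < M^-1 by rewrite invr_gt0.
  have w16 : cabs (w - z) <= N / M / 16.
    by rewrite (le_trans (ltW wM))// mulrAC -[leLHS]mul1r ler_wpM2r ?(ltW Mi)//; lra.
  have := holo_lip NM0 (fun w ws => conj (nbh_center (hh w)) (hM w ws)) w16.
  move=> /le_trans; apply.
  apply: (@le_trans _ _ (1024 * (2 * M) / (N / M) * M^-1)).
    by rewrite ler_wpM2l ?(ltW wM)// !mulr_ge0 ?invr_ge0 ?mulr_ge0 ?(ltW M0) ?(ltW NM0) ?(ltW N0) ?invr_ge0 ?(ltW M0).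
  rewrite (_ : _ * M^-1 = 2048 * M / N); last by field; rewrite !lt0r_neq0.
  rewrite ler_pdivrMr//.
  have tN : 4096 <= t * N by rewrite mulrC -ler_pdivrMr.
  apply: (@le_trans _ _ (4096 * cabs (u z))); first by lra.
  by rewrite mulrAC ler_wpM2r ?cabs_ge0.
have Mi : 0 < M^-1 by rewrite invr_gt0.
have b1 : cabs (v z / u z) <= 1.
  by rewrite cabsM cabsV ler_pdivrMr ?cabs_gt0// mul1r.
have : M^-1 * cabs (u z) < 2^-1.
  apply: (H (v z / u z) b1 f g u v z M^-1 (u z) fg hu hv Mi uz) => w wM.
  split; first by apply: (lip u hu.1) => // x /small xM; apply: le_trans xM; rewrite lerDl cabs_ge0.
  rewrite divfK//; apply: (lip v hv.1) => // x /small xM; apply: le_trans xM.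
  by rewrite lerDr cabs_ge0.
by rewrite mulrC ltr_pdivrMr//; lra.
Qed.

Lemma no_refuting_pair f g : ~ refuting_pair P f g.
Proof.
move=> fg; have gf := refuting_sym fg; have sP1 := ltnW sP.
have [u hu] := entire_form hP' dinj Qd only_crit fg sP1.
have [v hv] := entire_form hP' dinj Qd only_crit gf sP1.
have [t t0 Ht] := uniform_forms.
have [z0 uz0] := form_nonzero fg hu.
pose M z := cabs (u z) + cabs (v z).
(* [16] for [holo_lip], [4096 / t] for the tolerance of [uniform_forms] *)
pose N := 16 + 4096 / t.
have Nt : 0 < 4096 / t by rewrite divr_gt0.
have N16 : 16 <= N by rewrite /N; lra.
have N0 : 0 < N by lra.
have tN : 4096 / t <= N by rewrite /N; lra.
have h2 : 0 < 2^-1 :> R by rewrite invr_gt0.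
have Mloc z : nbh z (fun w => M w < M z + 1).
  apply: nbhS2 (holo_ccont (hu.1 z) h2) (holo_ccont (hv.1 z) h2) => w H1 H2.
  have := cabs_subl (u w) (u z); have := cabs_subl (v w) (v z); rewrite /M; lra.
have M0 : 0 < M z0 by rewrite /M ltr_wpDr ?cabs_ge0// cabs_gt0.
have [z [Mz small]] := point_picking N0 Mloc M0.
have [vu|/ltW uv] := leP (cabs (v z)) (cabs (u z)).
  exact: (rescaling_contradiction t0 N16 tN Ht fg hu hv Mz vu small).
rewrite /M addrC in Mz small.
apply: (rescaling_contradiction t0 N16 tN Ht gf hv hu Mz uv) => w ws.
by rewrite addrC; exact: small.
Qed.

Lemma no_refuting_pair_UPM : UPM P.
Proof.
split; first exact: ltnW.
move=> f g mf mg cf cg e; apply: contrapT => n.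
by apply: (@no_refuting_pair f g); split.
Qed.

End conclusion.

Section columns.
Variable R : realType.
Local Notation C := R[i].
Implicit Types (P : {poly C}) (c : seq C) (x y : C).

(** A critical point of multiplicity one that belongs to [B_i(H_2)], when
    [B_i(H_2)] is a singleton, is alone in its column: its multiplicity beats
    every repeated one, so nothing is repeated, and then the bound on the
    maximum leaves only multiplicities that belong to [A_i(H_2)]. *)
Lemma column_singleton P c x : P^`() != 0 -> c \in columns P ->
  setB_H2 P c = [:: x] -> mup x P^`() = 1%N -> c = [:: x].
Proof.
move=> P'0 cP Bx x1; have xB : x \in setB_H2 P c by rewrite Bx mem_head.
have [d0 _ cE] : exists2 d0, d0 \in crit_points P & c = [seq y <- crit_points P | P.[y] == P.[d0]].
  by move: cP; rewrite mem_undup => /mapP[d0 ? ->]; exists d0.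
have pos q : q \in mults P c -> (0 < q)%N.
  move=> /mapP[y]; rewrite cE mem_filter (mem_crit_points _ P'0) => /andP[_ ry] ->.
  by rewrite -XsubC_dvd// dvdp_XsubCl.
move: xB; rewrite mem_filter x1 => /andP[/[!mem_filter] /andP[max1 /andP[/allP H1 A1]] xc].
set s := mults P c in pos max1 H1 A1 *.
have all_A q : q \in s -> q \in setA s.
  move=> qs; apply: contraTT (H1 q qs) => qA; rewrite qA /= -leqNgt; exact: pos.
have all_H1 q : q \in s -> q \in setA_H1 s.
  move=> qs; rewrite mem_filter all_A// andbT; apply/allP => q' q's.
  by rewrite all_A.
have all_H2 q : q \in s -> q \in setA_H2 s.
  move=> qs; rewrite mem_filter all_H1// andbT; have := pos q qs; move: max1.
  set m := \big[_/_]_(_ <- _) _; lia.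
rewrite -Bx /setB_H2; apply/esym/all_filterP/allP => y yc.
by apply: all_H2; apply/mapP; exists y.
Qed.

Lemma column_unique P c x y : P^`() != 0 -> c \in columns P -> c = [:: x] ->
  P.[y] = P.[x] -> P^`().[y] = 0 -> y = x.
Proof.
move=> P'0 cP cx Pyx P'y.
have [d0 _ cE] : exists2 d0, d0 \in crit_points P & c = [seq y <- crit_points P | P.[y] == P.[d0]].
  by move: cP; rewrite mem_undup => /mapP[d0 ? ->]; exists d0.
have xc : x \in c by rewrite cx mem_head.
have : y \in c.
  move: xc; rewrite cE !mem_filter !(mem_crit_points _ P'0) Pyx => /andP[-> _].
  by rewrite /= rootE P'y.
by rewrite cx inE => /eqP.
Qed.

End columns.

Theorem theorem3p6 (R : realType) (n : nat) (P Q : {poly R[i]})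
  (d : 'I_3 -> R[i])
  (hn : (6 <= n)%N)
  (degP : size P = n.+1)
  (ncipP : NCIP P)
  (simpleP : forall z : R[i], root P z -> mup z P = 1%N)
  (ht : t_H2 P = 3%N)
  (ht' : t'_H2 P = 3%N)
  (hB : perm_eq [seq setB_H2 P c | c <- columns P & setB_H2 P c != [::]]
                [seq [:: d j] | j <- enum 'I_3])
  (hP' : P^`() = \prod_(j < 3) ('X - (d j)%:P) * Q)
  (degQ : (3 <= size Q)%N)
  (simple_d : forall j : 'I_3, mup (d j) P^`() = 1%N)
  (ha : forall j : 'I_3, Q^`().[d j] != 0)
  (hb : forall i j k : 'I_3, uniq [:: i; j; k] ->
     Q^`().[d j] / Q.[d j] !=
     (2 * d i + 2 * d k - 4 * d j) / ((d j - d k) * (d j - d i)))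
  (hc : forall i j k : 'I_3, uniq [:: i; j; k] ->
     forall xi : R[i], xi != d k -> P.[xi] = P.[d k] ->
     Q.[xi] / Q.[d k] !=
     ((d k - d i) ^+ 2 * (d k - d j) ^+ 2) /
     ((xi - d i) ^+ 2 * (xi - d j) ^+ 2))
  (hi : forall i j k : 'I_3, uniq [:: i; j; k] ->
     d k != 2 * d i - d j \/
     (d k = 2 * d i - d j /\ Q^`().[d j] / Q.[d j] != 3 / (d k - d i))) :
  UPM P.
Proof.
have Q0 : Q != 0 by rewrite -size_poly_gt0; lia.
have prod0 : \prod_(j < 3) ('X - (d j)%:P) != 0 :> {poly R[i]}.
  by apply/prodf_neq0 => j _; rewrite polyXsubC_eq0.
have P'0 : P^`() != 0 by rewrite hP' mulf_neq0.
have not_double j p : P^`() = ('X - (d j)%:P) * p -> p.[d j] != 0.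
  move=> P'E; apply/negP => rp; have /factor_theorem[q pE] : root p (d j) by [].
  have : (2 <= mup (d j) P^`())%N.
    by rewrite mup_geq// P'E pE mulrCA dvdp_mull// expr2.
  by rewrite simple_d.
have rest j : (\prod_(k < 3 | k != j) ('X - (d k)%:P) * Q).[d j] != 0.
  by apply: not_double; rewrite mulrA hP' (bigD1 j).
have Qd j : Q.[d j] != 0.
  by apply: contra (rest j) => /eqP Qj; rewrite hornerM Qj mulr0.
have dinj : injective d.
  move=> j k djk; apply/eqP; apply: contraTT (rest j) => jk; rewrite negbK.
  rewrite hornerM horner_prod (bigD1 k) 1?eq_sym//= !hornerE djk subrr !mul0r//.
have only_crit j x : P.[x] = P.[d j] -> P^`().[x] = 0 -> x = d j.
  have : [:: d j] \in [seq setB_H2 P c | c <- columns P & setB_H2 P c != [::]].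
    by rewrite (perm_mem hB); apply/mapP; exists j => //; rewrite mem_enum.
  move=> /mapP[c]; rewrite mem_filter => /andP[_ cP] /esym Bc.
  have cE := column_singleton P'0 cP Bc (simple_d j).
  exact: (column_unique P'0 cP cE).
by apply: (no_refuting_pair_UPM hP' dinj Qd only_crit ha); rewrite ?degP; lia.
Qed.
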